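(* Let $G$ be a finite group and suppose that its commuting graph $\Gamma(G)$ has an isolated edge. Then $\Gamma(G)$ consists of isolated edges, cliques (connected components that are complete graphs) and at most one noncomplete connected component. Moreover, such a noncomplete component has diameter at most $5$.
   Context: For a group $G$ with centre $Z(G)$, the commuting graph $\Gamma(G)$ is the simple graph with vertex set $G\setminus Z(G)$ in which two distinct vertices $x,y$ are adjacent if and only if $xy=yx$. An edge $\{v,w\}$ is isolated if $\{v,w\}$ is the vertex set of a connected component of the graph. *)

(* Defs.v *)
From mathcomp Require Import all_boot all_fingroup all_solvable.

Set Implicit Arguments.
Unset Strict Implicit.
Unset Printing Implicit Defensive.

(* A finite simple graph is given by a finite type of vertices
   and an adjacency relation [e], meant to be symmetric and irreflexive. *)
Section FiniteGraphs.

Variables (T : finType) (e : rel T).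

Definition components : {set {set T}} :=
  equivalence_partition (connect e) [set: T].

(* Edges are represented by their two-element vertex sets. *)
Definition isolated_edges : {set {set T}} :=
  [set C in components | [exists v, exists w, e v w && (C == [set v; w])]].

(* A one-vertex component counts as a clique, and so does an isolated edge. *)
Definition cliques : {set {set T}} :=
  [set C in components | [forall x in C, forall y in C, (x != y) ==> e x y]].

Definition has_walk (x y : T) (n : nat) : bool :=
  [exists p : n.-tuple T, path e x p && (last x p == y)].

(* The least length of a walk from x to y.  If y is reachable from x, this is
   smaller than #|T|; otherwise the value is the default #|T|. *)
Definition distance (x y : T) : nat := find (has_walk x y) (iota 0 #|T|).

(* For a connected component C, distances in the whole graph agree with those
   in the subgraph induced on C. *)
Definition diameter (C : {set T}) : nat :=
  \max_(x in C) \max_(y in C) distance x y.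

End FiniteGraphs.

Section CommutingGraph.

Variables (gT : finGroupType) (G : {group gT}).

Definition noncentral : finType := {x : gT | x \in (G :\: 'Z(G))%g}.

Definition commuting_graph : rel noncentral :=
  [rel x y | (x != y) && (val x * val y == val y * val x)%g].

End CommutingGraph.

Arguments noncentral {gT} G.
Arguments commuting_graph {gT} G.

(* Main.v *)
(* An isolated edge {v, w} forces 'C_G[v] = Z(G) u {v, w}, so either Z(G) = 1 and
   v = u generates a self-centralizing subgroup of order 3, or #|Z(G)| = 2 and v
   maps to an involution of G / Z(G) with centralizer of order at most 4.

   In the first case N := 'O_3^'(G) is nilpotent, since u acts on it without fixed
   points.  Exactly two nontrivial irreducible characters do not vanish at u,
   with values 1 and -1 and degrees f and f + 1, and the class algebra constants
   they determine express #|G| through a few integers.  Counting the x for which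
   u x and u ^ 2 x both have order 3 (such an x commutes with x ^ u) bounds these
   integers, and G / N turns out to have order 3, 6, 60 or 168.  If N != 1, every
   involution centralizes an element of 'Z(N)^#, and 'Z(N)^# is a hub within two
   steps of every element whose centralizer does not have prime order.  If N = 1,
   only the order 168 needs work: any two involutions are at distance at most 3,
   and elements of even centralizer order commute with an involution.

   In the second case, fusion of the involutions of H := G / Z(G) leaves three
   possibilities: H has a central involution, or a nontrivial element of odd order
   with a centralizer of index at most 2, or centralizers so small that all
   centralizers of noncentral elements of G are abelian.  In the first two cases a
   noncentral y in G with #|G : 'C_G[y]| <= 2 is at distance at most 2 from every
   element outside the complete components, and in the third all components are
   complete. *)

Require Import Defs.
From Stdlib Require Import ZArith.
From mathcomp Require Import all_boot all_order all_fingroup all_solvable.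
From mathcomp Require Import all_algebra all_field all_character.
From mathcomp Require Import ring lra zify.

Set Implicit Arguments.
Unset Strict Implicit.
Unset Printing Implicit Defensive.

(** * The integers of the character theoretic parametrization *)

(** The class algebra constants alone leave infinitely many solutions in the degree [f], the value
    [a] and the multiplier [m], so an upper bound has to come from structure. The constant with all
    three classes equal to that of [u] forces exactly [m ^ 2 * (f ^ 2 + f + 1) / 3] of the elements
    [x] counted there. Each of them generates with its conjugate under [u] an abelian group
    normalized by [u]. If [x] has odd order, it lies in a maximal [u]-invariant subgroup of order
    prime to 6; two such subgroups have coprime orders or are conjugate under the normalizer of
    [<[u]>], so their elements are few. If [x] has even order, it centralizes a four-group. The
    margin left in the quadratic terms bounds [m * f], and a finite search remains.

    With a centre of order 2 the difficulty is to return from [H] to [G], as commuting in [H] does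
    not imply commuting in [G]. From the centre of [H], or from odd order, one can still lift to an
    element with at most two conjugates. Elsewhere only the orders of centralizers in [H] are known,
    which suffices to make those in [G] cyclic modulo a central subgroup. *)

Section ArithmeticBound.
Local Open Scope Z_scope.
Import Stdlib.ZArith.BinInt.

(** Since [n] is at most a constant times [m * (f + 1)], and the term with [M] has a quadratic part
    strictly below that of the left side, the last hypothesis bounds [m * f]. The constant 270
    rounds up what the first of the two cases yields. *)
Lemma sc3_arithmetic_bound (t r m k c2 n M : Z) :
  let f := t + 3 * r in
    0 < t -> 0 < r -> 0 < m -> 0 <= k -> 0 <= n -> 0 <= M ->
    12 * k * r = m * ((3 * t + r) * f + 3 * t + 5 * r) ->
    k + 2 <= c2 -> c2 <= 4 * m * r -> c2 * n = f * (f + 1) * m * m ->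
    M <= k -> M <= 4 * m * r - 2 - k ->
    m * m * (f * f + f + 1) <= 3 * (1 + 2 * (4 * m * r - 1) + M * (2 * m * r - 1) + 2 * (n - 1)) ->
  m * f < 270.
Proof.
move=> f t0 r0 m0 k0 n0 M0 Ek c2k c2c En Mk Mc leD.
have f0 : 0 < f by rewrite /f; lia.
have kn : (k + 2) * n <= f * (f + 1) * m * m by rewrite -En; apply: Z.mul_le_mono_nonneg_r.
have [le_tr|gt_tr] := Z_le_gt_dec (2 * t) (3 * r).
  have k12 : m * f <= 12 * k.
    apply: (Zmult_lt_0_le_reg_r _ _ r) => //.
    have -> : 12 * k * r = m * f * r + m * (3 * t * f + 3 * t + 5 * r) by rewrite Ek; ring.
    suff : 0 <= m * (3 * t * f + 3 * t + 5 * r) by lia.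
    apply: Z.mul_nonneg_nonneg; first lia.
    have : 0 <= t * f by apply: Z.mul_nonneg_nonneg; lia.
    lia.
  have n12 : n <= 12 * (f + 1) * m.
    apply: (Zmult_lt_0_le_reg_r _ _ (m * f)); first by apply: Z.mul_pos_pos.
    have : n * (m * f) <= n * (12 * (k + 2)) by apply: Z.mul_le_mono_nonneg_l; lia.
    lia.
  have kM : M * (2 * m * r - 1) <= k * (2 * m * r).
    apply: (Z.le_trans _ (M * (2 * m * r))).
      by apply: Z.mul_le_mono_nonneg_l; lia.
    by apply: Z.mul_le_mono_nonneg_r => //; apply: Z.mul_nonneg_nonneg; lia.
  have kr : 6 * k * (2 * m * r) = m * m * ((3 * t + r) * f + 3 * t + 5 * r).
    have -> : 6 * k * (2 * m * r) = m * (12 * k * r) by ring.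
    by rewrite Ek; ring.
  (* Up to a linear term, at least 7/9 of [f * f] survives after twice the left side has absorbed
     the [M] term; the worst case is [2 * t = 3 * r]. *)
  have quad : 7 * f * f - f <= 9 * (2 * (f * f + f) - ((3 * t + r) * f + 3 * t + 5 * r)).
    have : 0 <= (3 * r - 2 * t) * f by apply: Z.mul_nonneg_nonneg; lia.
    have -> : 9 * (2 * (f * f + f) - ((3 * t + r) * f + 3 * t + 5 * r)) =
              7 * f * f - f + 8 * ((3 * r - 2 * t) * f) + 4 * (3 * r - 2 * t).
      by rewrite /f; ring.
    lia.
  have mquad := Z.mul_le_mono_nonneg_l _ _ (m * m) (Z.mul_nonneg_nonneg _ _ (Z.lt_le_incl _ _ m0) (Z.lt_le_incl _ _ m0)) quad.
  have fin : m * m * (7 * f * f - f) <= m * (1440 * f + 1296).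
    have : 3 * r <= f by rewrite /f; lia.
    move/(Z.mul_le_mono_nonneg_l _ _ m (Z.lt_le_incl _ _ m0)).
    lia.
  have fin2 : m * (7 * f * f - f) <= 1440 * f + 1296.
    by apply: (Zmult_lt_0_le_reg_r _ _ m) => //; lia.
  have f4 : 4 <= f by rewrite /f; lia.
  have fin3 : m * (7 * f - 1) <= 1440 + 324.
    by apply: (Zmult_lt_0_le_reg_r _ _ f) => //; lia.
  have := Z.mul_le_mono_nonneg_l _ _ m (Z.lt_le_incl _ _ m0) f4.
  lia.
have tt : 0 <= t * r by apply: Z.mul_nonneg_nonneg; lia.
have rr : 0 < r * r by apply: Z.mul_pos_pos.
have k2 : 2 * m * r <= k.
  apply: (Zmult_lt_0_le_reg_r _ _ (12 * r)); first lia.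
  have : m * (24 * r * r) <= m * ((3 * t + r) * f + 3 * t + 5 * r).
    apply: Z.mul_le_mono_nonneg_l; first lia.
    have h1 : 0 <= (2 * t - 3 * r) * t by apply: Z.mul_nonneg_nonneg; lia.
    have h2 : 0 <= (2 * t - 3 * r) * r by apply: Z.mul_nonneg_nonneg; lia.
    rewrite /f; lia.
  lia.
(* Now [k <= 4 * m * r - 2] bounds [t] from above, so that [f] lies between [4.5 * r] and
   [5.6 * r]. *)
have t26 : 10 * t <= 26 * r.
  have [//|gt] := Z_le_gt_dec (10 * t) (26 * r); exfalso.
  have : m * (48 * r * r) < m * ((3 * t + r) * f + 3 * t + 5 * r).
    apply: Zmult_lt_compat_l => //.
    have h1 : 0 <= (10 * t - 26 * r) * t by apply: Z.mul_nonneg_nonneg; lia.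
    have h2 : 0 <= (10 * t - 26 * r) * r by apply: Z.mul_nonneg_nonneg; lia.
    rewrite /f; lia.
  have : 12 * k * r <= 12 * (4 * m * r - 2) * r by apply: Z.mul_le_mono_nonneg_r; lia.
  lia.
have nb : 10 * n <= 28 * (f + 1) * m.
  apply: (Zmult_lt_0_le_reg_r _ _ (2 * m * r)); first by apply: Z.mul_pos_pos; lia.
  have le1 : 2 * m * r * n <= f * (f + 1) * m * m.
    apply: Z.le_trans kn; apply: Z.mul_le_mono_nonneg_r => //; lia.
  have : 10 * f * ((f + 1) * m * m) <= 56 * r * ((f + 1) * m * m).
    apply: Z.mul_le_mono_nonneg_r; last by rewrite /f; lia.
    by repeat apply: Z.mul_nonneg_nonneg; lia.
  lia.
have MB : M * (2 * m * r - 1) <= (2 * m * r) * (2 * m * r).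
  by apply: Z.mul_le_mono_nonneg; lia.
have f45 : 81 * r * r <= 4 * f * f.
  have : 0 <= (2 * f - 9 * r) * (2 * f + 9 * r) by apply: Z.mul_nonneg_nonneg; lia.
  lia.
have mf45 := Z.mul_le_mono_nonneg_l _ _ (m * m) (Z.mul_nonneg_nonneg _ _ (Z.lt_le_incl _ _ m0) (Z.lt_le_incl _ _ m0)) f45.
have f56 : 10 * f <= 56 * r by rewrite /f; lia.
have mr : m * (33 * m * r * r) <= m * (96 * r + 378 * r + 68).
  have := Z.mul_le_mono_nonneg_l _ _ m (Z.lt_le_incl _ _ m0) f56.
  have : 0 <= m * m * f by repeat apply: Z.mul_nonneg_nonneg; lia.
  have : 0 <= m * m  by repeat apply: Z.mul_nonneg_nonneg; lia.
  lia.
have mr2 : 33 * m * r * r <= 474 * r + 68.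
  by apply: (Zmult_lt_0_le_reg_r _ _ m) => //; lia.
have mr3 : 33 * m * r <= 474 + 68.
  apply: (Zmult_lt_0_le_reg_r _ _ r) => //; lia.
have := Z.mul_le_mono_nonneg_l _ _ m (Z.lt_le_incl _ _ m0) f56.
lia.
Qed.

End ArithmeticBound.

Section ArithmeticCheck.
Local Open Scope Z_scope.
Import Stdlib.ZArith.BinInt.

(** Binary integers keep the enumeration fast. The divisions round, so their exactness is tested as
    well: a quadruple passes if it violates some constraint or is one of the three survivors listed
    last. *)
Definition sc3_arithmetic_ok (t r m e : Z) : bool :=
  let f := t + 3 * r in
  let k := m * ((3 * t + r) * f + 3 * t + 5 * r) / (12 * r) in
  let c := 4 * m * r in let c2 := 2 ^ e in
  let n := f * (f + 1) * m * m / c2 in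
  [|| [|| 270 <=? m * f, negb (t mod 3 =? 1),
        negb (12 * k * r =? m * ((3 * t + r) * f + 3 * t + 5 * r)),
        negb (c2 * (c / c2) =? c) | c2 <? k + 2],
      Z.even (c / c2), negb (c2 * n =? f * (f + 1) * m * m),
      Z.even n, n mod 3 =? 0,
      3 * (1 + 2 * (c - 1) + Z.min k (c - 2 - k) * (2 * m * r - 1) + 2 * (n - 1)) <?
        m * m * (f * f + f + 1),
      [&& t =? 1, r =? 1, m =? 1 & n =? 5],
      [&& t =? 1, r =? 2, m =? 1 & n =? 7] |
      [&& t =? 4, r =? 4, m =? 1 & n =? 17]].

Lemma sc3_arithmetic_check :
  all (fun r => all (fun t => all (fun m => all (fun e =>
    sc3_arithmetic_ok (Z.of_nat t) (Z.of_nat r) (Z.of_nat m) (Z.of_nat e)) (iota 1 9))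
     (iota 1 (269 %/ (t + 3 * r)))) (iota 1 (269 - 3 * r))) (iota 1 89).
Proof. by vm_compute. Qed.

End ArithmeticCheck.

(* In terms of the degree f and the value a at an involution of the character
   taking the value 1 at u, t = (f + 3a)/4, r = (f - a)/4 and #|G| = 3 f (f+1) m^2;
   c is the order of the centralizer of an involution, 2^e its 2-part, and n is the
   {2,3}'-part of #|G|. *)
Lemma sc3_arithmetic (t r m k e n P M : nat) :
  let f := t + 3 * r in let c := 4 * m * r in
    t %% 3 = 1 -> 0 < r -> 0 < m ->
    12 * k * r = m * ((3 * t + r) * f + 3 * t + 5 * r) ->
    2 ^ e %| c -> odd (c %/ 2 ^ e) -> k + 2 <= 2 ^ e ->
    2 ^ e * n = f * (f + 1) * m * m -> odd n -> n %% 3 != 0 ->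
    P %| n -> P %% 3 = 1 -> M <= k -> M + k + 2 <= c ->
    m * m * (f * f + f + 1) <= 3 * (1 + 2 * (c - 1) + M * (2 * m * r - 1) + 2 * (P - 1)) ->
  [/\ t = 1, r = 1 & m = 1] \/ [/\ t = 1, r = 2 & m = 1].
Proof.
move=> f c t3 r0 m0 Ek dvc oddc lek En oddn n3 dvP P3 leMk leMc leD.
have n0 : 0 < n by case: n oddn {En n3 dvP}.
have P0 : 0 < P by case: P P3 {dvP leD}.
have lePn : P <= n := dvdn_leq n0 dvP.
have c0 : 0 < c by rewrite !muln_gt0 m0 r0.
have t0 : 0 < t by case: t t3 {f Ek En leD}.
have f0 : 0 < f by rewrite /f addn_gt0 t0.
have lec : 2 ^ e <= c := dvdn_leq c0 dvc.
have leD' : m * m * (f * f + f + 1) <= 3 * (1 + 2 * (c - 1) + M * (2 * m * r - 1) + 2 * (n - 1)).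
  by apply: leq_trans leD _; rewrite leq_mul2l leq_add2l leq_mul2l leq_sub2r ?orbT.
have mr0 : 0 < m * r by rewrite muln_gt0 m0.
have mf : m * f < 270.
  have := @sc3_arithmetic_bound (Z.of_nat t) (Z.of_nat r) (Z.of_nat m) (Z.of_nat k)
     (Z.of_nat (2 ^ e)) (Z.of_nat n) (Z.of_nat M).
  move: (2 ^ e) lek En lec {dvc oddc} => c2 lek En lec.
  move=> /(_ ltac:(clear -t0; lia) ltac:(clear -r0; lia) ltac:(clear -m0; lia)).
  move=> /(_ ltac:(clear; lia) ltac:(clear; lia) ltac:(clear; lia)).
  move=> /(_ ltac:(clear -Ek; rewrite /f in Ek; lia) ltac:(clear -lek; lia)).
  move=> /(_ ltac:(clear -lec; rewrite /c in lec; lia) ltac:(clear -En; rewrite /f in En; lia)).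
  move=> /(_ ltac:(clear -leMk; lia) ltac:(clear -leMc; rewrite /c in leMc; lia)).
  move=> /(_ ltac:(clear -leD' n0 c0 mr0; rewrite /f /c in leD' c0; lia)).
  by clear; rewrite /f; lia.
have lr : 3 * r * m + m <= m * f by rewrite /f; clear -t0 m0; nia.
have r89 : r \in iota 1 89 by rewrite mem_iota; clear -lr mf r0 m0; nia.
have tr : t \in iota 1 (269 - 3 * r).
  by rewrite mem_iota; clear -t0 mf m0; rewrite /f in mf *; nia.
have mr : m \in iota 1 (269 %/ f) by rewrite mem_iota m0 add1n ltnS leq_divRL // -ltnS.
have e1 : 0 < e by case: e lek {dvc oddc En lec} => //; rewrite addn2.
have e8 : e < 10.
  suff : 2 ^ e < 2 ^ 10 by rewrite ltn_exp2l.
  apply: leq_ltn_trans lec _; rewrite /c (_ : 2 ^ 10 = 1024) //.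
  by clear -mf lr; lia.
have er : e \in iota 1 9 by rewrite mem_iota e1.
have /allP/(_ r r89)/allP/(_ t tr)/allP/(_ m mr)/allP/(_ e er) := sc3_arithmetic_check.
have c2E : Z.pow 2 (Z.of_nat e) = Z.of_nat (2 ^ e).
  elim: (e) => // i IHi; rewrite Nat2Z.inj_succ Z.pow_succ_r; last exact: Nat2Z.is_nonneg.
  by rewrite IHi expnS; clear; lia.
have c20 : 0 < 2 ^ e by rewrite expn_gt0.
have [q def_c] := dvdnP dvc.
move: oddc; rewrite def_c mulnK // => oddq.
rewrite /sc3_arithmetic_ok c2E.
move: {lec dvc e8 e1 er c2E} (2 ^ e) c20 def_c lek En => c2 c20 def_c lek En.
rewrite -(Z.div_unique_exact _ _ (Z.of_nat k)); first last.
- by clear -Ek; rewrite /f in Ek; lia.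
- by clear -r0; lia.
rewrite -(Z.div_unique_exact _ _ (Z.of_nat q)); first last.
- by clear -def_c; rewrite /c in def_c; lia.
- by clear -c20; lia.
rewrite -(Z.div_unique_exact _ _ (Z.of_nat n)); first last.
- by clear -En; rewrite /f in En; lia.
- by clear -c20; lia.
case/or4P.
- case/or4P; last case/orP.
  + by move/Z.leb_le; clear -mf; rewrite /f in mf *; lia.
  + by move/negP; case; apply/Z.eqb_eq/esym/(Z.mod_unique _ _ (Z.of_nat (t %/ 3))); have := divn_eq t 3;
    rewrite t3; clear; lia.
  + by move/negP; case; apply/Z.eqb_eq; clear -Ek; rewrite /f in Ek; lia.
  + by move/negP; case; apply/Z.eqb_eq; clear -def_c; rewrite /c in def_c; lia.
  by move/Z.ltb_lt; clear -lek; lia.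
- by move/Z.even_spec=> -[x]; clear -oddq; lia.
- by move/negP; case; apply/Z.eqb_eq; clear -En; rewrite /f in En; lia.
case/or4P.
- by move/Z.even_spec=> -[x]; clear -oddn; lia.
- move/Z.eqb_eq => n30; have := Z.div_mod (Z.of_nat n) 3; rewrite n30.
  by move=> /(_ ltac:(by [])); clear -n3; lia.
- move/Z.ltb_lt; clear -leD' leMk leMc n0 c0 mr0; rewrite /f /c in leD' leMc c0 *; nia.
case/or3P; case/and4P.
- by move=> /Z.eqb_eq h1 /Z.eqb_eq h2 /Z.eqb_eq h3 _; left; clear -h1 h2 h3; split; lia.
- by move=> /Z.eqb_eq h1 /Z.eqb_eq h2 /Z.eqb_eq h3 _; right; clear -h1 h2 h3; split; lia.
(* The survivor with [f = 16] meets all constraints on [n = 17]. But 17 is 2 modulo 3, so its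
   divisor [P] is 1, and the sharper bound with [P] in place of [n] fails. *)
move=> /Z.eqb_eq tE /Z.eqb_eq rE /Z.eqb_eq mE /Z.eqb_eq nE; exfalso.
have nE' : n = 17 by clear -nE; lia.
have P1 : P = 1.
  have : P %| 17 by rewrite -nE'.
  by case/(primeP (isT : prime 17)).2 => /orP[/eqP//|/eqP P17]; rewrite P17 in P3.
have [t4 r4 m1] : [/\ t = 4, r = 4 & m = 1] by clear -tE rE mE; split; lia.
subst t r m; have k6 : k = 6 by clear -Ek; rewrite /f in Ek; lia.
by clear -leD leMk k6 P1; rewrite /f /c in leD; lia.
Qed.

(** * Fusion in Sylow subgroups and normal complements *)

Import GroupScope.

Lemma involutionV (gT : finGroupType) (x : gT) : x ^+ 2 = 1 -> x^-1 = x.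
Proof. by move=> x2; apply/eqP; rewrite eq_invg_mul -(expgS x 1) x2. Qed.

Lemma order2_mul (gT : finGroupType) (s x : gT) :
  s ^+ 2 = 1 -> (s * x) ^+ 2 = 1 -> x ^ s = x^-1.
Proof.
move=> s2 sx2; apply: (mulIg x).
by rewrite mulVg conjgE (involutionV s2) -mulgA -mulgA mulgA -(expgS _ 1) sx2.
Qed.

Lemma mem_cycle_sub (gT : finGroupType) (H : {group gT}) x z :
  x \in H -> z \in <[x]> -> z \in H.
Proof. by rewrite -cycle_subG => /subsetP; apply. Qed.

Lemma in_set4 (T : finType) (a b c d x : T) :
  (x \in [set a; b; c; d]) = [|| x == a, x == b, x == c | x == d].
Proof. by rewrite !inE -!orbA. Qed.

Lemma four_set_sub (gT : finGroupType) (H : {group gT}) x y :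
  x \in H -> y \in H -> [set 1; x; y; x * y] \subset H.
Proof.
by move=> Hx Hy; apply/subsetP=> z; rewrite in_set4 => /or4P[]/eqP-> //; apply: groupM.
Qed.

(** Both [U] and [U :^ g] are Sylow in ['N_G(Y)], so an element of that normalizer carries one to
    the other and corrects [g] to an element normalizing [U]. *)
Lemma Sylow_norm_conj (gT : finGroupType) p (G U X Y : {group gT}) g :
    p.-Sylow(G) U -> g \in G -> U \subset 'N(X) -> U \subset 'N(Y) ->
    Y :=: X :^ g ->
  exists2 n, n \in 'N_G(U) & Y :=: X :^ n.
Proof.
move=> sylU Gg nXU nYU defY.
have sUG := pHall_sub sylU.
have sylUN : p.-Sylow('N_G(Y)) U.
  by apply: (pHall_subl _ _ sylU); rewrite ?subsetIl // subsetI sUG.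
have sylUgN : p.-Sylow('N_G(Y)) (U :^ g).
  have sUgG : U :^ g \subset G by rewrite -(conjGid Gg) conjSg.
  apply: (@pHall_subl _ _ G 'N_G(Y) (U :^ g)); rewrite ?subsetIl ?pHallJ //.
  by rewrite subsetI sUgG defY /= normJ conjSg.
have [h /setIP[Gh nYh] defU] := Sylow_trans sylUgN sylUN.
exists (g * h); last by rewrite conjsgM -defY (normP nYh).
by rewrite inE groupM //=; apply/normP; rewrite conjsgM.
Qed.

(** Burnside's fusion argument: [P] and [P :^ g] are both Sylow in the centralizer of [x ^ g], which
    contains them because [P] is abelian. *)
Lemma abelian_Sylow_fusion (gT : finGroupType) p (G P : {group gT}) x g :
    p.-Sylow(G) P -> abelian P -> x \in P -> g \in G -> x ^ g \in P ->
  exists2 n, n \in 'N_G(P) & x ^ g = x ^ n.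
Proof.
move=> sylP abP Px Gg Pxg; have sPG := pHall_sub sylP.
have sylP1 : p.-Sylow('C_G[x ^ g]) P.
  apply: (pHall_subl _ _ sylP); rewrite ?subsetIl // subsetI sPG /=.
  by rewrite sub_cent1 (subsetP abP).
have sylPg : p.-Sylow('C_G[x ^ g]) (P :^ g).
  have sPgG : P :^ g \subset G by rewrite -(conjGid Gg) conjSg.
  apply: (@pHall_subl _ _ G 'C_G[x ^ g] (P :^ g)); rewrite ?subsetIl ?pHallJ //.
  by rewrite subsetI sPgG /= cent1J conjSg sub_cent1 (subsetP abP).
have [h /setIP[Gh cxh] defP] := Sylow_trans sylPg sylP1.
exists (g * h); last by rewrite conjgM; apply/esym/conjg_fixP/commgP/commute_sym/cent1P.
by rewrite inE groupM //=; apply/normP; rewrite conjsgM.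
Qed.

(* The transfer into P is x |-> x ^+ #|G : P| on P, since fusion in an abelian
   Sylow subgroup is controlled by its normaliser, here its centraliser. *)
Lemma Burnside_normal_complement (gT : finGroupType) p (G P : {group gT}) :
    p.-Sylow(G) P -> abelian P -> 'N_G(P) \subset 'C(P) ->
  exists K : {group gT}, [/\ K <| G, p^'.-group K & K * P = G].
Proof.
move=> sylP abP sNC; have sPG := pHall_sub sylP.
have abA : abelian (idm P @* P) by rewrite morphim_idm.
pose tau := transfer_morphism G abA.
pose K := ('ker tau)%G.
have nKG : K <| G := ker_normal tau.
have tauP x : x \in P -> val (tau x) = x ^+ #|G : P|.
  move=> Px; have Gx := subsetP sPG x Px.
  pose X := transversal (rcosets P G :* <[x]>) G.
  have trX : is_transversal X (rcosets P G :* <[x]>) G.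
    apply: transversalP; exact: (rcosets_cycle_partition sPG Gx).
  rewrite /= /tau /= (transfer_cycle_expansion sPG abA Gx trX).
  rewrite -(sum_index_rcosets_cycle sPG Gx trX).
  rewrite FiniteModule.fmval_sum (big_morph _ (expgD x) (expg0 x)).
  apply: eq_bigr => y Xy.
  have Gy : y \in G by apply: (subsetP (transversal_sub trX)).
  have Pxy : (x ^+ #|<[x]> : P :* y|) ^ y^-1 \in P.
    have := mulg_exp_card_rcosets P x y.
    by rewrite mem_rcoset conjgE invgK mulgA.
  rewrite /restrm /= FiniteModule.fmodK; last by rewrite mem_morphim.
  have Gy1 : y^-1 \in G by rewrite groupV.
  have [n /(subsetP sNC) cPn ->] :=
    abelian_Sylow_fusion sylP abP (groupX _ Px) Gy1 Pxy.
  by apply/conjg_fixP/commgP/commute_sym/(centP cPn); rewrite groupX.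
(* By the power formula [tauP], the order of an element of [K :&: P] divides both [#|P|] and
   [#|G : P|]. *)
have tiKP : K :&: P = 1.
  apply/trivgP/subsetP=> x /setIP[Kx Px]; rewrite inE.
  have [_ pP p'iGP] := and3P sylP.
  have x1 : x ^+ #|G : P| = 1 by rewrite -tauP // (mker Kx).
  rewrite -order_eq1 -dvdn1.
  have co : coprime #|P| #|G : P| by apply: pnat_coprime pP p'iGP.
  by rewrite -(eqP co) dvdn_gcd order_dvdG //= order_dvdn x1.
have sylK1 : p.-Sylow(K) (K :&: P) by exact: Sylow_setI_normal nKG sylP.
have p'K : p^'.-group K.
  by rewrite /pgroup -partn_eq1 // -(card_Hall sylK1) /= tiKP cards1.
exists K; split => //.
have sKP : K * P \subset G by rewrite mul_subG // normal_sub.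
apply/eqP; rewrite eqEcard sKP /= TI_cardMg //.
rewrite -(Lagrange (normal_sub nKG)) leq_mul //.
rewrite -card_quotient ?normal_norm // (card_isog (first_isog tau)).
apply: leq_trans (max_card _) _.
rewrite -(card_imset predT (val_inj : injective val)) subset_leq_card //.
apply/subsetP => _ /imsetP[[y Ay] _ ->] /=.
by have := Ay; rewrite /= morphim_idm.
Qed.

(** * Commuting graphs *)

Lemma distance_le (T : finType) (e : rel T) x p n :
  path e x p -> size p <= n -> distance e x (last x p) <= n.
Proof.
move=> e_p le_p_n; apply: leq_trans le_p_n; rewrite leqNgt; apply/negP => lt_p.
have := before_find 0 lt_p; rewrite nth_iota.
  by case/existsP; exists (in_tuple p); rewrite /= e_p eqxx.
(* [distance] never exceeds its default value [#|T|], so [size p] is an index within [iota]. *)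
by apply: leq_trans lt_p _; rewrite /distance -{2}(size_iota 0 #|T|) find_size.
Qed.

(** The first two alternatives make the component of [x] or of [y] a clique. Vertices of noncomplete
    components, even of two different ones, thus fall under the third, which both connects them and
    bounds their distance. *)
Lemma one_noncomplete_component (T : finType) (e : rel T) n :
    symmetric e ->
    (forall x y, [\/ {in connect e x &, forall u w, u != w -> e u w},
                     {in connect e y &, forall u w, u != w -> e u w} |
                     exists2 p, path e x p & last x p = y /\ size p <= n]) ->
  #|components e :\: (isolated_edges e :|: cliques e)| <= 1
  /\ (forall C, C \in components e -> C \notin cliques e -> diameter e C <= n).
Proof.
move=> sym_e trich; have eqR : {in [set: T] & &, equivalence_rel (connect e)}.
  move=> x y z _ _ _; split=> [|xy]; first exact: connect0.
  exact: same_connect (sym_connect_sym sym_e) _ _ xy z.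
have compE C x : C \in components e -> x \in C -> C =i connect e x.
  move=> compC Cx y; have partP := equivalence_partitionP eqR.
  have [_ tiP _] := and3P partP.
  by rewrite -(def_pblock tiP compC Cx) pblock_equivalence_partition ?inE.
have comp_ex C : C \in components e -> exists x, x \in C.
  by case/imsetP=> x _ ->; exists x; rewrite !inE connect0.
have ncl C x : C \in components e -> C \notin cliques e ->
   x \in C -> {in connect e x &, forall u w, u != w -> e u w} -> False.
  move=> compC nclC Cx clx; case/negP: nclC; rewrite inE compC.
  apply/forall_inP=> u Cu; apply/forall_inP=> w Cw; apply/implyP.
  by apply: clx; rewrite -(compE C).
have near C D x y : C \in components e -> C \notin cliques e ->
    D \in components e -> D \notin cliques e -> x \in C -> y \in D ->
    exists2 p, path e x p & last x p = y /\ size p <= n.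
  move=> cC nC cD nD Cx Dy; case: (trich x y) => // cl.
    by case: (ncl _ _ cC nC Cx cl).
  by case: (ncl _ _ cD nD Dy cl).
split=> [|C cC nC]; last first.
  apply/bigmax_leqP=> x Cx; apply/bigmax_leqP=> y Cy.
  have [p e_p [<- le_p]] := near C C x y cC nC cC nC Cx Cy.
  exact: distance_le.
apply/card_le1_eqP => C D.
rewrite !in_setD !in_setU !negb_or -!andbA => /and3P[_ nC cC] /and3P[_ nD cD].
have [[x Cx] [y Dy]] := (comp_ex C cC, comp_ex D cD).
have [p e_p [def_y _]] := near C D x y cC nC cD nD Cx Dy.
apply/setP=> z; rewrite (compE _ _ cC Cx) (compE _ _ cD Dy).
symmetry; apply: same_connect; first exact: sym_connect_sym.
by apply/connectP; exists p.
Qed.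

Section CommutingGraph.

Variables (gT : finGroupType) (G : {group gT}).

(** For a noncentral [x] this makes ['C_G[x] :\: 'Z(G)] the component of [x], and a clique. *)
Definition centrally_closed x :=
  abelian 'C_G[x] && [forall y in 'C_G[x] :\: 'Z(G), 'C_G[y] \subset 'C_G[x]].

(** Equal consecutive elements are allowed, so that walks can be written down without checking which
    of their elements coincide; [commuting_step_walk] removes the repetitions. *)
Definition commuting_step := [rel x y : gT | (y \in G :\: 'Z(G)) && (y \in 'C[x])].

Lemma commuting_graphE (x y : noncentral G) :
  commuting_graph G x y = (x != y) && (val x * val y == val y * val x).
Proof. by []. Qed.

Lemma commuting_graph_sym : symmetric (commuting_graph G).
Proof.
by move=> x y; rewrite !commuting_graphE eq_sym [X in _ && X]eq_sym.
Qed.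

Lemma commuting_step_walk (x : noncentral G) s :
    path commuting_step (val x) s ->
  exists2 p, path (commuting_graph G) x p &
             val (last x p) = last (val x) s /\ size p <= size s.
Proof.
elim: s x => [|a s IHs] x /=; first by exists [::].
case/andP=> /andP[nZa /cent1P cxa]; rewrite -[a]/(val (Sub a nZa : noncentral G)).
move/IHs=> [p e_p [def_l le_p]]; case: (eqVneq x (Sub a nZa)) => [def_x | neq_xa].
  by exists p; rewrite ?def_x //; split=> //; apply: leqW.
exists (Sub a nZa :: p); last by [].
suff: commuting_graph G x (Sub a nZa) by move=> e_xa; apply/andP.
by rewrite commuting_graphE neq_xa; apply/eqP.
Qed.

Lemma centrally_closed_connect (x y : noncentral G) :
    centrally_closed (val x) -> connect (commuting_graph G) x y ->
  val y \in 'C_G[val x].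
Proof.
case/andP=> _ /forall_inP clx /connectP[p e_p ->] {y}.
elim/last_ind: p e_p => [_|p z IHp]; first by case/setDP: (valP x) => Gx _; rewrite inE Gx /= cent1id.
rewrite rcons_path last_rcons => /andP[/IHp cxl /andP[_ /eqP clz]].
have [Gz _] := setDP (valP z); have [_ nZl] := setDP (valP (last x p)).
have sC : 'C_G[val (last x p)] \subset 'C_G[val x].
  by apply: clx; rewrite inE nZl.
by rewrite (subsetP sC) // inE Gz; apply/cent1P.
Qed.

Lemma commuting_graph_theorem n :
    {in G :\: 'Z(G) &, forall x y,
       [\/ centrally_closed x, centrally_closed y |
           exists2 s, path commuting_step x s & last x s = y /\ size s <= n]} ->
  #|components (commuting_graph G) :\:
      (isolated_edges (commuting_graph G) :|: cliques (commuting_graph G))| <= 1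
  /\ (forall C : {set noncentral G},
        C \in components (commuting_graph G) ->
        C \notin cliques (commuting_graph G) ->
        diameter (commuting_graph G) C <= n).
Proof.
have cl (x : noncentral G) : centrally_closed (val x) ->
    {in connect (commuting_graph G) x &, forall u w, u != w -> commuting_graph G u w}.
  move=> ccx u w xu xw neq_uw; rewrite commuting_graphE neq_uw; apply/eqP.
  have [abx _] := andP ccx; apply: (centsP abx); exact: centrally_closed_connect.
move=> trich; apply: one_noncomplete_component; first exact: commuting_graph_sym.
move=> x y; case: (trich (val x) (val y) (valP x) (valP y)) => [/cl | /cl | [s]].
- by constructor 1.
- by constructor 2.
case/commuting_step_walk=> p e_p [def_l le_p] [def_y le_s]; constructor 3.
exists p => //; split; last exact: leq_trans le_p le_s.
by apply: val_inj; rewrite def_l def_y.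
Qed.

(** With abelian centralizers, commuting is transitive on noncentral elements. *)
Lemma abelian_cent_closed :
    {in G :\: 'Z(G), forall x, abelian 'C_G[x]} ->
  {in G :\: 'Z(G), forall x, centrally_closed x}.
Proof.
move=> abC x nZx; rewrite /centrally_closed abC //.
apply/forall_inP=> y /setDP[/setIP[Gy cxy] nZy].
have Gx : x \in G by case/setDP: nZx.
apply/subsetP=> z Cyz; rewrite inE (subsetP (subsetIl _ _) z Cyz) /=.
have abCy : abelian 'C_G[y] by apply: abC; rewrite inE nZy.
apply/cent1P/esym; apply: (centsP abCy); last exact: Cyz.
by rewrite inE Gx /= cent1C.
Qed.

(** Any nontrivial [y] in a group of prime order generates it, so everything that commutes with [y]
    commutes with [x]. *)
Lemma prime_cent_closed x :
  'Z(G) = 1 -> x \in G -> prime #|'C_G[x]| -> centrally_closed x.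
Proof.
move=> Z1 Gx pr; have cycC := prime_cyclic pr.
rewrite /centrally_closed cyclic_abelian //=.
apply/forall_inP=> y /setDP[Cy nZy].
have defC : 'C_G[x] = <[y]>.
  apply/eqP; rewrite eq_sym eqEcard cycle_subG Cy /=.
  have := cardSg (_ : <[y]> \subset 'C_G[x]); rewrite cycle_subG => /(_ Cy).
  case/((primeP pr).2)/pred2P=> [/eqP|->] //.
  by rewrite -/#[y] order_eq1 => /eqP y1; rewrite y1 Z1 inE eqxx in nZy.
have Cx : x \in <[y]> by rewrite -defC inE Gx cent1id.
have /cycleP[i ->] := Cx; apply/setIS/subsetP=> z /cent1P cyz.
by apply/cent1P/commuteX.
Qed.

End CommutingGraph.

(** * Self-centralizing subgroups of order 3 *)

(** The map sending [y] to [[~ u, y]] is injective on [M] because [u] has no fixed points there,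
    hence onto. So the coset of [u] modulo [M] consists of conjugates of [u]. *)
Lemma commgM_conj (gT : finGroupType) (M : {group gT}) u x :
    u \in 'N(M) -> 'C_M[u] = 1 -> x \in M -> exists2 y, y \in M & u * x = u ^ y.
Proof.
move=> nMu reg Mx.
have injf : {in M &, injective (commg u)}.
  move=> y z My Mz; rewrite !commgEl => /mulgI eq_yz.
  have : y * z^-1 \in 'C_M[u].
    rewrite inE groupM ?groupV //=; apply/cent1P/commute_sym/commgP/conjg_fixP.
    by rewrite conjgM eq_yz -conjgM mulgV conjg1.
  by rewrite reg => /set1P/(canRL (mulgK _)); rewrite mul1g invgK.
have defM : commg u @: M = M.
  apply/eqP; rewrite eqEcard card_in_imset // leqnn andbT.
  apply/subsetP=> _ /imsetP[y My ->].
  by rewrite commgEr groupM // memJ_norm ?groupV.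
have : x \in commg u @: M by rewrite defM.
by case/imsetP=> y My ->; exists y; rewrite // commgEl mulKVg.
Qed.

(** The relations define the Euclidean triangle group (3,3,3), with [u] a rotation by a third of a
    turn and [a] a translation. Translations commute, and the three rotated copies of [a] cancel. *)
Lemma triangle333 (gT : finGroupType) (u a : gT) :
    u ^+ 3 = 1 -> (u * a) ^+ 3 = 1 -> (u ^+ 2 * a) ^+ 3 = 1 ->
  commute a (a ^ u) /\ a ^ (u ^+ 2) * a ^ u * a = 1.
Proof.
move=> u3 e1 e2.
have uu : u^-1 * u^-1 = u.
  by apply: (mulgI (u * u)); rewrite -mulgA mulKVg mulgV -u3 !expgS expg0 mulg1 mulgA.
have uV : u^-1 = u ^+ 2 by apply: (mulgI u); rewrite mulgV -expgS.
have cube v : v^-1 * v^-1 = v -> (v * a) ^+ 3 = 1 -> a ^ (v ^+ 2) * a ^ v * a = 1.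
  by move=> vv <-; rewrite !expgS expg0 mulg1 !conjgE invMg !mulgA vv mulgK mulg1.
have {e1} := cube u uu e1.
have vv : u^-1^-1 * u^-1^-1 = u^-1 by rewrite invgK uV.
rewrite -uV in e2; have {e2} := cube _ vv e2.
have uV2 : u^-1 ^+ 2 = u by rewrite expgVn -uV invgK.
rewrite uV2 uV => e2 e1.
split=> //.
have u4 : u ^+ 2 * u ^+ 2 = u by rewrite -expgD expgS u3 mulg1.
have u3r : u * u ^+ 2 = 1 by rewrite -expgS.
have c12 : commute (a ^ u) (a ^ (u ^+ 2)).
  by apply: (mulIg a); rewrite e1 e2.
have := congr1 (conjg^~ (u ^+ 2)) c12.
by rewrite /= (conjMg (a ^ u)) (conjMg (a ^ _)) -!conjgM u3r u4 conjg1.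
Qed.

Section RegularOrder3.

Variables (gT : finGroupType) (M : {group gT}).

Lemma regular3_triangle u x :
    u \in 'N(M) -> u ^+ 3 = 1 -> 'C_M[u] = 1 -> x \in M ->
  commute x (x ^ u) /\ x ^ (u ^+ 2) * x ^ u * x = 1.
Proof.
move=> nMu u3 reg Mx.
have cube v : v \in 'N(M) -> v ^+ 3 = 1 -> 'C_M[v] = 1 -> (v * x) ^+ 3 = 1.
  by move=> nMv v3 /commgM_conj-/(_ x nMv Mx)[y _ ->]; rewrite -conjXg v3 conj1g.
have uV : u ^+ 2 = u^-1 by apply: (mulgI u); rewrite mulgV -expgS.
apply: triangle333 => //; apply: cube; rewrite // uV ?groupV // ?expgVn ?u3 ?invg1 //.
by rewrite -cent_cycle cycleV cent_cycle.
Qed.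

(** For [v] equal to [u] or its inverse and [z] in [M], the product [v * z] is again a conjugate of
    [v] under [M], so [x] commutes with [(x ^ v) ^ z] by the triangle relation. Since [x] is the
    inverse of the product of its two images, it commutes with its own conjugates too. *)
Lemma regular3_Engel u x y :
    u \in 'N(M) -> u ^+ 3 = 1 -> 'C_M[u] = 1 -> x \in M -> y \in M ->
  commute x (x ^ y).
Proof.
move=> nMu u3 reg Mx My.
have comm v z : v \in 'N(M) -> v ^+ 3 = 1 -> 'C_M[v] = 1 -> z \in M ->
    commute x ((x ^ v) ^ z).
  move=> nMv v3 regv Mz; have [w Mw def_vz] := commgM_conj nMv regv Mz.
  rewrite -conjgM def_vz; apply: (regular3_triangle _ _ _ Mx).1.
  - by rewrite groupJ // (subsetP (normG M)).
  - by rewrite -conjXg v3 conj1g.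
  by rewrite cent1J -(conjGid Mw) -conjIg regv conjs1g.
have uV : u^-1 = u ^+ 2 by apply: (mulgI u); rewrite mulgV -expgS.
have -> : x ^ y = ((x ^ (u ^+ 2)) ^ y * (x ^ u) ^ y)^-1.
  rewrite -conjMg -conjVg; congr (_ ^ y); apply/esym/eqP.
  by rewrite eq_invg_mul (regular3_triangle nMu u3 reg Mx).2.
apply/commuteV/commuteM; last exact: comm.
apply: comm; rewrite ?groupX //; first by rewrite -expgM -[(2 * 3)%N]/(3 * 2)%N expgM u3 expg1n.
by rewrite -uV -reg -!cent_cycle cycleV.
Qed.

(** All conjugates of [x] commute, so its normal closure is abelian and lies in the Fitting
    subgroup. *)
Lemma regular3_nil u :
  u \in 'N(M) -> u ^+ 3 = 1 -> 'C_M[u] = 1 -> nilpotent M.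
Proof.
move=> nMu u3 reg; suff /eqP <- : 'F(M) == M by apply: Fitting_nil.
rewrite eqEsubset Fitting_sub; apply/subsetP=> x Mx.
have sxM : <<x ^: M>> \subset M by rewrite gen_subG class_subG.
have nilx : nilpotent <<x ^: M>>.
  apply: abelian_nil; rewrite abelian_gen; apply/centsP.
  move=> _ /imsetP[y My ->] _ /imsetP[z Mz ->].
  rewrite -(mulgKV y z) conjgM; have := regular3_Engel nMu u3 reg Mx (groupM Mz (groupVr My)).
  by move/(congr1 (conjg^~ y)); rewrite !conjMg.
have nx : <<x ^: M>> <| M by rewrite /normal sxM norms_gen ?class_norm.
by apply: (subsetP (Fitting_max nx nilx)); rewrite mem_gen ?class_refl.
Qed.

End RegularOrder3.

Section SelfCentralizing3.

Variables (gT : finGroupType) (G : {group gT}) (u : gT).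
Hypotheses (Gu : u \in G) (ou : #[u] = 3) (cu : 'C_G[u] = <[u]>).

Lemma sc3_expg3 : u ^+ 3 = 1.
Proof. by rewrite -ou expg_order. Qed.

(** In a Sylow subgroup [P] containing [u], the nontrivial centre of [P] centralizes [u], so it is
    [<[u]>]; then [P] centralizes [u]. *)
Lemma sc3_Sylow : 3.-Sylow(G) <[u]>.
Proof.
have pu : 3.-group <[u]> by rewrite /pgroup -[#|<[u]>|]/#[u] ou.
have suG : <[u]> \subset G by rewrite cycle_subG.
have [P sylP suP] := Sylow_superset suG pu.
have [sPG pP _] := and3P sylP.
have Pu : u \in P by rewrite -cycle_subG.
have sZu : 'Z(P) \subset <[u]>.
  apply/subsetP=> z /centerP[Pz cPz]; rewrite -cu inE (subsetP sPG) //=.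
  exact/cent1P/cPz.
have pr : prime #|<[u]>| by rewrite -[#|<[u]>|]/#[u] ou.
have [sub | ti] := prime_subgroupVti 'Z(P) pr; last first.
  move: ti; rewrite (setIidPl sZu) => /eqP.
  rewrite (center_nil_eq1 (pgroup_nil pP)) => /eqP P1.
  by move: Pu; rewrite P1 inE => /eqP u1; have := ou; rewrite u1 order1.
suff defP : P :=: <[u]> by rewrite -defP.
apply/eqP; rewrite eqEsubset suP andbT -cu subsetI sPG /= sub_cent1.
by move: sub; rewrite cycle_subG => /setIP[].
Qed.

Lemma sc3_class y : y \in G -> #[y] = 3 ->
  exists2 g, g \in G & (y = u ^ g \/ y = u^-1 ^ g).
Proof.
move=> Gy oy; have py : 3.-group <[y]> by rewrite /pgroup -[#|<[y]>|]/#[y] oy.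
have syG : <[y]> \subset G by rewrite cycle_subG.
have [g Gg] := Sylow_subJ sc3_Sylow syG py.
rewrite cycle_subG mem_conjg => /cycleP[k def_y]; exists g => //.
have {def_y} : y ^ g^-1 = u ^+ (k %% 3) by rewrite def_y -ou expg_mod_order.
have := ltn_pmod k (isT : 0 < 3); case: (k %% 3) => [|[|[|//]]] _ def_y.
- move: oy; rewrite -(orderJ y g^-1) def_y order1 //.
- by left; rewrite -[u]def_y conjgKV.
right; rewrite -[y](conjgKV g) def_y; congr (_ ^ g).
by apply: (mulgI u); rewrite mulgV -expgS sc3_expg3.
Qed.

Lemma sc3_cent y : y \in G -> #[y] = 3 -> 'C_G[y] = <[y]>.
Proof.
move=> Gy oy; have [g Gg [->|->]] := sc3_class Gy oy.
  by rewrite cent1J -{1}(conjGid Gg) -conjIg cu -cycleJ.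
rewrite cent1J -{1}(conjGid Gg) -conjIg cycleJ cycleV -cu.
by rewrite -!cent_cycle cycleV.
Qed.

Lemma sc3_comm y z : y \in G -> #[y] = 3 -> z \in G -> coprime 3 #[z] ->
  commute y z -> z = 1.
Proof.
move=> Gy oy Gz coz cyz; apply/eqP; rewrite -order_eq1 -dvdn1.
rewrite -(eqP coz) dvdn_gcd dvdnn andbT -oy.
have : z \in 'C_G[y] by rewrite inE Gz; apply/cent1P/commute_sym.
by rewrite sc3_cent // => /order_dvdG.
Qed.

Lemma sc3_regular (K : {group gT}) y : K \subset G -> coprime 3 #|K| ->
  y \in G -> #[y] = 3 -> 'C_K[y] = 1.
Proof.
move=> sKG coK Gy oy; apply/trivgP/subsetP=> z /setIP[Kz /cent1P cyz].
rewrite inE; apply/eqP; apply: (sc3_comm Gy oy) (commute_sym cyz).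
  exact: (subsetP sKG).
exact: coprime_dvdr (order_dvdG Kz) coK.
Qed.

Lemma sc3_nil (K : {group gT}) : K \subset G -> coprime 3 #|K| ->
  u \in 'N(K) -> nilpotent K.
Proof.
by move=> sKG coK nKu; apply: (regular3_nil nKu sc3_expg3); apply: sc3_regular.
Qed.

Lemma sc3_cent_coprime (R : {group gT}) z : R \subset G -> z \in G ->
  z != 1 -> coprime 3 #[z] -> R \subset 'C[z] -> coprime 3 #|R|.
Proof.
move=> sRG Gz ntz coz cRz; rewrite prime_coprime //; apply/negP.
case/Cauchy=> // y Ry oy; case/eqP: ntz.
apply: (sc3_comm (subsetP sRG y Ry) oy Gz coz).
by apply/cent1P; apply: (subsetP cRz).
Qed.

Lemma sc3_norm_cases n : n \in 'N_G(<[u]>) ->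
  u ^ n = u /\ n \in <[u]> \/ u ^ n = u^-1.
Proof.
case/setIP=> Gn nun; have : u ^ n \in <[u]> by rewrite memJ_norm ?cycle_id.
case/cycleP=> k def_un.
have {}def_un : u ^ n = u ^+ (k %% 3) by rewrite def_un -ou expg_mod_order.
have := ltn_pmod k (isT : 0 < 3).
case: (k %% 3) def_un => [|[|[|//]]] def_un _.
- by have := ou; rewrite -(orderJ u n) def_un order1.
- left; split=> //; rewrite -cu inE Gn; apply/cent1P/commute_sym/commgP.
  exact/conjg_fixP.
by right; rewrite def_un; apply: (mulgI u); rewrite mulgV -expgS sc3_expg3.
Qed.

Lemma sc3_neqV : u != u^-1.
Proof. by rewrite eq_sym eq_invg_mul -(expgS u 1) -order_dvdn ou. Qed.

Lemma sc3_inverting g : g \in G -> u ^ g = u^-1 ->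
  exists t, [/\ t \in G, #[t] = 2 & u ^ t = u^-1].
Proof.
move=> Gg ug; have ugg : u ^ (g ^+ 2) = u by rewrite conjgM ug conjVg ug invgK.
(* [g ^+ 2] centralizes [u], so its order divides 3; hence the odd power [g ^+ 3] squares to 1 and
   still inverts [u]. *)
exists (g ^+ 3); have ug3 : u ^ (g ^+ 3) = u^-1 by rewrite (expgS g 2) conjgM ug conjVg ugg.
split=> //; first by rewrite groupX.
apply: nt_prime_order => //.
  rewrite -expgM mulnC expgM.
  have : g ^+ 2 \in <[u]>.
    rewrite -cu inE groupX //; apply/cent1P/commute_sym/commgP/conjg_fixP => //.
  by move/order_dvdG; rewrite -[#|_|]/#[u] ou => /dvdnP[k k3]; apply/eqP; rewrite -order_dvdn k3 dvdn_mull.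
by apply/eqP=> g31; have := sc3_neqV; rewrite -ug3 g31 conjg1 eqxx.
Qed.

Lemma sc3_norm_index t : t \in G -> u ^ t = u^-1 ->
  forall n, n \in 'N_G(<[u]>) -> n \in <[u]> \/ n * t \in <[u]>.
Proof.
move=> Gt ut n Nn; have [[_ un] | un] := sc3_norm_cases Nn; [by left | right].
rewrite -cu inE groupM //; last by case/setIP: Nn.
by apply/cent1P/commute_sym/commgP/conjg_fixP; rewrite conjgM un conjVg ut invgK.
Qed.

Lemma sc3_coprime_pcore : coprime 3 #|'O_3^'(G)|.
Proof. by rewrite prime_coprime // -p'natE //; apply: pcore_pgroup. Qed.

(** For [x] in [X], [u * x] is a conjugate of [u], so it lies in the normal subgroup ['O_3^'(G) <*>
    <[u]>]. Then so does [x], and the elements of order prime to 3 in this subgroup form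
    ['O_3^'(G)]. *)
Lemma sc3_split_sub (X : {group gT}) :
    'O_3^'(G) * 'N_G(<[u]>) = G -> X \subset G -> u \in 'N(X) ->
  coprime 3 #|X| -> X \subset 'O_3^'(G).
Proof.
move=> defG sXG nXu coX; set N := 'O_3^'(G).
have nNG : N <| G by apply: pcore_normal.
have nNU : <[u]> \subset 'N(N) by rewrite cycle_subG (subsetP (normal_norm nNG)).
have nUN : N <*> <[u]> <| G.
  rewrite /normal join_subG (normal_sub nNG) cycle_subG Gu /=.
  rewrite -{1}defG mulG_subG; apply/andP; split.
    exact: subset_trans (joing_subl _ _) (normG _).
  by rewrite normsY ?subsetIr //= subIset // normal_norm.
have cardNU : #|N <*> <[u]>| = (#|N| * 3)%N.
  rewrite norm_joinEr // coprime_cardMg -?[#|<[u]>|]/#[u] ou //.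
  by rewrite coprime_sym sc3_coprime_pcore.
have hallN : 3^'.-Hall(N <*> <[u]>) N.
  rewrite /pHall joing_subl pcore_pgroup pnatNK.
  by rewrite -divgS ?joing_subl //= cardNU mulKn ?cardG_gt0.
apply/subsetP=> x Xx.
have [y Xy def_ux] := commgM_conj nXu (sc3_regular sXG coX Gu ou) Xx.
have nN : N <| N <*> <[u]> by rewrite normalYl.
rewrite (mem_normal_Hall hallN nN).
  rewrite /p_elt; apply: pnat_dvd (order_dvdG Xx) _.
  by rewrite p'natE // -prime_coprime.
have Uu : u \in N <*> <[u]> by rewrite mem_gen // inE cycle_id orbT.
by rewrite -(groupMl _ Uu) def_ux memJ_norm // (subsetP (normal_norm nUN)) // (subsetP sXG).
Qed.

End SelfCentralizing3.

(** * Characters of a group with a self-centralizing subgroup of order 3 *)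

Section Characters.
Import Order.TTheory GRing.Theory Num.Theory GroupScope.
Local Open Scope ring_scope.

(** Here [n] is the multiplicity of the trivial character in the restriction to [H]. *)
Lemma char_sum_nat (gT : finGroupType) (G H : {group gT}) (chi : 'CF(G)) :
    H \subset G -> chi \is a character ->
  exists n : nat, \sum_(x in H) chi x = (n * #|H|)%N%:R.
Proof.
move=> sHG Nchi; have := Cnat_cfdot_char (cfRes_char H Nchi) (cfun1_char H).
case/natrP=> n; rewrite cfdotE => /(canRL (mulVKf (neq0CG H))) sum_chi.
exists n; rewrite mulnC natrM -sum_chi; apply: eq_bigr => x Hx.
by rewrite cfun1E Hx conjC1 mulr1 cfResE.
Qed.

Lemma cycle2E (gT : finGroupType) (x : gT) : #[x]%g = 2%N -> <[x]>%g = [set 1%g; x].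
Proof.
move=> ox; apply/esym/eqP; rewrite eqEcard subUset !sub1set group1 cycle_id /=.
by rewrite -[#|<[x]>%g|]/#[x]%g ox cards2 eq_sym -order_eq1 ox.
Qed.

Lemma cycle3E (gT : finGroupType) (x : gT) :
  #[x]%g = 3%N -> <[x]>%g = [set 1%g; x; x^-1%g].
Proof.
move=> ox; apply/esym/eqP; rewrite eqEcard !subUset !sub1set group1 groupV cycle_id /=.
rewrite -[#|<[x]>%g|]/#[x]%g ox [[set 1%g; x]]setUC -setUA cardsU1 cards2 !inE.
have nx1 : x != 1%g by rewrite -order_eq1 ox.
rewrite (negPf nx1) eq_sym (eq_sym 1%g) eq_invg1 nx1 /= eq_invg_mul.
by rewrite -(expgS x 1) -order_dvdn ox.
Qed.


Section Characters3.

Variables (gT : finGroupType) (G : {group gT}) (u t : gT).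
Hypotheses (Gu : u \in G) (ou : #[u]%g = 3%N) (cu : ('C_G[u] = <[u]>)%g).
Hypotheses (Gt : t \in G) (ot : #[t]%g = 2%N) (ut : (u ^ t = u^-1)%g).

Lemma sc3_classE y : (y \in u ^: G)%g = (y \in G) && (#[y]%g == 3%N).
Proof.
apply/idP/andP=> [/imsetP[g Gg ->] | [Gy /eqP oy]].
  by rewrite groupJ // orderJ ou.
have [g Gg [->|->]] := sc3_class Gu ou cu Gy oy; first exact: memJ_class.
by rewrite -ut -conjgM memJ_class // groupM.
Qed.

Lemma sc3_irrV i : 'chi[G]_i u^-1%g = 'chi_i u.
Proof. by rewrite -ut cfunJ. Qed.

Lemma sc3_irr_conj i : ('chi[G]_i u)^* = 'chi_i u.
Proof. by rewrite -irr_inv sc3_irrV. Qed.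

Lemma sc3_irr_sum i : exists n : nat, 'chi[G]_i 1%g + 'chi_i u *+ 2 = (n * 3)%N%:R.
Proof.
have suG : (<[u]> \subset G)%g by rewrite cycle_subG.
have [n] := char_sum_nat suG (irr_char i).
rewrite -[#|<[u]>%g|]/#[u]%g ou => sum_n; exists n; rewrite -sum_n.
have nu1 : 1%g != u by rewrite eq_sym -order_eq1 ou.
have nuV1 : 1%g != u^-1%g by rewrite eq_sym eq_invg1 -order_eq1 ou.
rewrite /= cycle3E // -setUA big_setU1 ?inE ?negb_or ?nu1 //=.
by rewrite big_setU1 ?inE ?(sc3_neqV ou) //= big_set1 sc3_irrV mulr2n.
Qed.

Lemma sc3_irr_int i : 'chi[G]_i u \in Num.int.
Proof.
apply: Cint_rat_Aint (Aint_irr i u).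
have [n] := sc3_irr_sum i; have /natrP[d ->] := Cnat_irr1 i.
move/(canRL (addKr _)); rewrite -(mulr_natr ('chi_i u)).
have nz2 : 2 != 0 :> algC by rewrite pnatr_eq0.
move/(canRL (mulfK nz2)) => ->.
by rewrite rpred_div ?rpredD ?rpredN ?rpred_nat.
Qed.

(** The squares in the column of [u] add up to 3 and its entries are integers, so besides the
    trivial character there is room for two values of absolute value 1. Orthogonality with the
    column of degrees fixes the signs and the difference of the degrees. *)
Lemma sc3_irr_values : exists i1 i2 : Iirr G,
  [/\ [/\ i1 != 0, i2 != 0 & i1 != i2], 'chi_i1 u = 1, 'chi_i2 u = -1,
      'chi_i2 1%g = 'chi_i1 1%g + 1 &
      forall i, i != 0 -> i != i1 -> i != i2 -> 'chi_i u = 0].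
Proof.
have nz_sqr (x : algC) : x \in Num.int -> x != 0 -> 1 <= x ^+ 2.
  by move=> Zx nzx; apply: sqr_intr_ge1.
have sum2 : \sum_(i | i != 0) 'chi[G]_i u ^+ 2 = 2.
  have := second_orthogonality_relation u Gu.
  rewrite class_refl cu -[#|<[u]>%g|]/#[u]%g ou (bigD1 0) //= irr0 cfun1E Gu.
  rewrite conjC1 mulr1 => /(canRL (addKr _)) sum3.
  transitivity (3%:R - 1 : algC); last by ring.
  rewrite addrC -sum3; apply: eq_bigr => i _.
  by rewrite sc3_irr_conj expr2.
have sum1 : \sum_(i | i != 0) 'chi[G]_i 1%g * 'chi_i u = -1.
  have := second_orthogonality_relation 1%g Gu.
  rewrite sc3_classE order1 andbF (bigD1 0) //= irr0 !cfun1E Gu group1.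
  rewrite conjC1 mulr1 => /(canRL (addKr _)) sum3.
  rewrite addr0 in sum3; rewrite -sum3; apply: eq_bigr => i _.
  by rewrite sc3_irr_conj.
have real i : 'chi[G]_i u \is Num.real by apply: Rreal_int; apply: sc3_irr_int.
have [i2 nz2 neg2] : exists2 i2 : Iirr G, i2 != 0 & 'chi_i2 u < 0.
  apply/exists_inP; apply: contraT => /exists_inPn pos.
  have : 0 <= \sum_(i | i != 0) 'chi[G]_i 1%g * 'chi_i u.
    apply: sumr_ge0 => i nzi; apply: mulr_ge0; first exact/ltW/irr1_gt0.
    by rewrite real_leNgt ?real0 // pos.
  by rewrite sum1 oppr_ge0 ler10.
have sum2_pos P : 0 <= \sum_(i | P i) 'chi[G]_i u ^+ 2.
  by apply: sumr_ge0 => i _; rewrite real_exprn_even_ge0.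
have v2 : 'chi_i2 u = -1.
  move: neg2; have le2 : 'chi_i2 u ^+ 2 <= 2.
    by rewrite -sum2 (bigD1 i2) //= lerDl.
  move: le2; have /intrP[z ->] := sc3_irr_int i2.
  rewrite ltrz0 -rmorphXn /= -[2]/(2%:~R) ler_int => le2 neg2.
  by have -> : z = -1 by nia.
have sum2' : \sum_(i | (i != 0) && (i != i2)) 'chi[G]_i u ^+ 2 = 1.
  move: sum2; rewrite (bigD1 i2) //= v2 => /(canRL (addKr _)) ->.
  by rewrite sqrrN expr1n; ring.
have [i1 /andP[nz1 n12] nzv1] : exists2 i1 : Iirr G, (i1 != 0) && (i1 != i2) & 'chi_i1 u != 0.
  apply/exists_inP; apply: contraT => /exists_inPn zero.
  move/eqP: sum2'; rewrite big1 ?(eq_sym 0) ?oner_eq0 // => i /zero.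
  by rewrite negbK => /eqP->; rewrite expr0n.
have v1 : 'chi_i1 u ^+ 2 = 1.
  apply/eqP; rewrite eq_le nz_sqr ?sc3_irr_int // andbT.
  by rewrite -sum2' (bigD1 i1) ?nz1 //= lerDl.
have zero i : i != 0 -> i != i1 -> i != i2 -> 'chi_i u = 0.
  move=> nzi n1 n2; apply/eqP; rewrite -sqrf_eq0; apply/eqP.
  move: sum2'; rewrite (bigD1 i1) ?nz1 //= v1 => /(canRL (addKr _)).
  rewrite addNr => /psumr_eq0P; apply; last by rewrite nzi n2.
  by move=> j _; rewrite real_exprn_even_ge0.
have sum12 : 'chi_i1 1%g * 'chi_i1 u - 'chi_i2 1%g = -1.
  rewrite -sum1 (bigD1 i2) //= (bigD1 i1) ?nz1 //= big1 ?addr0.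
    by rewrite v2 mulrN1 addrC.
  by move=> i /andP[/andP[nzi n2] n1]; rewrite zero ?mulr0.
have /eqP := v1; rewrite sqrf_eq1 => /orP[] /eqP v1'.
  exists i1, i2; split=> //; move: sum12; rewrite v1' mulr1 => e.
  by have := congr1 (fun z => 'chi_i1 1%g - z) e; rewrite /= subKr opprK.
move: sum12; rewrite v1' mulrN1 -opprD => /oppr_inj.
have /natrP[d1 d1E] := Cnat_irr1 i1; have /natrP[d2 d2E] := Cnat_irr1 i2.
have := irr1_gt0 i1; have := irr1_gt0 i2; rewrite d1E d2E !ltr0n => p1 p2.
rewrite -natrD => /eqP; rewrite pnatr_eq1 => /eqP; lia.
Qed.

(** The character formula for class algebra constants, reduced to the three characters that do not
    vanish at [u]. *)
Lemma sc3_structure i1 i2 x y :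
    [/\ i1 != 0, i2 != 0 & i1 != i2] -> 'chi_i1 u = 1 -> 'chi_i2 u = -1 ->
    (forall i, i != 0 -> i != i1 -> i != i2 -> 'chi[G]_i u = 0) ->
    x \in G -> y \in G ->
  #|gring_classM_coef_set (x ^: G) (y ^: G) u|%:R =
  (#|x ^: G| * #|y ^: G|)%:R / #|G|%:R *
  (1 + 'chi_i1 x * 'chi_i1 y / 'chi_i1 1%g - 'chi_i2 x * 'chi_i2 y / 'chi_i2 1%g)
  :> algC.
Proof.
move=> [nz1 nz2 n12] v1 v2 zero Gx Gy.
pose j z := enum_rank_in (classes1 G) (z ^: G).
have jE z : z \in G -> enum_val (j z) = z ^: G by move=> Gz; rewrite enum_rankK_in ?mem_classes.
have refl z : z \in G -> z \in enum_val (j z) by move=> Gz; rewrite jE ?class_refl.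
have := gring_classM_coef_sum_eq (refl x Gx) (refl y Gy) (refl u Gu).
rewrite (set_gring_classM_coef _ _ (refl u Gu)) !jE // => ->; congr (_ * _).
rewrite (bigD1 0) // (bigD1 i1) // (bigD1 i2) /=; last by rewrite nz2 eq_sym.
rewrite big1 => [|i /andP[/andP[nzi n1] n2]]; last first.
  by rewrite zero // conjC0 mulr0 mul0r.
rewrite !sc3_irr_conj v1 v2 irr0 !cfun1E Gx Gy Gu group1.
by rewrite divr1 !mulr1 mulrN1 mulNr addr0 addrA.
Qed.

(** Orthogonality of the columns of [u] and [x], which belong to different classes. *)
Lemma sc3_regular_value i1 i2 x :
    [/\ i1 != 0, i2 != 0 & i1 != i2] -> 'chi_i1 u = 1 -> 'chi_i2 u = -1 ->
    (forall i, i != 0 -> i != i1 -> i != i2 -> 'chi[G]_i u = 0) ->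
    x \in G -> #[x]%g != 3%N -> 'chi_i2 x = 'chi_i1 x + 1.
Proof.
move=> [nz1 nz2 n12] v1 v2 zero Gx nx.
have := second_orthogonality_relation x Gu; rewrite sc3_classE (negPf nx) andbF.
rewrite (bigD1 0) // (bigD1 i1) // (bigD1 i2) /=; last by rewrite nz2 eq_sym.
rewrite big1 => [|i /andP[/andP[nzi n1] n2]]; last by rewrite zero // conjC0 mulr0.
rewrite !sc3_irr_conj v1 v2 irr0 !cfun1E Gx Gu !mulr1 mulrN1 addr0 addrA.
by move/eqP; rewrite subr_eq0 addrC => /eqP->.
Qed.

End Characters3.

Section Numbers3.

Variables (gT : finGroupType) (G : {group gT}) (u t : gT).
Hypotheses (Gu : u \in G) (ou : #[u]%g = 3%N) (cu : ('C_G[u] = <[u]>)%g).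
Hypotheses (Gt : t \in G) (ot : #[t]%g = 2%N) (ut : (u ^ t = u^-1)%g).

Lemma sc3_card_class : (#|u ^: G| * 3)%N = #|G|.
Proof.
rewrite -index_cent1 cu mulnC -{1}ou -[#[u]%g]/#|<[u]>%g| Lagrange //.
by rewrite cycle_subG.
Qed.

Lemma involution_class s : (s \in t ^: G)%g -> [/\ s \in G, #[s]%g = 2%N & (s^-1 = s)%g].
Proof.
case/imsetP=> g Gg ->; rewrite groupJ // orderJ ot -conjVg; split=> //.
by congr (_ ^ _)%g; apply/eqP; rewrite eq_invg_mul -(expgS t 1) -order_dvdn ot.
Qed.

Lemma sc3_inverting_product s r : (s * s = 1 -> r * r = 1 -> s * r = u ->
  [/\ u ^ s = u^-1, u ^ r = u^-1 & r ^ u = s])%g.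
Proof.
move=> ss rr def_u.
have [sV rV] : (s^-1 = s /\ r^-1 = r)%g.
  by split; apply/eqP; rewrite eq_invg_mul ?ss ?rr.
have uV : (u^-1 = r * s)%g by rewrite -def_u invMg sV rV.
have u3 := sc3_expg3 ou.
split; rewrite conjgE.
- by rewrite uV -def_u sV !mulgA ss mul1g.
- by rewrite uV -def_u rV -!mulgA rr mulg1.
apply: (mulgI s); rewrite ss uV -def_u -u3 -def_u !expgS expg0 mulg1.
by rewrite !mulgA.
Qed.

(** Both factors of [u] invert it, so they lie in the normalizer of [<[u]>], a symmetric group of
    degree 3 with three involutions. *)
Lemma sc3_card_TT :
  #|gring_classM_coef_set (t ^: G)%g (t ^: G)%g u| = 3%N.
Proof.
pose h c := (u * t ^ c, t ^ c)%g.
have invT s : (s \in t ^: G -> s * s = 1)%g.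
  by case/involution_class=> _ _ sV; rewrite -{1}sV mulVg.
have tt := invT t (class_refl G t).
have tV : (t^-1 = t)%g by have [] := involution_class (class_refl G t).
have ct c : c \in <[u]>%g -> (c ^ t = c^-1)%g.
  by case/cycleP=> k ->; rewrite conjXg ut expgVn.
have tc c : c \in <[u]>%g -> (t ^ c = t * (c * c))%g.
  by move=> uc; rewrite conjgE -ct // conjgE tV !mulgA -(mulgA (t * c)%g t) tt mulg1.
have c4 c : c \in <[u]>%g -> ((c * c) * (c * c) = c)%g.
  move=> uc; have : (c ^+ 3 = 1)%g.
    by apply/eqP; rewrite -order_dvdn -ou; apply: order_dvdG.
  by rewrite !expgS expg0 mulg1 => c3; rewrite -mulgA c3 mulg1.
have uG : (<[u]> \subset G)%g by rewrite cycle_subG.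
have -> : gring_classM_coef_set (t ^: G)%g (t ^: G)%g u = h @: <[u]>%g.
  apply/setP=> [[s r]]; apply/setIdP/imsetP => [[/andP[/= Ts Tr] /eqP def_u] | [c uc [-> ->]]].
    have [[Gs _ _] [Gr _ rV]] := (involution_class Ts, involution_class Tr).
    have [us ur def_s] := sc3_inverting_product (invT _ Ts) (invT _ Tr) def_u.
    have utr : (t * r \in <[u]>)%g.
      rewrite -cu inE groupM //=; apply/cent1P/commute_sym/commgP/conjg_fixP.
      by rewrite conjgM ut conjVg ur invgK.
    exists ((t * r) * (t * r))%g; first by rewrite groupM.
    have -> : h (t * r * (t * r))%g = (u * r, r)%g.
      have tr : (t ^ (t * r * (t * r)) = r)%g.
        by rewrite (tc _ (groupM utr utr)) (c4 _ utr) mulgA tt mul1g.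
      by rewrite /h tr.
    by rewrite -def_u -mulgA (invT r Tr) mulg1.
  have Gc := subsetP uG c uc; have Ttc : (t ^ c \in t ^: G)%g by apply: memJ_class.
  have tctc := invT _ Ttc.
  split; last by rewrite /= -mulgA tctc mulg1.
  rewrite inE /= [X in _ && X]Ttc andbT.
  have cuc : (u ^ c = u)%g.
    by apply/conjg_fixP/commgP; case/cycleP: uc => k ->; apply: commuteX.
  have utc : (u ^ (t ^ c) = u^-1)%g by rewrite -{1}cuc -conjJg ut conjVg cuc.
  have ss : ((u * t ^ c) * (u * t ^ c) = 1)%g.
    have [_ _ tcV] := involution_class Ttc.
    have quq : (t ^ c * (u * t ^ c) = u^-1)%g by rewrite -utc [RHS]conjgE tcV.
    by rewrite -mulgA quq mulgV.
  have def_u : (u * t ^ c * t ^ c = u)%g by rewrite -mulgA tctc mulg1.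
  have [_ _ <-] := sc3_inverting_product ss tctc def_u.
  by rewrite -conjgM; apply: memJ_class; rewrite groupM.
rewrite card_in_imset; first by rewrite -[#|_|]/#[u]%g ou.
move=> c c' uc uc' [_]; rewrite !tc // => /mulgI cc.
by rewrite -(c4 c) // -(c4 c') // cc.
Qed.

Lemma sc3_card_VT :
  #|gring_classM_coef_set (u ^: G)%g (t ^: G)%g u| =
  #|[set s in (t ^: G)%g | #[u * s]%g == 3%N]|.
Proof.
pose h s := (u * s, s)%g; rewrite -(@card_imset _ _ h) => [|s r [] //].
apply: eq_card => [[v s]]; apply/setIdP/imsetP => [[/andP[/= Vv Ts] /eqP def_u] | [r]].
  have [Gs _ sV] := involution_class Ts.
  have def_v : (v = u * s)%g by rewrite -def_u -{2}sV mulgK.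
  exists s; last by rewrite /h -def_v.
  by move: Vv; rewrite inE Ts -def_v (sc3_classE Gu ou cu Gt ut) => /andP[].
rewrite inE => /andP[Tr our] [-> ->]; have [Gr _ rV] := involution_class Tr.
split; last by rewrite /= -{2}rV mulgK.
by rewrite inE /= [X in _ && X]Tr (sc3_classE Gu ou cu Gt ut) groupM // our.
Qed.

Lemma sc3_card_VV :
  #|gring_classM_coef_set (u ^: G)%g (u ^: G)%g u| =
  #|[set x in G | (#[u * x]%g == 3%N) && (#[u ^+ 2 * x]%g == 3%N)]|.
Proof.
(* The product of the two components is [u ^+ 2 * x * x^-1 * u^-1 = u]. *)
pose h x := (u ^+ 2 * x, (u * x)^-1)%g.
rewrite -(@card_imset _ _ h) => [|x y [/mulgI-> //]].
apply: eq_card => [[v w]]; apply/setIdP/imsetP => [[/andP[/= Vv Vw] /eqP def_u] | [x]].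
  move: Vv Vw; rewrite !(sc3_classE Gu ou cu Gt ut) => /andP[Gv ov] /andP[Gw ow].
  have def_uw : (u * (u^-1 * w^-1))^-1%g = w by rewrite mulKVg invgK.
  have def_uv : (u ^+ 2 * (u^-1 * w^-1))%g = v.
    by rewrite -mulgA mulKVg -def_u mulgK.
  exists (u^-1 * w^-1)%g; last by rewrite /h def_uw def_uv.
  by rewrite inE groupM ?groupV // mulKVg orderV ow def_uv.
rewrite inE => /and3P[Gx o1 o2] [-> ->].
rewrite inE /= !(sc3_classE Gu ou cu Gt ut) groupV orderV !groupM ?groupX //.
by rewrite o1 o2 invMg mulgA mulgK mulgK.
Qed.

End Numbers3.

Lemma involution_value (gT : finGroupType) (G : {group gT}) (chi : 'CF(G)) s (f : nat) :
    chi \is a character -> chi 1%g = f%:R -> s \in G -> #[s]%g = 2%N ->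
  exists b : int, chi s = b%:~R.
Proof.
move=> Nchi chi1 Gs os; have sG : (<[s]> \subset G)%g by rewrite cycle_subG.
have [n] := char_sum_nat sG Nchi.
rewrite /= cycle2E // big_setU1 ?inE; last by rewrite eq_sym -order_eq1 os.
rewrite big_set1 chi1 cards2 => /(canRL (addKr _)) ->.
exists (- f%:Z + (n * (1%g != s).+1)%N%:Z); by rewrite rmorphD rmorphN /= -!pmulrn.
Qed.

Lemma Aint_div_dvdn (n d : nat) : (n%:R / d%:R : algC) \in Aint -> (0 < d)%N -> (d %| n)%N.
Proof.
move=> Ai d0; rewrite -dvdC_nat unfold_in -if_neg pnatr_eq0 -lt0n d0.
by apply: Cint_rat_Aint => //; rewrite rpred_div ?rpred_nat.
Qed.

Section Numbers3.

Variables (gT : finGroupType) (G : {group gT}) (u t : gT).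
Hypotheses (Gu : u \in G) (ou : #[u]%g = 3%N) (cu : ('C_G[u] = <[u]>)%g).
Hypotheses (Gt : t \in G) (ot : #[t]%g = 2%N) (ut : (u ^ t = u^-1)%g).

(* Here f and a are the values at 1 and t of the irreducible character taking the
   value 1 at u, and K is its kernel. *)
Lemma sc3_numbers : exists (f : nat) (a : int) (K : {group gT}),
  [/\ [/\ (0 < f)%N, (f %% 3 = 1)%N, (3 * f %| #|G|)%N & (3 * f.+1 %| #|G|)%N],
      [/\ (K <| G)%g, f = 1%N -> (u \in K) && (t \notin K) &
          f <> 1%N -> coprime 3 #|K| /\
            forall s, s \in G -> #[s]%g = 2%N -> s \notin K -> (s \in t ^: G)%g],
      #|t ^: G|%:Z ^+ 2 * (f%:Z - a) ^+ 2 = 3 * #|G|%:Z * f%:Z * (f%:Z + 1),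
      3 * #|[set s in (t ^: G)%g | #[u * s]%g == 3%N]|%:Z * f%:Z * (f%:Z + 1)
        = #|t ^: G|%:Z * (f%:Z * (f%:Z + 1) + a * (f%:Z + 1) + (a + 1) * f%:Z) &
      9 * #|[set x in G | (#[u * x]%g == 3%N) && (#[u ^+ 2 * x]%g == 3%N)]|%:Z
        * f%:Z * (f%:Z + 1) = #|G|%:Z * (f%:Z ^+ 2 + f%:Z + 1) /\
      forall W : {group gT}, (W \subset G)%g -> #|W| = 4%N ->
        (W^# \subset t ^: G)%g -> exists n : nat, f%:Z + 3 * a = 4 * n%:Z].
Proof.
have [i1 [i2 [neq v1 v2 d12 zero]]] := sc3_irr_values Gu ou cu Gt ot ut.
have structure x y := sc3_structure Gu Gt ut neq v1 v2 zero (x := x) (y := y).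
have regv x := sc3_regular_value Gu ou cu Gt ut neq v1 v2 zero (x := x).
have cTT : #|gring_classM_coef_set (t ^: G)%g (t ^: G)%g u| = 3%N by apply: sc3_card_TT.
have cVT : #|gring_classM_coef_set (u ^: G)%g (t ^: G)%g u| = #|[set s in (t ^: G)%g | #[u * s]%g == 3%N]| by apply: sc3_card_VT.
have cVV : #|gring_classM_coef_set (u ^: G)%g (u ^: G)%g u| = #|[set x in G | (#[u * x]%g == 3%N) && (#[u ^+ 2 * x]%g == 3%N)]| by apply: sc3_card_VV Gt ut.
have /natrP[f fE] := Cnat_irr1 i1; have fpos : (0 < f)%N.
  by have := irr1_gt0 i1; rewrite fE ltr0n.
have [a aE] := involution_value (irr_char i1) fE Gt ot.
have a2E : 'chi_i2 t = a%:~R + 1 by rewrite regv ?aE // ot.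
have f2E : 'chi_i2 1%g = f%:R + 1 by rewrite d12 fE.
have gE : #|G|%:R = 3%:R * #|u ^: G|%:R :> algC.
  by rewrite -natrM mulnC sc3_card_class.
have nzV : #|u ^: G|%:R != 0 :> algC.
  by rewrite pnatr_eq0 -lt0n (cardD1 u) class_refl.
have nzT : #|t ^: G|%:R != 0 :> algC.
  by rewrite pnatr_eq0 -lt0n (cardD1 t) class_refl.
have nzf : f%:R != 0 :> algC by rewrite pnatr_eq0 -lt0n.
have nzf1 : f%:R + 1 != 0 :> algC by rewrite -[1]/(1%:R) -natrD pnatr_eq0 addn1.
have nz3 : 3%:R != 0 :> algC by rewrite pnatr_eq0.
have eTT : #|t ^: G|%:Z ^+ 2 * (f%:Z - a) ^+ 2 = 3 * #|G|%:Z * f%:Z * (f%:Z + 1).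
  have := structure t t Gt Gt; rewrite cTT.
  rewrite aE a2E fE f2E natrM gE => e.
  apply: (@intr_inj algC); rewrite !(rmorphM, rmorphD, rmorphN, rmorphXn) /= -!pmulrn.
  rewrite gE; transitivity (3%:R * (3%:R * #|u ^: G|%:R) * f%:R * (f%:R + 1) : algC); last by ring.
  by rewrite {1}e; field; rewrite ?nzf ?nzf1 ?nzV.
have eVT : 3 * #|[set s in (t ^: G)%g | #[u * s]%g == 3%N]|%:Z * f%:Z * (f%:Z + 1)
        = #|t ^: G|%:Z * (f%:Z * (f%:Z + 1) + a * (f%:Z + 1) + (a + 1) * f%:Z).
  have := structure u t Gu Gt; rewrite cVT.
  rewrite aE a2E fE f2E v1 v2 natrM gE => e.
  apply: (@intr_inj algC); rewrite !(rmorphM, rmorphD, rmorphN, rmorphXn) /= -!pmulrn.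
  by rewrite e; field; rewrite ?nzf ?nzf1 ?nzV.
have eVV : 9 * #|[set x in G | (#[u * x]%g == 3%N) && (#[u ^+ 2 * x]%g == 3%N)]|%:Z
        * f%:Z * (f%:Z + 1) = #|G|%:Z * (f%:Z ^+ 2 + f%:Z + 1).
  have := structure u u Gu Gu; rewrite cVV.
  rewrite fE f2E v1 v2 natrM gE => e.
  apply: (@intr_inj algC); rewrite !(rmorphM, rmorphD, rmorphN, rmorphXn) /= -!pmulrn.
  by rewrite gE e; field; rewrite ?nzf ?nzf1 ?nzV.
have ftE : f%:Z - a != 0.
  apply: contraTneq (_ : (0 < 3 * #|G|%:Z * f%:Z * (f%:Z + 1))) => [e0|].
    by rewrite -eTT e0 expr0n mulr0.
  have -> : 3 * #|G|%:Z * f%:Z * (f%:Z + 1) = (3 * #|G| * f * (f + 1))%N%:Z.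
    by rewrite !PoszM PoszD.
  by rewrite ltz_nat !muln_gt0 cardG_gt0 fpos addn1.
have t_notK : t \notin cfker 'chi_i1.
  rewrite cfkerEirr inE aE fE pmulrn eqr_int; apply: contra ftE => /eqP->.
  by rewrite subrr.
have dvdV d : (d %| #|u ^: G|)%N -> (3 * d %| #|G|)%N.
  by move=> dvd; rewrite -(sc3_card_class Gu ou cu) mulnC dvdn_mul.
exists f, a, (cfker 'chi_i1)%G; split=> //.
- split=> //.
  + have [n] := sc3_irr_sum Gu ou Gt ut i1; rewrite v1 fE -natrD => /eqP.
    by rewrite eqr_nat => /eqP; lia.
  (* The central characters take the values [#|u ^: G| / f] and [- #|u ^: G| / (f + 1)] at the class
     of [u], and these are algebraic integers. *)
  + apply/dvdV/Aint_div_dvdn => //.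
    by have := Aint_class_div_irr1 i1 Gu; rewrite v1 mulr1 fE.
  apply/dvdV/Aint_div_dvdn => //.
  have := Aint_class_div_irr1 i2 Gu; rewrite v2 f2E mulrN1 mulNr rpredN.
  by rewrite -[1]/(1%:R) -natrD addn1.
- split=> [|f1|f1]; first exact: cfker_normal.
    have Ku : u \in cfker 'chi_i1 by rewrite cfkerEirr inE v1 fE f1.
    by rewrite /= Ku t_notK.
  split.
    rewrite prime_coprime //; apply/negP=> /Cauchy[] // y Ky oy.
    have Gy : y \in G by apply: (subsetP (cfker_sub 'chi_i1)).
    have : (y \in u ^: G)%g by rewrite (sc3_classE Gu ou cu Gt ut) Gy oy.
    case/imsetP=> g Gg def_y; have : 'chi_i1 y = 'chi_i1 1%g.
      have : y \in cfker 'chi_i1 by exact: Ky.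
      by rewrite cfkerEirr inE => /eqP.
    rewrite def_y (cfunJ 'chi_i1 u Gg) v1 fE => /esym/eqP.
    by rewrite pnatr_eq1 => /eqP.
  move=> s Gs os nKs; have [b bE] := involution_value (irr_char i1) fE Gs os.
  have : s \notin cfker 'chi_i1 by exact: nKs.
  rewrite cfkerEirr inE bE fE pmulrn eqr_int => nbf.
  have b2E : 'chi_i2 s = b%:~R + 1 by rewrite regv ?bE // os.
  (* This class algebra constant is proportional to [(f - b) * (f - a)], nonzero because [s] and [t]
     lie outside the kernel. So [u] is a product of conjugates of [s] and [t], which are conjugate
     to each other since [u] has odd order. *)
  have [[s' t'] ] : exists p, p \in gring_classM_coef_set (s ^: G)%g (t ^: G)%g u.
    apply/set0Pn; rewrite -card_gt0 -(ltr0n algC) lt0r ler0n andbT.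
    rewrite structure // bE b2E aE a2E fE f2E.
    have -> : 1 + b%:~R * a%:~R / f%:R - (b%:~R + 1) * (a%:~R + 1) / (f%:R + 1)
       = (f%:Z - b)%:~R * (f%:Z - a)%:~R / f%:R / (f%:R + 1) :> algC.
      by rewrite !rmorphB /= -!pmulrn; field; rewrite nzf nzf1.
    have nzS : #|s ^: G|%:R != 0 :> algC.
      by rewrite pnatr_eq0 -lt0n (cardD1 s) class_refl.
    rewrite natrM !mulf_neq0 ?invr_eq0 ?neq0CG // intr_eq0 //.
    by rewrite subr_eq0 eq_sym.
  case/setIdP=> /andP[/= Ss Tt] /eqP def_u.
  have inv (x : gT) : (#[x] = 2%N -> x * x = 1)%g.
    by move=> ox; apply/eqP; rewrite -(expgS x 1) -order_dvdn ox.
  have os' : #[s']%g = 2%N by case/imsetP: Ss => g _ ->; rewrite orderJ.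
  have ot' : #[t']%g = 2%N by case/imsetP: Tt => g _ ->; rewrite orderJ.
  have [_ _ def_s] := sc3_inverting_product ou (inv _ os') (inv _ ot') def_u.
  have Ts' : (s' \in t ^: G)%g.
    by rewrite -def_s -(class_eqP Tt) memJ_class.
  by rewrite -(class_eqP Ts') class_sym.
(* The character sums to [f + 3 * a] over [W], and this is 4 times a multiplicity. *)
split=> // W sWG oW sWT; have [n] := char_sum_nat sWG (irr_char i1).
rewrite (big_setD1 1%g) //= fE (eq_bigr (fun=> a%:~R)); last first.
  by move=> x /(subsetP sWT)/imsetP[g Gg ->]; rewrite cfunJ // aE.
have -> : #|W| = 4%N by []. 
rewrite sumr_const cardsDS ?sub1set // cards1 oW => e; exists n.
apply: (@intr_inj algC); rewrite rmorphD !rmorphM /= -!pmulrn.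
by move: e; rewrite natrM -(mulr_natl a%:~R) => e; rewrite [RHS]mulrC; exact: e.
Qed.

End Numbers3.

End Characters.

(** * Splitting over the 3'-core, and alternating subgroups of degree 4 *)

Section ElementaryAbelian4.
Import Order.TTheory GRing.Theory Num.Theory GroupScope.
Section Dichotomy3.

Variables (gT : finGroupType) (G : {group gT}) (u : gT).
Hypotheses (Gu : u \in G) (ou : #[u] = 3) (cu : 'C_G[u] = <[u]>).

Lemma sc3_complement (K : {group gT}) :
    K \subset G -> u \in K -> {in 'N_K(<[u]>), forall n, u ^ n = u} ->
  'O_3^'(K) * <[u]> = K.
Proof.
move=> sKG Ku cN; have cuK : 'C_K[u] = <[u]>.
  by apply/eqP; rewrite eqEsubset -{1}cu setSI //= subsetI cycle_subG Ku cycle_subG cent1id.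
have abu : abelian <[u]> := cycle_abelian u.
have sNC : 'N_K(<[u]>) \subset 'C(<[u]>).
  apply/subsetP=> n Nn; rewrite cent_cycle; apply/cent1P/commute_sym/commgP.
  by apply/conjg_fixP/cN.
have [L [nLK pL defK]] :=
  Burnside_normal_complement (sc3_Sylow Ku ou cuK) abu sNC.
apply/eqP; rewrite eqEsubset mul_subG ?pcore_sub ?cycle_subG //= -{1}defK.
by rewrite mulSg // pcore_max.
Qed.

(** If nothing inverts [u], transfer yields a normal 3-complement. If [f = 1], it does so inside the
    kernel of a linear character that is nontrivial at [t], and the Frattini argument supplies the
    rest. Otherwise, the absence of [s] would mean a vanishing class algebra constant, which has no
    integer solution. *)
Lemma sc3_dichotomy :
  'O_3^'(G) * 'N_G(<[u]>) = G \/
  exists t s, [/\ t \in G, #[t] = 2, u ^ t = u^-1, s \in t ^: G & #[u * s] = 3].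
Proof.
have suG : <[u]> \subset G by rewrite cycle_subG.
have suN : <[u]> \subset 'N_G(<[u]>) by rewrite subsetI suG normG.
have sufG : G \subset 'O_3^'(G) * 'N_G(<[u]>) -> 'O_3^'(G) * 'N_G(<[u]>) = G.
  by move=> sG; apply/eqP; rewrite eqEsubset sG mul_subG ?pcore_sub ?subsetIl.
have [/exists_inP[g Gg /eqP ug] | /exists_inPn noinv] :=
  boolP [exists g in G, u ^ g == u^-1]; last first.
  left; apply: sufG; rewrite -{1}(sc3_complement (subxx G) Gu) ?mulgS //.
  move=> n Nn; have [[]//|un] := sc3_norm_cases ou cu Nn.
  by case/setIP: Nn => /noinv; rewrite un eqxx.
have [t [Gt ot ut]] := sc3_inverting ou cu Gg ug.
have [f [a [K [[f0 _ _ _] [nKG K1 _] _ eVT _]]]] := sc3_numbers Gu ou cu Gt ot ut.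
have [f1 | nf1] := eqVneq f 1%N.
  left; have /andP[Ku nKt] := K1 f1; apply: sufG.
  have sKG := normal_sub nKG.
  have sylK : 3.-Sylow(K) <[u]>.
    by apply: pHall_subl sKG (sc3_Sylow Gu ou cu); rewrite cycle_subG.
  rewrite -{1}(Frattini_arg nKG sylK).
  rewrite -{1}(sc3_complement sKG Ku) => [|n /setIP[Kn nn]].
    rewrite -mulgA (mulSGid suN) mulSg // pcore_max //; first exact: pcore_pgroup.
    exact: char_normal_trans (pcore_char _ _) nKG.
  have Nn : n \in 'N_G(<[u]>) by rewrite inE (subsetP sKG).
  have [un|unt] := sc3_norm_index ou cu Gt ut Nn.
    by apply/conjg_fixP/commgP; case/cycleP: un => k ->; apply: commuteX.
  case/negP: nKt; rewrite -(groupMl _ Kn).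
  by apply: (subsetP (_ : <[u]> \subset K)); rewrite // cycle_subG.
right; exists t.
suff /set0Pn[s]: [set s in t ^: G | #[u * s] == 3] != set0.
  by rewrite inE => /andP[Ts /eqP us]; exists s.
apply/negP=> /eqP T0; move: eVT; rewrite T0 cards0.
have : (0 < #|t ^: G|)%N by rewrite (cardD1 t) class_refl.
move/eqP: nf1 => nf1; move: #|t ^: G| f0 nf1 => T; clear.
move=> f0 nf1 T0 e; have {e} : (f%:Z * (f%:Z + 1) + a * (f%:Z + 1) + (a + 1) * f%:Z = 0)%R by nia.
(* Four times the equation, plus 3, factors; for [f > 1] the factor [2 * f + 1] is too large to
   divide 3. *)
move=> e; have : ((2 * f%:Z + 1) * (2 * f%:Z + 3 + 4 * a) = 3)%R by nia.
have [x def_x] : exists x : int, x = (2 * f%:Z + 3 + 4 * a)%R by eexists.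
rewrite -def_x => {def_x} e; have x0 : (x > 0)%R by nia.
nia.
Qed.

(* If s is an involution with #[u * s] = 3, then s and u generate an alternating
   group of degree 4, every element of order 3 of which acts regularly on Z.
   Adding up the resulting relations shows that an element inverted by s has
   order dividing 4. *)
Lemma alt4_inverted (Z : {group gT}) s e :
    Z \subset G -> coprime 3 #|Z| -> abelian Z -> u \in 'N(Z) -> s \in 'N(Z) ->
    s \in G -> #[s] = 2 -> #[u * s] = 3 -> e \in Z -> e ^ s = e^-1 ->
  e ^+ 4 = 1.
Proof.
move=> sZG coZ abZ nZu nZs Gs os ous Ze es.
have u3 := sc3_expg3 ou.
have ss : s * s = 1 by apply/eqP; rewrite -(expgS s 1) -order_dvdn os.
have sV : s^-1 = s by apply/eqP; rewrite eq_invg_mul ss.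
have reg y : y \in G -> #[y] = 3 -> y \in 'N(Z) ->
    e ^ (y * y) * e ^ y * e = 1.
  move=> Gy oy nZy; have y3 : y ^+ 3 = 1 by rewrite -oy expg_order.
  by have [_] := regular3_triangle nZy y3 (sc3_regular Gu ou cu sZG coZ Gy oy) Ze.
have uV : u^-1 = u * u by apply: (mulgI u); rewrite mulgV -u3 !expgS expg0 mulg1.
have osu : #[s * u] = 3.
  by rewrite -ous -(orderJ (u * s) s) conjgE sV -!mulgA ss mulg1.
have sq (y : gT) : #[y] = 3 -> y * y = y^-1.
  move=> oy; apply: (mulgI y); rewrite mulgV mulgA.
  by have := expg_order y; rewrite oy !expgS expg0 mulg1 mulgA.
have e_us := reg (u * s) (groupM Gu Gs) ous (groupM nZu nZs).
have e_su := reg (s * u) (groupM Gs Gu) osu (groupM nZs nZu).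
have e_u := reg u Gu ou nZu.
have e_V : (e^-1) ^ s = e by rewrite conjVg es invgK.
rewrite (sq _ ous) invMg sV (conjgM _ s u^-1) es conjVg in e_us.
rewrite (sq _ osu) invMg sV (conjgM _ s u) es conjVg in e_su.
rewrite (sq _ ou) in e_u.
have := congr1 (conjg^~ s) e_u; rewrite /= conj1g (conjMg (_ * _)) (conjMg (e ^ _)).
rewrite -!conjgM es.
set a := e ^ u in e_su e_u; set b := e ^ u^-1 in e_us e_u.
set d := e ^ (u^-1 * s) in e_su *; set c := e ^ (u * s) in e_us *.
have -> : d = e^-1 * a.
  by apply: (mulIg a^-1); rewrite mulgK; apply: (mulIg e); rewrite e_su mulVg.
have -> : c = b * e^-1.
  by apply: (mulgI b^-1); rewrite mulKg; apply: (mulIg e); rewrite e_us mulVg.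
have Za : a \in Z by rewrite memJ_norm.
have Zb : b \in Z by rewrite memJ_norm ?groupV.
rewrite mulgA -(mulgA e^-1) (centsP abZ a Za b Zb) => e_dc.
have def_ba : b * a = e^-1 by apply: (mulIg e); rewrite e_u mulVg.
rewrite def_ba in e_dc.
have : e^-1 ^+ 4 = 1 by rewrite !expgS expg0 mulg1 -!mulgA in e_dc *.
by rewrite expgVn => /eqP; rewrite eq_invg1 => /eqP.
Qed.

(** The element [z^-1 * z ^ s] is inverted by [s], so its fourth power is trivial, while its order
    is odd. *)
Lemma alt4_centralizes (Z : {group gT}) s :
    Z \subset G -> coprime 6 #|Z| -> abelian Z -> u \in 'N(Z) -> s \in 'N(Z) ->
    s \in G -> #[s] = 2 -> #[u * s] = 3 ->
  Z \subset 'C[s].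
Proof.
move=> sZG coZ abZ nZu nZs Gs os ous.
have [co2 co3] : coprime 2 #|Z| /\ coprime 3 #|Z|.
  by apply/andP; rewrite -coprimeMl.
apply/subsetP=> z Zz; apply/cent1P/commgP/conjg_fixP.
have Zzs : z ^ s \in Z by rewrite memJ_norm.
have ss : s * s = 1 by apply/eqP; rewrite -(expgS s 1) -order_dvdn os.
have inv : (z^-1 * z ^ s) ^ s = (z^-1 * z ^ s)^-1.
  rewrite (conjMg z^-1) -conjgM ss conjg1 conjVg [RHS]invMg invgK.
  by rewrite (centsP abZ) ?groupV.
have e4 := alt4_inverted sZG co3 abZ nZu nZs Gs os ous (groupM (groupVr Zz) Zzs) inv.
have : #[z^-1 * z ^ s] == 1%N.
  rewrite -dvdn1 -(eqP (_ : coprime 4 #|Z|)); last by rewrite (coprimeXl 2 co2).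
  have Ze : z^-1 * z ^ s \in Z by rewrite groupM ?groupV.
  by rewrite dvdn_gcd (order_dvdG Ze) order_dvdn e4 eqxx.
by rewrite order_eq1 => /eqP e1; apply: (mulgI z^-1); rewrite e1 mulVg.
Qed.

End Dichotomy3.

(** Otherwise [sc3_dichotomy] provides an involution [s] that centralizes ['Z(L)]. The centralizer
    of ['Z(L)] is a normal 3'-subgroup of ['N_G(L)]. But it contains the commutator of [s] with an
    element of order 3 inverted by [s], hence that element. *)
Lemma sc3_local (gT : finGroupType) (G L : {group gT}) u :
    u \in G -> #[u] = 3 -> 'C_G[u] = <[u]> -> L \subset G -> u \in 'N(L) ->
    nilpotent L -> L :!=: 1 -> coprime 6 #|L| ->
  'O_3^'('N_G(L)) * 'N_('N_G(L))(<[u]>) = 'N_G(L).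
Proof.
move=> Gu ou cu sLG nLu nilL ntL coL; set H := 'N_G(L)%G.
have Hu : u \in H by rewrite inE Gu.
have sHG : H \subset G := subsetIl _ _.
have cuH : 'C_H[u] = <[u]>.
  by apply/eqP; rewrite eqEsubset -{1}cu setSI //= subsetI cycle_subG Hu cycle_subG cent1id.
have [// | [t [s [Ht ot ut /imsetP[h Hh def_s] ous]]]] := sc3_dichotomy Hu ou cuH.
have nLH : L <| H by rewrite /normal subsetIr subsetI sLG normG.
pose Z := 'Z(L)%G.
have nZH : Z <| H := char_normal_trans (center_char L) nLH.
have coZ : coprime 6 #|Z| := coprime_dvdr (cardSg (center_sub L)) coL.
have Hs : s \in H by rewrite def_s groupJ.
have os : #[s] = 2 by rewrite def_s orderJ.
have nZ x : x \in H -> x \in 'N(Z) := subsetP (normal_norm nZH) x.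
have cZs := alt4_centralizes Hu ou cuH (normal_sub nZH) coZ (center_abelian L)
  (nZ u Hu) (nZ s Hs) Hs os ous.
have ntZ : Z :!=: 1 by rewrite /= center_nil_eq1.
have [z Zz ntz] := trivgPn _ ntZ.
pose R := 'C_H(Z)%G.
have nRH : R <| H := norm_normalI (norms_cent (normal_norm nZH)).
have Gz : z \in G := subsetP (subset_trans (normal_sub nZH) sHG) z Zz.
have coz : coprime 3 #[z].
  by apply: coprime_dvdr (order_dvdG Zz) (coprime_dvdl _ coZ).
have coR : coprime 3 #|R|.
  have sRG : R \subset G := subset_trans (normal_sub nRH) sHG.
  apply: (sc3_cent_coprime Gu ou cu sRG Gz ntz coz).
  by rewrite subIset // orbC (subset_trans (centS (_ : [set z] \subset Z))) ?sub1set // cent_set1.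
have Rs : s \in R.
  by rewrite inE Hs; apply/centP=> x Zx; apply/cent1P; rewrite cent1C (subsetP cZs).
have Hy : u ^ h \in H by rewrite groupJ.
have oy : #[u ^ h] = 3 by rewrite orderJ.
have ys : (u ^ h) ^ s = (u ^ h)^-1 by rewrite def_s -conjJg ut conjVg.
have Ry : u ^ h \in R.
  have : [~ u ^ h, s] \in R.
    by rewrite commgEr groupM // memJ_norm ?groupV // (subsetP (normal_norm nRH)).
  rewrite commgEl ys -invMg groupV => Ryy.
  have -> : u ^ h = (u ^ h * u ^ h) * (u ^ h * u ^ h).
    by have := expg_order (u ^ h); rewrite oy !expgS expg0 mulg1 => y3; rewrite -mulgA y3 mulg1.
  by rewrite groupM.
have := order_dvdG Ry; rewrite oy => /dvdnP[k def_R].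
by move: coR; rewrite def_R coprimeMr andbF.
Qed.
End ElementaryAbelian4.

(** * Triangle elements of odd order *)

Definition gt3 : nat_pred := [pred p | 3 < p].

Lemma gt3_natE n : 0 < n -> gt3.-nat n = coprime 6 n.
Proof.
move=> n0; rewrite (_ : 6 = (2 * 3)%N) // coprimeMl !prime_coprime //.
rewrite /pnat n0; apply/allP/andP=> [all3 | [n2 n3] p].
  have gt3P q : prime q -> q %| n -> q \in gt3.
    by move=> pr dv; apply: all3; rewrite mem_primes pr n0.
  split; apply/negP=> dv; first by have := gt3P 2 isT dv.
  by have := gt3P 3 isT dv.
rewrite mem_primes => /and3P[pr _ dv]; rewrite inE ltnNge.
case: p pr dv => [|[|[|[|p]]]] // _ dv; first by rewrite dv in n2.
by rewrite dv in n3.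
Qed.

Section OddPart.

Variables (gT : finGroupType) (G : {group gT}) (u : gT).
Hypotheses (Gu : u \in G) (ou : #[u] = 3) (cu : 'C_G[u] = <[u]>).

Definition regular_gt3 (R : {group gT}) := [&& gt3.-group R, R \subset G & u \in 'N(R)].

Definition max_gt3 (R : {group gT}) := [max R | regular_gt3 R].

Lemma sc3_norm_exp n : n \in 'N_G(<[u]>) -> n ^+ 6 = 1.
Proof.
move=> Nn; have Gn : n \in G by case/setIP: Nn.
have un2 : u ^ (n ^+ 2) = u.
  by have [[un _]|un] := sc3_norm_cases ou cu Nn; rewrite conjgM ?conjVg !un ?conjVg ?un ?invgK.
have : n ^+ 2 \in <[u]>.
  by rewrite -cu inE groupX //; apply/cent1P/commute_sym/commgP/conjg_fixP.
move/order_dvdG; rewrite -[#|<[u]>|]/#[u] ou => /dvdnP[k k3].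
by rewrite (expgM n 2 3); apply/eqP; rewrite -order_dvdn k3 dvdn_mull.
Qed.

(* The normalizer of 'O_p(R) splits by [sc3_local], which puts every u-invariant
   {2,3}'-subgroup of it inside its 3'-core. *)
Lemma max_gt3_core (R : {group gT}) p :
    max_gt3 R -> prime p -> p %| #|R| ->
  p.-Sylow(G) 'O_p(R) /\ R :=: 'O_gt3('O_3^'('N_G('O_p(R)))).
Proof.
case/maxgroupP=> /and3P[gtR sRG nRu] maxR pr pdv.
have coR6 : coprime 6 #|R| by rewrite -gt3_natE.
have coR : coprime 3 #|R| by apply: coprime_dvdl coR6.
have nilR := sc3_nil Gu ou cu sRG coR nRu.
pose L := 'O_p(R)%G; have sylLR : p.-Sylow(R) L := nilpotent_pcore_Hall p nilR.
have sLR : L \subset R := pcore_sub p R.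
have sLG := subset_trans sLR sRG.
have ntL : L :!=: 1.
  by rewrite -cardG_gt1 (card_Hall sylLR) p_part_gt1 mem_primes pr cardG_gt0.
have nLu : u \in 'N(L) by rewrite (subsetP (char_norms (pcore_char p R))).
have coL : coprime 6 #|L| := coprime_dvdr (cardSg sLR) coR6.
have splH := sc3_local Gu ou cu sLG nLu (nilpotentS sLR nilR) ntL coL.
set H := 'N_G(L)%G in splH *; pose M := 'O_3^'(H)%G.
have Hu : u \in H by rewrite inE Gu.
have sHG : H \subset G := subsetIl _ _.
have cuH : 'C_H[u] = <[u]>.
  by apply/eqP; rewrite eqEsubset -{1}cu setSI //= subsetI cycle_subG Hu cycle_subG cent1id.
have sRH : R \subset H by rewrite subsetI sRG char_norm // pcore_char.
have sRM : R \subset M := sc3_split_sub Hu ou cuH splH sRH nRu coR.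
have nMH : M <| H := pcore_normal _ _.
have sMG : M \subset G := subset_trans (pcore_sub _ _) sHG.
have coM : coprime 3 #|M| := sc3_coprime_pcore _.
have nMu : u \in 'N(M) by rewrite (subsetP (normal_norm nMH)).
have nilM := sc3_nil Gu ou cu sMG coM nMu.
have defR : 'O_gt3(M) = R.
  apply: (maxR 'O_gt3(M)%G); last by rewrite (sub_Hall_pcore (nilpotent_pcore_Hall gt3 nilM)).
  rewrite /regular_gt3 pcore_pgroup (subset_trans (pcore_sub _ _)) //=.
  by rewrite (subsetP (char_norms (pcore_char gt3 M))).
split; last by rewrite -[LHS]defR.
rewrite -Sylow_subnorm -/H.
have gtp : p \in gt3.
  by apply: (pnatPpi gtR); rewrite mem_primes pr cardG_gt0.
have sylLM : p.-Sylow(M) L.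
  by apply: subHall_Sylow gtp sylLR; rewrite -defR; exact: nilpotent_pcore_Hall.
have [sLM pL p'iL] := and3P sylLM.
rewrite /pHall pL (subset_trans sLM (pcore_sub _ _)) /=.
rewrite -(Lagrange_index (pcore_sub _ _ : M \subset H) sLM) pnatM p'iL andbT.
(* Elements of this normalizer have order dividing 6, whereas [p > 3]. As [H] splits, the index of
   [M] in [H] divides its order. *)
have p'N : p^'.-group 'N_H(<[u]>).
  rewrite /pgroup p'natE //; apply/negP=> /Cauchy[] // n Nn on.
  have Nn' : n \in 'N_G(<[u]>) by apply: (subsetP (setSI _ sHG)).
  have : p %| 6 by rewrite -on order_dvdn sc3_norm_exp.
  by move: gtp; rewrite inE; move: pr; case: p {sylLR L sLR sLG ntL nLu coL splH H M Hu sHG cuH sRH sRM nMH sMG coM nMu nilM defR sylLM sLM pL p'iL Nn on pdv} => [|[|[|[|[|[|[|p]]]]]]] // _ _ /dvdn_leq.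
apply: pnat_dvd p'N.
rewrite -(@dvdn_pmul2l #|M|) ?cardG_gt0 // Lagrange ?normal_sub //.
by rewrite (mul_cardG M 'N_H(<[u]>)) [M * _]splH dvdn_mulr.
Qed.

(** Both ['O_p(R1)] and ['O_p(R2)] are Sylow subgroups of [G] normalized by [u], hence conjugate
    under ['N_G(<[u]>)], and by [max_gt3_core] each determines its [R]. *)
Lemma max_gt3_conj (R1 R2 : {group gT}) p :
    max_gt3 R1 -> max_gt3 R2 -> prime p -> p %| #|R1| -> p %| #|R2| ->
  exists2 n, n \in 'N_G(<[u]>) & R2 :=: R1 :^ n.
Proof.
move=> max1 max2 pr dv1 dv2.
have [syl1 def1] := max_gt3_core max1 pr dv1.
have [syl2 def2] := max_gt3_core max2 pr dv2.
have [g Gg conj12] := Sylow_trans syl1 syl2.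
have nO (R : {group gT}) : max_gt3 R -> <[u]> \subset 'N('O_p(R)).
  case/maxgroupP=> /and3P[_ _ nRu] _; rewrite cycle_subG.
  by rewrite (subsetP (char_norms (pcore_char p R))).
have [n Nn def_n] :=
  Sylow_norm_conj (sc3_Sylow Gu ou cu) Gg (nO _ max1) (nO _ max2) conj12.
exists n => //; rewrite def2 def1 -!pcoreJ; congr 'O_gt3('O_3^'(_)).
have Gn : n \in G by case/setIP: Nn.
by rewrite conjIg (conjGid Gn) -normJ; congr (_ :&: 'N(_)).
Qed.

Lemma sc3_card_mod3 (R : {group gT}) :
  R \subset G -> coprime 3 #|R| -> u \in 'N(R) -> #|R| = 1 %[mod 3].
Proof.
move=> sRG coR nRu; have : #[u] %| #|R|.-1.
  apply: regular_norm_dvd_pred; first by rewrite cycle_subG.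
  move=> x /setD1P[ntx ux]; apply: (sc3_regular Gu ou cu sRG coR).
    by apply: mem_cycle_sub ux.
  have := order_dvdG ux; rewrite -[#|<[u]>|]/#[u] ou.
  by case/primeP: (isT : prime 3) => _ pr3 /pr3/pred2P[/eqP|//]; rewrite order_eq1 (negPf ntx).
by rewrite ou; have := cardG_gt0 R; lia.
Qed.

Lemma max_gt3_mod3 (R : {group gT}) : regular_gt3 R -> #|R| = 1 %[mod 3].
Proof.
case/and3P=> gtR sRG nRu; apply: sc3_card_mod3 => //.
by apply: (@coprime_dvdl _ 6) => //; rewrite -gt3_natE.
Qed.


(** Its cardinality is the class algebra constant of [sc3_card_VV]. *)
Definition triangle_set := [set x in G | (#[u * x] == 3) && (#[u ^+ 2 * x] == 3)].

(** By [triangle333], [a] and [a ^ u] generate an abelian group [A] normalized by [u]. An element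
    [b] of order 3 in [<[a]>] is self-centralizing, so [A = <[b]>]; being normalized by [u], this is
    [<[u]>]. Then [a] would be a nontrivial power of [u], which the two orders exclude. *)
Lemma triangle_set_group a : a \in triangle_set ->
  [/\ commute a (a ^ u), a ^ (u ^+ 2) * a ^ u * a = 1,
      coprime 3 #[a] & exists A : {group gT},
      [/\ A :=: <[a]> * <[a ^ u]>, A \subset G & u \in 'N(A)]].
Proof.
rewrite inE => /and3P[Ga /eqP o1 /eqP o2].
have u3 := sc3_expg3 ou.
have e1 : (u * a) ^+ 3 = 1 by rewrite -o1 expg_order.
have e2 : (u ^+ 2 * a) ^+ 3 = 1 by rewrite -o2 expg_order.
have [ca cube] := triangle333 u3 e1 e2.
have caa : <[a ^ u]> \subset 'C(<[a]>).
  by rewrite cent_cycle cycle_subG; apply/cent1P/commute_sym.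
pose A := (<[a]> <*> <[a ^ u]>)%G.
have defA : A :=: <[a]> * <[a ^ u]> by rewrite /= norm_joinEr // cents_norm.
have [Aa Aau] : a \in A /\ a ^ u \in A.
  by rewrite !mem_gen // inE cycle_id ?orbT.
have sAG : A \subset G by rewrite join_subG !cycle_subG Ga groupJ.
have nAu : u \in 'N(A).
  have Aauu : a ^ (u ^+ 2) \in A.
    suff -> : a ^ (u ^+ 2) = (a ^ u * a)^-1 by rewrite groupV groupM.
    by apply: (mulIg (a ^ u * a)); rewrite mulgA cube mulVg.
  by rewrite inE /= conjYg -!cycleJ join_subG !cycle_subG -conjgM -(expgS u 1) Aau.
have abA : abelian A.
  by rewrite abelianY !cycle_abelian.
split=> //; last by exists A.
rewrite prime_coprime //; apply/negP=> dv3.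
have [b Ab ob] : exists2 b, b \in <[a]> & #[b] = 3.
  by have [] := Cauchy (isT : prime 3) dv3 => // b; exists b.
have Gb : b \in G by apply: mem_cycle_sub Ab.
have sAb : A \subset <[b]>.
  rewrite -(sc3_cent Gu ou cu Gb ob) subsetI sAG sub_cent1.
  by apply: (subsetP abA); apply: (subsetP (joing_subl _ _)).
have defAb : A :=: <[b]>.
  by apply/eqP; rewrite eqEsubset sAb cycle_subG (subsetP (joing_subl _ _)).
have nbu : <[u]> \subset 'N(<[b]>) by rewrite cycle_subG -defAb.
have p3 x : #[x] = 3 -> 3.-group <[x]> by rewrite /pgroup -[#|<[x]>|]/#[x] => ->.
have defu : <[b]> <*> <[u]> = <[u]>.
  apply: (sub_pHall (sc3_Sylow Gu ou cu)); rewrite ?joing_subr //=.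
    by rewrite norm_joinEr // pgroupM !p3.
  by rewrite join_subG !cycle_subG Gb.
have ua : a \in <[u]>.
  by rewrite -defu (subsetP (joing_subl _ _)) // -defAb.
have {ua} : a \in [set 1; u; u ^+ 2].
  case/cycleP: ua => k ->; rewrite -(expg_mod_order u k) ou.
  have := ltn_pmod k (isT : 0 < 3); case: (k %% 3) => [|[|[|//]]] _.
  - by rewrite !inE eqxx.
  - by rewrite !inE eqxx orbT.
  by rewrite !inE eqxx !orbT.
rewrite !inE -orbA => /or3P[] /eqP def_a.
- by move: dv3; rewrite def_a order1.
- by move: o2; rewrite def_a -expgSr u3 order1.
by move: o1; rewrite def_a -expgS u3 order1.
Qed.

Lemma triangle_set_odd a : a \in triangle_set -> odd #[a] ->
  exists2 R : {group gT}, max_gt3 R & a \in R.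
Proof.
move=> Da odda; have [_ _ co3 [A [defA sAG nAu]]] := triangle_set_group Da.
have gta : gt3.-group <[a]>.
  by rewrite /pgroup gt3_natE // (_ : 6 = (2 * 3)%N) // coprimeMl coprime2n odda.
have gtA : gt3.-group A.
  by rewrite defA pgroupM gta /pgroup -[#|_|]/#[a ^ u] orderJ.
have regA : regular_gt3 A by rewrite /regular_gt3 gtA sAG.
have [R maxR sAR] := maxgroup_exists regA.
exists R => //; apply: (subsetP sAR); rewrite defA.
by apply: (subsetP (mulG_subl _ _)); apply: cycle_id.
Qed.

Variable t : gT.
Hypotheses (Gt : t \in G) (ut : u ^ t = u^-1).

(** [P] is the product of [#|R|] over representatives of the orbits of ['N_G(<[u]>)] on [S]. Orbits
    have at most two members, members of different orbits have coprime orders, and each order is 1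
    modulo 3. The bound rests on [(p - 1) + (q - 1) <= p * q - 1]. *)
Lemma sum_max_gt3 (S : {set {group gT}}) :
    {in S, forall R, max_gt3 R} ->
    {in S & 'N_G(<[u]>), forall R n, (R :^ n)%G \in S} ->
  exists P, [/\ P %| #|G|`_gt3, P = 1 %[mod 3],
    (forall p, prime p -> p %| P -> exists2 R : {group gT}, R \in S & p %| #|R|) &
    \sum_(R in S) (#|gval R| - 1) <= 2 * (P - 1)].
Proof.
elim: {S}_.+1 {-2}S (ltnSn #|S|) => // m IHm S leSm maxS closS.
have [-> | [R SR]] := set_0Vmem S.
  exists 1%N; split; rewrite ?dvd1n ?big_set0 // => p pr.
  by rewrite dvdn1 => /eqP p1; rewrite p1 in pr.
have Nt : t \in 'N_G(<[u]>).
  by rewrite inE Gt; apply/normP; rewrite -cycleJ ut cycleV.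
have orbR n : n \in 'N_G(<[u]>) -> (R :^ n)%G \in [set R; (R :^ t^-1)%G].
  move=> Nn; have nRu : <[u]> \subset 'N(R).
    by rewrite cycle_subG; have /maxgroupp/and3P[] := maxS R SR.
  have [un | unt] := sc3_norm_index ou cu Gt ut Nn.
    by rewrite !inE; apply/orP; left; apply/eqP/val_inj/(normP (subsetP nRu _ un)).
  rewrite !inE; apply/orP; right; apply/eqP/val_inj => /=.
  by rewrite -{2}(normP (subsetP nRu _ unt)) -conjsgM mulgK.
pose S' := S :\: [set R; (R :^ t^-1)%G].
have sS'S : S' \subset S := subsetDl _ _.
have ltS'm : #|S'| < m.
  rewrite -ltnS; apply: leq_trans leSm; rewrite ltnS; apply: proper_card.
  by apply/properP; split=> //; exists R; rewrite // !inE eqxx.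
have closS' : {in S' & 'N_G(<[u]>), forall R' n, (R' :^ n)%G \in S'}.
  move=> R' n S'R' Nn; rewrite inE closS ?(subsetP sS'S) // andbT.
  move: (S'R'); rewrite inE => /andP[nR' _]; apply: contra nR'.
  have def_R' : R' = ((R' :^ n) :^ n^-1)%G by apply/val_inj; rewrite /= conjsgK.
  move=> /set2P[] def_R'n; rewrite def_R' def_R'n; first by rewrite orbR ?groupV.
  rewrite (_ : ((R :^ t^-1) :^ n^-1)%G = (R :^ (t^-1 * n^-1))%G) ?orbR ?groupM ?groupV //.
  by apply/val_inj; rewrite /= conjsgM.
have [P' [dvP' P'1 prP' sumP']] := IHm S' ltS'm (sub_in1 (subsetP sS'S) maxS) closS'.
have gtR : gt3.-group R by have /maxgroupp/and3P[] := maxS R SR.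
have sRG : R \subset G by have /maxgroupp/and3P[] := maxS R SR.
exists (P' * #|R|)%N; split.
- rewrite Gauss_dvd ?dvP' /=.
    by rewrite -(part_pnat_id gtR) partn_dvd ?cardG_gt0 // cardSg.
  have [// | ngcd1] := boolP (coprime P' #|R|).
  have gcd_gt1 : 1 < gcdn P' #|R|.
    by rewrite ltn_neqAle eq_sym ngcd1 gcdn_gt0 cardG_gt0 orbT.
  have pr := pdiv_prime gcd_gt1.
  have := pdiv_dvd (gcdn P' #|R|); rewrite dvdn_gcd => /andP[dv1 dv2].
  have [R' S'R' dv'] := prP' _ pr dv1.
  have [SR' nR'] := setDP S'R'.
  have [n Nn def_R'] := max_gt3_conj (maxS R SR) (maxS R' SR') pr dv2 dv'.
  by case/negP: nR'; rewrite (_ : R' = (R :^ n)%G) ?orbR //; apply/val_inj.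
- by rewrite -modnMm P'1 (max_gt3_mod3 (maxgroupp (maxS R SR))).
- move=> p pr; rewrite Euclid_dvdM // => /orP[/(prP' _ pr)[R' S'R' dv] | dv].
    by exists R'; rewrite // (subsetP sS'S).
  by exists R.
rewrite (big_setID [set R; (R :^ t^-1)%G]) /= -/S'.
rewrite (eq_bigr (fun=> #|R| - 1)%N) => [|R']; last first.
  by rewrite !inE => /andP[_ /orP[]/eqP-> //]; rewrite /= cardJg.
rewrite sum_nat_const.
have le2 : #|S :&: [set R; (R :^ t^-1)%G]| <= 2.
  by apply: leq_trans (subset_leq_card (subsetIr _ _)) _; rewrite cards2; case: (_ != _).
have P'0 : 0 < P' by case: P' P'1 {dvP' prP' sumP'}.
have R0 := cardG_gt0 R.
have le_y := leq_mul le2 (leqnn (#|R| - 1)).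
apply: leq_trans (leq_add le_y sumP') _.
rewrite -mulnDr leq_mul2l /=.
case: #|R| R0 => // r _; case: P' P'0 {P'1 dvP' prP' sumP'} => // p _.
by rewrite mulSn mulnS !subn1 /=; lia.
Qed.

Lemma regular_gt3J (R : {group gT}) n :
  n \in 'N_G(<[u]>) -> regular_gt3 R -> regular_gt3 (R :^ n)%G.
Proof.
case/setIP=> Gn nun /and3P[gtR sRG nRu].
rewrite /regular_gt3 pgroupJ gtR -{1}(conjGid Gn) conjSg sRG /= normJ mem_conjg.
have snR : <[u]> \subset 'N(R) by rewrite cycle_subG.
by apply: (subsetP snR); rewrite memJ_norm ?groupV // cycle_id.
Qed.

Lemma max_gt3J (R : {group gT}) n :
  n \in 'N_G(<[u]>) -> max_gt3 R -> max_gt3 (R :^ n)%G.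
Proof.
move=> Nn /maxgroupP[regR maxR]; apply/maxgroupP; split; first exact: regular_gt3J.
move=> H regH sRH; rewrite -[gval H](conjsgKV n); congr (_ :^ n).
apply: (maxR (H :^ n^-1)%G); first by apply: regular_gt3J; rewrite ?groupV.
by rewrite -(conjSg _ _ n) conjsgKV.
Qed.

Lemma card_triangle_odd : exists P, [/\ P %| #|G|`_gt3, P = 1 %[mod 3] &
  #|[set a in triangle_set | odd #[a] && (a != 1)]| <= 2 * (P - 1)].
Proof.
pose S := [set R | max_gt3 R].
have [||P [dvP P1 _ leP]] := @sum_max_gt3 S.
- by move=> R; rewrite inE.
- by move=> R n SR Nn; move: SR; rewrite /S 2!in_set => maxR; apply: max_gt3J.
exists P; split=> //; apply: leq_trans leP.
have sub : [set a in triangle_set | odd #[a] && (a != 1)]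
    \subset \bigcup_(R in S) (gval R)^#.
  apply/subsetP=> a; rewrite inE => /and3P[Da odda nta].
  have [R maxR Ra] := triangle_set_odd Da odda.
  by apply/bigcupP; exists R; [rewrite inE | rewrite in_setD1 nta].
apply: leq_trans (subset_leq_card sub) _.
elim/big_ind2: _ => [|A m B n leA leB|R _]; first by rewrite cards0.
  by apply: leq_trans (leq_add leA leB); rewrite cardsU leq_subr.
by rewrite [#|R|](cardsD1 1) group1 addKn.
Qed.

End OddPart.

(** * Integer parametrization of the group order *)

Section Parametrization.
Import Order.TTheory GRing.Theory Num.Theory GroupScope.
Local Open Scope ring_scope.

(** With [d = f - a], the first equation makes the quotient of [g] by [3 * f * (f + 1)] a square
    [m ^ 2], and then [c = m * d]. The relation [f + 3 * a = 4 * n] gives [d = 4 * r] for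
    [r = n - a]. *)
Lemma sc3_parametrization (g h c f n DT D : nat) (a : int) :
    (0 < g)%N -> (h * c = g)%N -> (0 < f)%N -> (f %% 3 = 1)%N ->
    (3 * f %| g)%N -> (3 * f.+1 %| g)%N ->
    h%:Z ^+ 2 * (f%:Z - a) ^+ 2 = 3 * g%:Z * f%:Z * (f%:Z + 1) ->
    3 * DT%:Z * f%:Z * (f%:Z + 1) =
      h%:Z * (f%:Z * (f%:Z + 1) + a * (f%:Z + 1) + (a + 1) * f%:Z) ->
    9 * D%:Z * f%:Z * (f%:Z + 1) = g%:Z * (f%:Z ^+ 2 + f%:Z + 1) ->
    f%:Z + 3 * a = 4 * n%:Z -> (DT <= h)%N ->
  exists r m : nat, [/\ [/\ f = n + 3 * r, n %% 3 = 1, 0 < r & 0 < m],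
    g = 3 * f * (f + 1) * m * m, c = 4 * m * r,
    4 * DT * r = m * ((3 * n + r) * f + 3 * n + 5 * r) &
    3 * D = m * m * (f * f + f + 1)]%N.
Proof.
move=> g0 hc f0 f3 dv1 dv2 E1 E2 E3 E4 leDT.
have h0 : (0 < h)%N by case: h hc {E1 E2 leDT} g0 => // <-.
(* A character value is bounded by the degree; here this is read off from [DT <= h] and the second
   equation. *)
have leaf : a <= f%:Z.
  rewrite leNgt; apply/negP=> ltfa.
  have : 3 * DT%:Z * f%:Z * (f%:Z + 1) <= h%:Z * (3 * (f%:Z * (f%:Z + 1))).
    have -> : 3 * DT%:Z * f%:Z * (f%:Z + 1) = DT%:Z * (3 * (f%:Z * (f%:Z + 1))) by ring.
    by apply: ler_wpM2r => //; rewrite !mulr_ge0 ?addr_ge0.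
  rewrite E2 ler_pM2l ?ltz_nat // => le3.
  have := mulr_gt0 (_ : 0 < a - f%:Z) (_ : 0 < 2 * f%:Z + 1).
  by rewrite subr_gt0 => /(_ ltfa) /(_ ltac:(clear; lia)); clear -le3; lia.
have nef : a != f%:Z.
  apply/eqP=> def_a; move: E1; rewrite def_a subrr expr0n mulr0 => /esym/eqP.
  by clear -g0 f0; nia.
have [d def_d] : exists d : nat, f%:Z - a = d%:Z.
  by exists `|f%:Z - a|%N; rewrite gez0_abs // subr_ge0.
have d0 : (0 < d)%N by clear -def_d nef leaf; lia.
have dvg : (3 * (f * f.+1) %| g)%N.
  have /dvdnP[g' def_g] : (3 %| g)%N := dvdn_trans (dvdn_mulr _ (dvdnn 3)) dv1.
  move: dv1 dv2; rewrite def_g ![(_ * 3)%N]mulnC !dvdn_pmul2l // => dv1 dv2.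
  by rewrite Gauss_dvd ?dv1 // coprimenS.
have [m' def_g] := dvdnP dvg.
have hd2 : ((h * d) ^ 2 = (3 * (f * f.+1)) ^ 2 * m')%N.
  have : (h%:Z * d%:Z) ^+ 2 = (3 * (f%:Z * (f%:Z + 1))) ^+ 2 * m'%:Z.
    by rewrite exprMn -def_d E1 def_g !PoszM -[f.+1]addn1 PoszD; ring.
  by rewrite !expr2 -!mulnn => E; clear -E; lia.
have : ((3 * (f * f.+1)) ^ 2 %| (h * d) ^ 2)%N by rewrite hd2 dvdn_mulr.
rewrite dvdn_pexp2r // => /dvdnP[m def_hd].
have ff0 : (0 < (3 * (f * f.+1)) ^ 2)%N by rewrite expn_gt0 !muln_gt0 f0.
have m2 : (m' = m * m)%N.
  apply/eqP; rewrite -(eqn_pmul2l ff0) -hd2 def_hd; apply/eqP; clear; ring.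
have m0 : (0 < m)%N.
  rewrite lt0n; apply/eqP=> m_0; move/eqP: def_hd; rewrite m_0 mul0n muln_eq0.
  by rewrite (gtn_eqF h0) (gtn_eqF d0).
have cE : (c = m * d)%N.
  apply/eqP; rewrite -(eqn_pmul2l h0) hc def_g m2; apply/eqP.
  by rewrite [RHS]mulnCA def_hd; clear; ring.
have [r def_r] : exists r : nat, n%:Z - a = r%:Z.
  by exists `|n%:Z - a|%N; rewrite gez0_abs //; clear -def_d E4; lia.
have d4 : d = (4 * r)%N by clear -def_d def_r E4; lia.
have fE : f = (n + 3 * r)%N by clear -def_r E4; lia.
exists r, m; split.
- split=> //; first by rewrite fE in f3; clear -f3; lia.
  by clear -d4 d0; lia.
- by rewrite def_g m2; clear; ring.
- by rewrite cE d4; clear; ring.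
- have aE : a = n%:Z - r%:Z by clear -def_r; lia.
  have E2' : 3 * DT%:Z * (f * (f + 1))%N%:Z * d%:Z =
     (3 * (f * f.+1) * m)%N%:Z * (f%:Z * (f%:Z + 1) + a * (f%:Z + 1) + (a + 1) * f%:Z).
    have -> : (3 * (f * f.+1) * m)%N%:Z = h%:Z * d%:Z :> int by rewrite mulnC -def_hd PoszM.
    by rewrite [RHS]mulrAC -E2 !PoszM PoszD; clear; ring.
  have ff : (f * (f + 1))%N%:Z != 0 :> int by rewrite eqz_nat -lt0n muln_gt0 f0 addn1.
  have : 3 * DT%:Z * d%:Z = 3 * m%:Z * (f%:Z * (f%:Z + 1) + a * (f%:Z + 1) + (a + 1) * f%:Z).
    apply: (mulIf ff); move: E2'; rewrite !PoszM -[f.+1]addn1; clear; lia.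
  by rewrite aE fE d4; clear; lia.
have ff : (f * (f + 1))%N%:Z != 0 :> int by rewrite eqz_nat -lt0n muln_gt0 f0 addn1.
have : 9 * D%:Z = 3 * m%:Z * m%:Z * (f%:Z ^+ 2 + f%:Z + 1).
  apply: (mulIf ff); move: E3; rewrite def_g m2 !PoszM -[f.+1]addn1 !PoszD !expr2; clear; lia.
by rewrite !expr2; clear; lia.
Qed.
End Parametrization.

(** As [v ^+ 2 * s] is the inverse of a conjugate of [v * s], [triangle333] applies: the conjugates
    of [s] under [v] commute, as in the alternating group of degree 4. *)
Lemma triangle_involution (gT : finGroupType) (v s : gT) :
    #[v] = 3 -> s ^+ 2 = 1 -> (v * s) ^+ 3 = 1 ->
  commute s (s ^ v) /\ s ^ (v ^+ 2) = s * s ^ v.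
Proof.
move=> ov s2 e1; have v3 : v ^+ 3 = 1 by rewrite -ov expg_order.
have sV := involutionV s2.
have e2 : (v ^+ 2 * s) ^+ 3 = 1.
  have -> : v ^+ 2 * s = ((v * s) ^ v)^-1.
    rewrite conjgE -(mulgA v s v) mulKg invMg sV; congr (_ * _).
    by apply: (mulgI v); rewrite mulgV -expgS.
  by rewrite expgVn -conjXg e1 conj1g invg1.
have [c1 e3] := triangle333 v3 e1 e2; split=> //.
have -> : s ^ (v ^+ 2) = (s ^ v * s)^-1.
  by apply: (mulIg (s ^ v * s)); rewrite mulgA e3 mulVg.
by rewrite invMg -conjVg sV.
Qed.

Lemma card_four_set (gT : finGroupType) (s r : gT) :
  s ^+ 2 = 1 -> s != 1 -> r != 1 -> r != s -> #|[set 1; s; r; s * r]| = 4.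
Proof.
move=> s2 nts ntr ners.
have ne3 : s * r != 1.
  by rewrite -eq_invg_mul; apply: contra ners => /eqP<-; rewrite eq_invg_mul -(expgS s 1) s2.
have ne4 : s * r != s by rewrite -[X in _ != X]mulg1 (inj_eq (mulgI s)).
have ne5 : s * r != r by rewrite -[X in _ != X]mul1g (inj_eq (mulIg _)).
rewrite (_ : 4 = #|[:: 1; s; r; s * r]|) //.
  by apply: eq_card => x; rewrite !inE -!orbA.
apply/esym/card_uniqP; rewrite /= !inE !negb_or.
rewrite (eq_sym 1 s) (eq_sym 1 r) (eq_sym 1 (_ * _)) (eq_sym s r).
by rewrite (eq_sym s (_ * _)) (eq_sym r (_ * _)) nts ntr ne3 ners ne4 ne5.
Qed.

(** Both sides count the pairs of conjugates of [x] and [y] related by [Q]. *)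
Lemma class_pair_count (gT : finGroupType) (G : {group gT}) (x y : gT) (Q : rel gT) :
    (forall v s g, g \in G -> Q (v ^ g) (s ^ g) = Q v s) ->
  (#|x ^: G| * #|[set s in y ^: G | Q x s]| = #|y ^: G| * #|[set v in x ^: G | Q v y]|)%N.
Proof.
move=> invQ.
have leE (z w : gT) (R : rel gT) : (forall v s g, g \in G -> R (v ^ g) (s ^ g) = R v s) ->
  (#|z ^: G| * #|[set s in w ^: G | R z s]| =
     \sum_(v in z ^: G) \sum_(s in w ^: G) R v s)%N.
  move=> invR; rewrite -sum_nat_const; apply: eq_bigr => v /imsetP[g Gg ->].
  rewrite -sum1dep_card big_mkcondr /= [RHS](reindex_inj (conjg_inj g)) /=.
  apply: eq_big => [s | s _]; last by rewrite invR //; case: (R z s).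
  by rewrite memJ_norm // (subsetP (class_norm w G)).
rewrite (leE x y Q) // (leE y x [rel s v | Q v s]) //; last by move=> *; apply: invQ.
exact: exchange_big.
Qed.

(** * Triangle elements of even order and centralizers of involutions *)

Section Involutions.

Variables (gT : finGroupType) (G : {group gT}) (u t : gT).
Hypotheses (Gu : u \in G) (ou : #[u] = 3) (cu : 'C_G[u] = <[u]>).
Hypotheses (Gt : t \in G) (ot : #[t] = 2) (ut : u ^ t = u^-1).

Let T3 := [set s in t ^: G | #[u * s] == 3].

Lemma triangle_involutionP s : s \in T3 ->
  [/\ s \in G, s ^+ 2 = 1, s != 1, s ^ u != s & commute s (s ^ u) /\ s ^ (u ^+ 2) = s * s ^ u].
Proof.
rewrite inE => /andP[Ts /eqP us3]; have [Gs os sV] := involution_class Gt ot Ts.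
have s2 : s ^+ 2 = 1 by rewrite -os expg_order.
have nts : s != 1 by rewrite -order_eq1 os.
split=> //; last by apply: triangle_involution => //; rewrite -us3 expg_order.
apply: contra nts => /eqP/conjg_fixP/commgP/commute_sym cus.
by rewrite (sc3_comm Gu ou cu Gu ou Gs _ cus) ?os.
Qed.

Lemma triangle_involutionJ s : s \in T3 -> s ^ u \in T3.
Proof.
rewrite !inE => /andP[Ts us3].
have -> : u * s ^ u = (u * s) ^ u by rewrite conjMg [u ^ u]conjgE mulKg.
by rewrite memJ_norm ?(subsetP (class_norm t G)) // Ts orderJ us3.
Qed.

Lemma dvd3_card_T3 : 3 %| #|T3|.
Proof.
have pu : 3.-group <[u]> by rewrite /pgroup -[#|<[u]>|]/#[u] ou.
have actT : [acts <[u]>, on T3 | 'J].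
  rewrite cycle_subG inE /= inE; apply/andP; split=> //; rewrite inE.
  by apply/subsetP=> s T3s; rewrite inE; apply: triangle_involutionJ.
have := pgroup_fix_mod pu actT; rewrite /dvdn => ->.
rewrite (_ : 'Fix_(T3 | 'J)(<[u]>) = set0) ?cards0 //.
apply/setP=> s; rewrite !in_set0; apply/setIP=> [[T3s]].
move/afixP/(_ _ (cycle_id u)) => /= sus.
by have [_ _ _ /eqP[]] := triangle_involutionP T3s.
Qed.

Lemma four_group_T3 s : s \in T3 ->
  exists2 W : {group gT}, W \subset G & [/\ #|W| = 4, u \in 'N(W) & W^# \subset t ^: G].
Proof.
move=> T3s; have [Gs s2 nts nesu [cs suu]] := triangle_involutionP T3s.
have T3su := triangle_involutionJ T3s; have [Gsu su2 ntsu _ _] := triangle_involutionP T3su.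
have gW : group_set [set 1; s; s ^ u; s * s ^ u].
  have ss : s * s = 1 by rewrite -(expgS s 1).
  have ss' : s ^ u * s ^ u = 1 by rewrite -(expgS _ 1).
  have cs' : s ^ u * s = s * s ^ u by rewrite cs.
  have e1 : s * (s * s ^ u) = s ^ u by rewrite mulgA ss mul1g.
  have e2 : s ^ u * (s * s ^ u) = s by rewrite mulgA cs' -mulgA ss' mulg1.
  have e3 : s * s ^ u * s = s ^ u by rewrite -mulgA cs' e1.
  have e4 : s * s ^ u * s ^ u = s by rewrite -mulgA ss' mulg1.
  have e5 : s * s ^ u * (s * s ^ u) = 1 by rewrite mulgA e3 ss'.
  apply/group_setP; split=> [|x y]; first by rewrite !inE eqxx.
  rewrite !inE -!orbA => /or4P[] /eqP-> /or4P[] /eqP->;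
    rewrite ?mul1g ?mulg1 ?ss ?ss' ?cs' ?e1 ?e2 ?e3 ?e4 ?e5 ?eqxx ?orbT //.
pose W := Group gW; exists W => /=.
  by apply/subsetP=> x; rewrite !inE -!orbA => /or4P[] /eqP-> //; apply: groupM.
split; first exact: card_four_set.
  have suuV : (s ^ u) ^ u = s * s ^ u by rewrite -conjgM.
  rewrite inE; apply/subsetP=> y /imsetP[x].
  rewrite !inE -!orbA => /or4P[] /eqP -> ->.
  - by rewrite conj1g eqxx.
  - by rewrite eqxx !orbT.
  - by rewrite suuV eqxx !orbT.
  by rewrite (conjMg s) suuV mulgA -cs -mulgA -(expgS (s ^ u) 1) su2 mulg1 eqxx !orbT.
apply/subsetP=> x; rewrite !inE -!orbA => /andP[ntx] /or4P[] /eqP def_x.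
- by rewrite def_x eqxx in ntx.
- by move: T3s; rewrite inE def_x => /andP[].
- by move: T3su; rewrite inE def_x => /andP[].
by move: (triangle_involutionJ T3su); rewrite inE -conjgM -(expgS u 1) suu def_x => /andP[].
Qed.

Definition four_cent s := 'C_G[s] :&: 'C[s ^ u].
(** For [s] in [big_cent] the group ['C_G[s]] is normalized by [u], which leaves at most two such
    groups. For [s] in [small_cent] the centralizer [four_cent s] of the four-group generated by [s]
    and [s ^ u] has index at least 2 in ['C_G[s]]. The two kinds are counted differently. *)
Definition big_cent := [set s in T3 | 'C_G[s] \subset 'C[s ^ u]].
Definition small_cent := [set s in T3 | ~~ ('C_G[s] \subset 'C[s ^ u])].

Lemma four_centJ s : s \in T3 -> four_cent (s ^ u) = four_cent s.
Proof.
move=> T3s; have [_ _ _ _ [cs suu]] := triangle_involutionP T3s.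
rewrite /four_cent -conjgM -(expgS u 1) suu.
apply/setP=> x; apply/setIP/setIP=> -[/setIP[Gx /cent1P c1] /cent1P c2].
  split; last exact/cent1P.
  rewrite inE Gx; apply/cent1P.
  by have := commuteM c2 (commuteV c1); rewrite mulgK.
split; last exact/cent1P/commuteM.
by rewrite inE Gx; apply/cent1P.
Qed.

Lemma small_centJ s : s \in small_cent -> s ^ u \in small_cent.
Proof.
rewrite !in_set => /andP[/andP[Ts us3] nsC]; have T3s : s \in T3 by rewrite inE Ts.
have := triangle_involutionJ T3s; rewrite inE => -> /=; apply: contra nsC => sC.
rewrite -(conjSg _ _ u) conjIg (conjGid Gu) -cent1J (subset_trans sC) //.
by rewrite -cent1J.
Qed.

Lemma card_centT3 s : s \in T3 -> #|'C_G[s]| = #|'C_G[t]|.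
Proof.
rewrite inE => /andP[/imsetP[g Gg ->] _].
by rewrite cent1J -{1}(conjGid Gg) -conjIg cardJg.
Qed.

Lemma big_cent_conj s s1 : s \in big_cent -> s1 \in big_cent ->
  'C_G[s] = 'C_G[s1] \/ 'C_G[s] = 'C_G[s1] :^ t^-1.
Proof.
have nC r : r \in big_cent -> <[u]> \subset 'N('C_G[r]).
  rewrite inE => /andP[T3r sC]; rewrite cycle_subG inE.
  have -> : 'C_G[r] :^ u = 'C_G[r]; last exact: subxx.
  apply/eqP; rewrite eq_sym eqEcard cardJg leqnn andbT.
  by rewrite conjIg (conjGid Gu) -cent1J subsetI subsetIl.
move=> S1s S1s1; have [] := (nC s S1s, nC s1 S1s1) => ns ns1.
have [T3s T3s1] : s \in T3 /\ s1 \in T3 by move: S1s S1s1; rewrite !inE => /andP[-> _] /andP[-> _].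
have [g Gg def_s] : exists2 g, g \in G & s = s1 ^ g.
  move: T3s T3s1; rewrite !inE => /andP[Ts _] /andP[Ts1 _].
  by apply/imsetP; rewrite -(class_eqP Ts1) in Ts.
have defC : 'C_G[s] :=: 'C_G[s1] :^ g by rewrite conjIg (conjGid Gg) -cent1J def_s.
have [n Nn ->] := Sylow_norm_conj (sc3_Sylow Gu ou cu) Gg ns1 ns defC.
have [un | unt] := sc3_norm_index ou cu Gt ut Nn; [left | right].
  exact: (normP (subsetP ns1 _ un)).
by rewrite -[in RHS](normP (subsetP ns1 _ unt)) -conjsgM mulgK.
Qed.

(** The pairs counted by [T3], seen from [t] instead of [u]; each [v] sends [t] to an involution in
    [I]. *)
Let X := [set v in u ^: G | #[v * t] == 3].
Let I := [set s in t ^: G | (s \in 'C[t]) && (s != t)].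

Lemma triangle_class v : v \in X -> [/\ v \in G, t ^ v \in I & t ^ (v ^+ 2) = t * t ^ v].
Proof.
rewrite inE => /andP[Cv /eqP vt3]; have Gv : v \in G by case/imsetP: Cv => g Gg ->; rewrite groupJ.
have ov : #[v] = 3 by case/imsetP: Cv => g Gg ->; rewrite orderJ.
have t2 : t ^+ 2 = 1 by rewrite -ot expg_order.
have vt1 : (v * t) ^+ 3 = 1 by rewrite -vt3 expg_order.
have [ct tvv] := triangle_involution ov t2 vt1.
split=> //; rewrite inE memJ_class //=; apply/andP; split; first exact/cent1P/commute_sym.
apply/negP=> /eqP/conjg_fixP/commgP/commute_sym cvt.
by have := ot; rewrite (sc3_comm Gu ou cu Gv ov Gt _ cvt) ?ot // order1.
Qed.

(** The quotient of two elements of the fibre fixes [t], and it fixes [s] because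
    [t ^ (v ^+ 2) = t * s]. *)
Lemma card_triangle_fiber s : s \in I ->
  #|[set v in X | t ^ v == s]| <= #|'C_G[t] :&: 'C[s]|.
Proof.
move=> Is; have [-> | [v0]] := set_0Vmem [set v in X | t ^ v == s]; first by rewrite cards0.
rewrite inE => /andP[/triangle_class[Gv0 _ tv0] /eqP def_s].
rewrite -(card_imset [set v in X | t ^ v == s] (mulIg v0^-1)); apply/subset_leq_card/subsetP=> w /imsetP[v + ->].
rewrite inE => /andP[/triangle_class[Gv _ tv] /eqP tvs].
have fix_cent r : r ^ (v * v0^-1) = r -> v * v0^-1 \in 'C[r].
  by move=> rJ; apply/cent1P/commute_sym/commgP/conjg_fixP.
apply/setIP; split; last apply: fix_cent.
  rewrite inE groupM ?groupV //=; apply: fix_cent.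
  by rewrite conjgM tvs -def_s conjgK.
rewrite -{1}tvs conjgM -(conjgM t) -(expgS v 1) tv tvs -def_s -tv0.
by rewrite (expgS v0 1) conjgM conjgK.
Qed.

Lemma card_triangle_sum (R : pred gT) :
  #|[set v in X | R (t ^ v)]| <= \sum_(s in I | R s) #|'C_G[t] :&: 'C[s]|.
Proof.
rewrite -sum1_card (partition_big (conjg t) [pred s | (s \in I) && R s]) /= => [|v]; last first.
  by rewrite inE => /andP[/triangle_class[_ -> _]].
apply: leq_sum => s /andP[Is Rs]; apply: leq_trans (card_triangle_fiber Is).
rewrite sum1_card; apply/subset_leq_card/subsetP=> v.
by rewrite unfold_in /= !inE => /andP[/andP[-> _] ->].
Qed.

Lemma card_centralizing_involutions : #|I| + 2 <= #|'C_G[t]|.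
Proof.
have nt1 : t != 1 by rewrite -order_eq1 ot.
have <- : #|[set 1; t]| = 2 by rewrite cards2 eq_sym nt1.
have dis : I :&: [set 1; t] = set0.
  apply/setP=> s; rewrite !inE; apply/andP=> -[/and3P[Ts _ nst] /orP[/eqP s1 | st]].
    by have [_ ] := involution_class Gt ot Ts; rewrite s1 order1.
  by rewrite st in nst.
rewrite -cardsUI dis cards0 addn0; apply/subset_leq_card/subsetP=> s.
case/setUP=> [|/set2P[]->]; last 2 first.
- exact: group1.
- by rewrite inE Gt cent1id.
rewrite inE => /and3P[Ts cst _].
by rewrite inE cst andbT; have [] := involution_class Gt ot Ts.
Qed.

(** A fibre has at most [#|'C_G[t]|] elements, and at most half as many when ['C_G[t]] does not
    centralize [s], which the factor 2 evens out. At most [#|'C_G[t]| - 2] involutions [s] occur. *)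
Lemma card_triangle_classes :
  #|[set v in X | 'C_G[t] \subset 'C[t ^ v]]| + 2 * #|[set v in X | ~~ ('C_G[t] \subset 'C[t ^ v])]|
    <= #|'C_G[t]| * (#|'C_G[t]| - 2).
Proof.
have le1 := card_triangle_sum [pred s | 'C_G[t] \subset 'C[s]].
have le2 := card_triangle_sum [pred s | ~~ ('C_G[t] \subset 'C[s])].
apply: leq_trans (leq_add le1 (leq_mul (leqnn 2) le2)) _.
rewrite big_distrr /=.
apply: (@leq_trans (\sum_(s in I) #|'C_G[t]|)).
  rewrite [X in _ <= X](bigID (fun s => 'C_G[t] \subset 'C[s])) /=.
  apply: leq_add; apply: leq_sum => s /andP[_]; first by rewrite subset_leq_card ?subsetIl.
  move=> nsC; rewrite -(Lagrange (subsetIl 'C_G[t] 'C[s])) mulnC leq_mul2l.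
  by rewrite indexg_gt1 subsetI subxx nsC orbT.
by rewrite sum_nat_const mulnC leq_mul2l -(addnK 2 #|I|) leq_sub2r ?orbT // card_centralizing_involutions.
Qed.

(** Let [S] be a Sylow 2-subgroup of ['C_G[t]] containing [t]. At least [#|'C_G[t] :&: 'C[s]|]
    elements of ['C_G[t]] carry a given [s] of [I] into [S :\: [set 1; t]], and each of them carries
    at most [#|S| - 2] involutions there. *)
Lemma card_triangle_Sylow : #|X| <= #|'C_G[t]| * (#|'C_G[t]|`_2 - 2).
Proof.
have Ct : t \in 'C_G[t] by rewrite inE Gt cent1id.
have pt : 2.-group <[t]> by rewrite /pgroup -[#|<[t]>|]/#[t] ot.
have stC : <[t]> \subset 'C_G[t] by rewrite cycle_subG.
have [S sylS stS] := Sylow_superset stC pt.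
have sSC := pHall_sub sylS.
pose S0 := S :\: [set 1; t].
have cardS0 : #|S0| = (#|'C_G[t]|`_2 - 2)%N.
  rewrite cardsD -(card_Hall sylS) (setIidPr _) ?cards2 1?eq_sym -?order_eq1 ?ot //.
  by rewrite subUset !sub1set group1 -cycle_subG.
apply: (@leq_trans (\sum_(s in I) #|'C_G[t] :&: 'C[s]|)).
  have := card_triangle_sum predT; rewrite (eq_bigl (mem I)) => [|s]; last by rewrite andbT.
  by apply: leq_trans; apply/subset_leq_card/subsetP=> v Xv; rewrite inE Xv.
rewrite -cardS0 -sum_nat_const.
apply: (@leq_trans (\sum_(s in I) \sum_(y in 'C_G[t]) ((s ^ y)%g \in S0))).
  apply: leq_sum => s Is; move: (Is); rewrite inE => /and3P[Ts cst nst].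
  have [Gs os _] := involution_class Gt ot Ts.
  have sSs : <[s]> \subset 'C_G[t] by rewrite cycle_subG inE Gs.
  have ps : 2.-group <[s]> by rewrite /pgroup -[#|<[s]>|]/#[s] os.
  have [y Cy] := Sylow_Jsub sylS sSs ps; rewrite -cycleJ cycle_subG => Ssy.
  rewrite -big_mkcondr sum1_card -(card_imset _ (mulIg y)).
  apply/subset_leq_card/subsetP=> _ /imsetP[z /setIP[Cz cz] ->].
  have szy : s ^ (z * y) = s ^ y.
    by rewrite conjgM; congr (_ ^ _); apply/conjg_fixP/commgP/commute_sym/cent1P.
  rewrite unfold_in /= groupM //= szy in_setD Ssy andbT !inE negb_or.
  rewrite -{1}(conj1g y) (inj_eq (conjg_inj y)) -order_eq1 os /=.
  have <- : t ^ y = t by apply/conjg_fixP/commgP/commute_sym/cent1P; case/setIP: Cy.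
  by rewrite (inj_eq (conjg_inj y)).
rewrite exchange_big /=; apply: leq_sum => y _.
rewrite -big_mkcondr sum1_card -(card_imset _ (conjg_inj y)).
by apply/subset_leq_card/subsetP=> _ /imsetP[s /andP[_ Ss] ->].
Qed.

Lemma card_T3_pairs (R : rel gT) :
    (forall v s g, g \in G -> R (v ^ g) (s ^ g) = R v s) ->
  (#|'C_G[t]| * #|[set s in T3 | R u s]| = 3 * #|[set v in X | R v t]|)%N.
Proof.
move=> invR; have := @class_pair_count _ G u t [rel v s | (#[v * s] == 3) && R v s].
have -> : [set s in t ^: G | (#[u * s] == 3) && R u s] = [set s in T3 | R u s].
  by apply/setP=> s; rewrite !inE andbA.
have -> : [set v in u ^: G | (#[v * t] == 3) && R v t] = [set v in X | R v t].
  by apply/setP=> s; rewrite !inE andbA.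
move=> /(_ _)/= count.
have {count} : (#|u ^: G| * #|[set s in T3 | R u s]| = #|t ^: G| * #|[set v in X | R v t]|)%N.
  by apply: count => v s g Gg; rewrite -conjMg orderJ invR.
have e1 : (#|'C_G[t]| * #|t ^: G|)%N = #|G| by rewrite -index_cent1 Lagrange ?subsetIl.
have := sc3_card_class Gu ou cu; have := cardG_gt0 G; move: e1.
move: #|'C_G[t]| #|t ^: G| #|u ^: G| #|G| #|[set _ in T3 | _]| #|[set _ in X | _]| => c h k g x y e1 g0 e2 e3.
apply/eqP; rewrite -(eqn_pmul2l g0); apply/eqP; transitivity (3 * c * (k * x))%N.
  by rewrite -e2; clear; lia.
by rewrite e3 -e1; clear; lia.
Qed.

Lemma card_T3_bounds :
  #|T3| <= 3 * (#|'C_G[t]|`_2 - 2) /\ #|T3| + #|small_cent| <= 3 * (#|'C_G[t]| - 2).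
Proof.
have c0 : 0 < #|'C_G[t]| := cardG_gt0 _.
split; rewrite -(leq_pmul2l c0).
  have := @card_T3_pairs (fun _ _ => true) (fun _ _ _ _ => erefl).
  have -> : [set s in T3 | true] = T3 by apply/setP=> s; rewrite !inE andbT.
  have -> : [set s in X | true] = X by apply/setP=> s; rewrite !inE andbT.
  by move->; rewrite mulnCA leq_mul2l card_triangle_Sylow.
have inv (v s g : gT) : g \in G -> ('C_G[s ^ g] \subset 'C[(s ^ g) ^ (v ^ g)]) = ('C_G[s] \subset 'C[s ^ v]).
  by move=> Gg; rewrite -conjJg !cent1J -{1}(conjGid Gg) -conjIg conjSg.
have e1 := @card_T3_pairs (fun v s => 'C_G[s] \subset 'C[s ^ v]) inv.
have e2 := @card_T3_pairs (fun v s => ~~ ('C_G[s] \subset 'C[s ^ v])) (fun v s g Gg => congr1 negb (inv v s g Gg)).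
have := card_triangle_classes; rewrite -/big_cent -/small_cent in e1 e2.
have -> : #|T3| = (#|big_cent| + #|small_cent|)%N.
  rewrite -(cardsID [set s | 'C_G[s] \subset 'C[s ^ u]] T3).
  by congr (_ + _)%N; apply: eq_card => s; rewrite !inE // andbC.
move: e1 e2; move: #|big_cent| #|small_cent| #|[set _ in _ | _]| #|[set _ in X | _]| => b s x y e1 e2 le.
by rewrite 2!mulnDr e1 e2 -addnA (mulnCA _ 3); move: le; move: (_ * (_ - _))%N => z; clear; lia.
Qed.

Hypothesis allT : forall s, s \in G -> #[s] = 2 -> s \in t ^: G.

(** For [a] of even order this is the involution of [<[a]>]. *)
Let half (a : gT) := a ^+ (#[a]./2).

Let E := [set a in triangle_set G u | ~~ odd #[a]].

Lemma even_half a : a \in E -> [/\ half a \in T3, a != 1 & a \in four_cent (half a)].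
Proof.
rewrite inE => /andP[Da evena]; have [ca cube co3 [A [defA sAG nAu]]] := triangle_set_group Gu ou cu Da.
have Ga : a \in G by move: Da; rewrite inE => /andP[].
have nta : a != 1 by apply: contraNneq evena => ->; rewrite order1.
have o2 : #[half a] = 2.
  have e2 : #[a] = (#[a]./2 * 2)%N by rewrite muln2 -[LHS](odd_double_half #[a]) (negPf evena).
  rewrite orderXdiv; first by rewrite {1}e2 mulKn // half_gt0 ltn_neqAle eq_sym order_eq1 nta order_gt0.
  by rewrite {2}e2 dvdn_mulr.
have coA : coprime 3 #|A|.
  apply: (@coprime_dvdr _ (#[a] * #[a ^ u])); last by rewrite coprimeMr orderJ co3.
  by rewrite defA /order mul_cardG dvdn_mulr.
have Ghalf : half a \in G by rewrite groupX.
split=> //; last first.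
  apply/setIP; split; first by rewrite inE Ga; apply/cent1P/commuteX/commute_refl.
  by apply/cent1P; rewrite /half conjXg; apply: commuteX.
rewrite inE allT //=.
have Ah : half a \in A by rewrite defA (subsetP (mulG_subl _ _)) // mem_cycle.
have regA : 'C_A[u] = 1 := sc3_regular Gu ou cu sAG coA Gu ou.
have [y Ay def_uh] := commgM_conj nAu regA Ah.
by rewrite def_uh orderJ ou.
Qed.

(** All these [a] lie in the two centralizers left by [big_cent_conj]. *)
Lemma card_even_big : #|[set a in E | half a \in big_cent]| <= 2 * (#|'C_G[t]| - 1).
Proof.
have [S10 | [s1 S1s1]] := set_0Vmem big_cent.
  rewrite (_ : [set _ in _ | _] = set0) ?cards0 //.
  by apply/setP=> a; rewrite S10 !inE andbF.
apply: (@leq_trans #|'C_G[s1]^# :|: ('C_G[s1] :^ t^-1)^#|).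
  apply/subset_leq_card/subsetP=> a; rewrite inE => /andP[Ea S1a].
  have [_ nta /setIP[Ca _]] := even_half Ea.
  rewrite inE !in_setD1 nta /=.
  by have [<-|<-] := big_cent_conj S1a S1s1; rewrite Ca ?orbT.
have T3s1 : s1 \in T3 by move: S1s1; rewrite inE => /andP[].
rewrite -(card_centT3 T3s1); apply: leq_trans (leq_card_setU _ _) _.
have cE (H : {set gT}) : 1 \in H -> #|H^#| = (#|H| - 1)%N.
  by move=> H1; rewrite [#|H|](cardsD1 1) H1 addKn.
by rewrite mul2n -addnn !cE ?group1 // cardJg.
Qed.

(** Each [a] is counted three times, in [four_cent] of the three conjugates of [half a] under [u],
    and each [four_cent s] has index at least 2 in ['C_G[s]]. *)
Lemma card_even_small :
  6 * #|[set a in E | half a \in small_cent]| <= #|small_cent| * (#|'C_G[t]| - 2).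
Proof.
set E2 := [set a in E | _].
have le2 s : s \in small_cent -> 2 * #|(four_cent s)^#| <= #|'C_G[t]| - 2.
  rewrite inE => /andP[T3s nsC]; rewrite -(card_centT3 T3s).
  have sF : four_cent s \subset 'C_G[s] := subsetIl _ _.
  have iF : 1 < #|'C_G[s] : four_cent s|.
    by rewrite indexg_gt1 subsetI subxx.
  have := Lagrange sF; rewrite [#|four_cent s|](cardsD1 1) group1.
  by move=> <-; move: iF; move: #|_ : _| #|_^#| => i x; nia.
have le3 a : a \in E2 -> 3 <= \sum_(s in small_cent) (a \in four_cent s).
  rewrite inE => /andP[Ea]; have [_ nta Fa] := even_half Ea.
  set s := half a in Fa * => S2s.
  have T3s : s \in T3 by move: S2s; rewrite inE => /andP[].
  have [_ _ _ nesu [cs suu]] := triangle_involutionP T3s.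
  have T3su := triangle_involutionJ T3s.
  have Fsu := four_centJ T3s; have Fsuu := four_centJ T3su; have Ssu := small_centJ S2s.
  have neuu : (s ^ u) ^ u != s.
    rewrite -conjgM -(expgS u 1) suu -[X in _ != X]mulg1 (inj_eq (mulgI s)).
    by have [_ _ ] := triangle_involutionP T3su.
  rewrite (_ : 3 = #|[set s; s ^ u; (s ^ u) ^ u]|); last first.
    rewrite setUC cardsU1 cards2 !inE negb_or neuu (inj_eq (conjg_inj u)) nesu.
    by rewrite eq_sym nesu.
  rewrite -big_mkcondr sum1_card; apply/subset_leq_card/subsetP=> r; rewrite !inE.
  rewrite -orbA unfold_in /=.
  by case/or3P=> /eqP->; rewrite ?Fsuu ?Fsu Fa andbT // ?small_centJ.
rewrite -[X in X <= _]/(6 * #|E2|)%N.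
have : (3 * #|E2| <= \sum_(s in small_cent) #|(four_cent s)^#|)%N.
  rewrite mulnC -sum_nat_const.
  apply: (@leq_trans (\sum_(a in E2) \sum_(s in small_cent) (a \in four_cent s))).
    by apply: leq_sum => a; apply: le3.
  rewrite exchange_big /=; apply: leq_sum => s _.
  rewrite -big_mkcondr sum1_card; apply/subset_leq_card/subsetP=> a.
  rewrite in_setD1 => /andP[E2a ->]; rewrite andbT.
  by move: E2a; rewrite inE => /andP[/even_half[]].
move=> le_sum; rewrite (_ : 6 = 2 * 3)%N // -mulnA.
apply: leq_trans (leq_mul (leqnn 2) le_sum) _.
by rewrite big_distrr -sum_nat_const /=; apply: leq_sum.
Qed.

End Involutions.

(** The centralizer of an involution in the centre of a Sylow 2-subgroup contains that subgroup, and
    all involutions are conjugate. *)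
Lemma involution_cent_2part (gT : finGroupType) (G : {group gT}) t :
    t \in G -> #[t] = 2 -> (forall s, s \in G -> #[s] = 2 -> s \in t ^: G) ->
  (#|'C_G[t]|`_2 = #|G|`_2)%N.
Proof.
move=> Gt ot allT; have [P sylP] := Sylow_exists 2 G.
have [sPG pP _] := and3P sylP.
have dv2 : 2 %| #|'Z(P)|.
  have ntZ : 'Z(P) != 1.
    rewrite (center_nil_eq1 (pgroup_nil pP)) -cardG_gt1 (card_Hall sylP) p_part_gt1.
    by have := order_dvdG Gt; rewrite ot mem_primes cardG_gt0.
  by have [] := pgroup_pdiv (pgroupS (center_sub P) pP) ntZ.
have [z /setIP[Pz cPz] oz] := Cauchy (isT : prime 2) dv2.
have Gz := subsetP sPG z Pz.
have sPC : P \subset 'C_G[z] by rewrite subsetI sPG sub_cent1.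
rewrite -(card_Hall sylP) (card_Hall (pHall_subl sPC (subsetIl _ _) sylP)).
have /imsetP[g Gg ->] := allT z Gz oz.
by rewrite /= cent1J -{2}(conjGid Gg) -conjIg cardJg.
Qed.

(** * Orders of groups with trivial 3'-core *)

Section Orders.

Variables (gT : finGroupType) (G : {group gT}) (u t s0 : gT).
Hypotheses (Gu : u \in G) (ou : #[u] = 3) (cu : 'C_G[u] = <[u]>).
Hypotheses (Gt : t \in G) (ot : #[t] = 2) (ut : u ^ t = u^-1).
Hypotheses (Ts0 : s0 \in t ^: G) (us0 : #[u * s0] = 3) (O1 : 'O_3^'(G) = 1).

Lemma sc3_orders :
  (forall s, s \in G -> #[s] = 2 -> s \in t ^: G) /\
  ((#|G| = 60 /\ #|'C_G[t]| = 4) \/ (#|G| = 168 /\ #|'C_G[t]| = 8)).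
Proof.
have [f [a [K [[f0 f3 dv1 dv2] [nKG f1K fn1] E1 E2 [E3 EW]]]]] := sc3_numbers Gu ou cu Gt ot ut.
have [Gs0 os0 s0V] := involution_class Gt ot Ts0.
(* If [f = 1], the normal subgroup [K] contains [u], hence the element [u * s0] of order 3, hence
   [s0] and its conjugate [t], a contradiction. *)
have f_n1 : f <> 1%N.
  case/f1K/andP=> Ku ntK; case/negP: ntK.
  have Kus : u * s0 \in K.
    have Gus : u * s0 \in G by rewrite groupM.
    have [g Gg [->|->]] := sc3_class Gu ou cu Gus us0; rewrite memJ_norm ?groupV //;
      exact: (subsetP (normal_norm nKG)).
  have Ks : s0 \in K by rewrite -(groupMl s0 Ku).
  have : t \in s0 ^: G by rewrite class_sym.
  case/imsetP=> g Gg ->; rewrite memJ_norm //; exact: (subsetP (normal_norm nKG)).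
have [coK allT'] := fn1 f_n1.
have K1 : K :=: 1.
  by apply/trivgP; rewrite -O1 pcore_max // /pgroup p'natE // -prime_coprime.
have allT s : s \in G -> #[s] = 2 -> s \in t ^: G.
  move=> Gs os; apply: allT' => //; rewrite K1 inE -order_eq1 os //.
split=> //.
pose T3 := [set s in t ^: G | #[u * s] == 3].
have T3s0 : s0 \in T3 by rewrite inE Ts0 us0.
have [W sWG [cW _ WT]] := four_group_T3 Gu ou cu Gt ot T3s0.
have [n E4] := EW W sWG cW WT.
have hc : (#|t ^: G| * #|'C_G[t]|)%N = #|G| by rewrite mulnC -index_cent1 Lagrange ?subsetIl.
have leT3 : #|T3| <= #|t ^: G| by apply/subset_leq_card/subsetP=> s; rewrite inE => /andP[].
have [r [m [[def_f n3 r0 m0] gE cE T3E DE]]] :=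
  sc3_parametrization (cardG_gt0 G) hc f0 f3 dv1 dv2 E1 E2 E3 E4 leT3.
have /dvdnP[k T3k] : 3 %| #|T3| := dvd3_card_T3 Gu ou cu Gt ot.
have [leT3c leT3s] := card_T3_bounds Gu ou cu Gt ot.
rewrite -/T3 in leT3c leT3s.
have [P [dvP P3 oddP]] := card_triangle_odd Gu ou cu Gt ut.
have c0 : 0 < #|'C_G[t]| := cardG_gt0 _.
pose e := logn 2 #|'C_G[t]|.
have eE : (#|'C_G[t]|`_2 = 2 ^ e)%N by rewrite p_part.
have e0 : 1 < 2 ^ e.
  rewrite -eE p_part_gt1 mem_primes c0 cE -!mulnA (dvdn_mulr _ (isT : 2 %| 4)) //.
pose n' := (#|G|`_2^'`_3^')%N.
have g2 : (#|G|`_2 = 2 ^ e)%N by rewrite -(involution_cent_2part Gt ot allT).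
have g3 : (#|G|`_2^'`_3 = 3)%N.
  rewrite partn_part; last by move=> p; rewrite !inE => /eqP->.
  by rewrite -(card_Hall (sc3_Sylow Gu ou cu)) -[LHS]/#[u].
have gn : #|G| = (2 ^ e * (3 * n'))%N by rewrite -g2 -g3 !partnC ?part_gt0.
have oddn : odd n'.
  have : 2^'.-nat n' by apply: pnat_dvd (dvdn_part _ _) (part_pnat _ _).
  by rewrite p'natE // dvdn2 negbK.
have nn3 : n' %% 3 != 0 by have := part_pnat 3^' (#|G|`_2^')%N; rewrite p'natE.
have gtP : gt3.-nat P by apply: pnat_dvd dvP (part_pnat _ _).
have P0 : 0 < P by case/andP: gtP.
have coP : coprime 6 P by rewrite -gt3_natE.
have dvPn : P %| n'.
  have : P %| #|G| by apply: dvdn_trans dvP (dvdn_part _ _).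
  have [coP2 coP3] : coprime 2 P /\ coprime 3 P.
    by apply/andP; rewrite -coprimeMl.
  by rewrite gn Gauss_dvdr ?coprimeXr 1?coprime_sym ?coprimeXl // Gauss_dvdr // coprime_sym.
have le_even := card_even_big Gu ou cu Gt ut allT.
have le_small := card_even_small Gu ou cu Gt ot allT.
set E := [set a in triangle_set G u | ~~ odd #[a]] in le_even le_small.
have [sbT ssT] : big_cent G u t \subset T3 /\ small_cent G u t \subset T3.
  by split; apply/subsetP=> s; rewrite inE => /andP[].
have Dle : #|triangle_set G u| <= 1 + 2 * (P - 1) +
    (#|[set a in E | a ^+ (#[a]./2) \in big_cent G u t]| +
     #|[set a in E | a ^+ (#[a]./2) \in small_cent G u t]|).
  apply: (@leq_trans #|([set 1] :|: [set a in triangle_set G u | odd #[a] && (a != 1)]) :|: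
    ([set a in E | a ^+ (#[a]./2) \in big_cent G u t] :|:
     [set a in E | a ^+ (#[a]./2) \in small_cent G u t])|).
    apply/subset_leq_card/subsetP=> x Dx.
    have [-> | ntx] := eqVneq x 1; first by rewrite !in_setU in_set1 eqxx.
    have [oddx | evenx] := boolP (odd #[x]); apply/setUP; [left | right].
      by apply/setUP; right; apply/setIdP; rewrite oddx.
    have Ex : x \in E by apply/setIdP.
    have [T3x _ _] := even_half Gu ou cu allT Ex.
    apply/setUP; have [sC | nsC] := boolP ('C_G[x ^+ (#[x]./2)] \subset 'C[(x ^+ (#[x]./2)) ^ u]).
      by left; apply/setIdP; split=> //; apply/setIdP.
    by right; apply/setIdP; split=> //; apply/setIdP.
  apply: leq_trans (leq_card_setU _ _) _; apply: leq_add.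
    by apply: leq_trans (leq_card_setU _ _) _; rewrite cards1 leq_add2l.
  exact: leq_card_setU.
pose c := #|'C_G[t]|; rewrite -/c in cE eE c0 leT3c leT3s le_even le_small *.
(* [small_cent] has at most [#|T3| = 3 * k] elements, and at most [3 * (c - 2) - 3 * k] by
   [card_T3_bounds]. *)
pose M := minn k (c - 2 - k).
have oddc : odd (c %/ 2 ^ e).
  have -> : (c %/ 2 ^ e = c`_2^')%N by rewrite -{1}(partnC 2 c0) eE mulKn // expn_gt0.
  by have := part_pnat 2^' c; rewrite p'natE // dvdn2 negbK.
have dvc : 2 ^ e %| c by rewrite -eE dvdn_part.
have lec := dvdn_leq c0 dvc.
have ke : k + 2 <= 2 ^ e by move: leT3c; rewrite T3k eE; clear -e0; lia.
have kc : k + 2 <= c := leq_trans ke lec.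
have leM : #|small_cent G u t| <= 3 * M.
  have := subset_leq_card ssT; move: leT3s; rewrite T3k /M; clear -kc; lia.
have leE2 : #|[set a in E | a ^+ (#[a]./2) \in small_cent G u t]| <= M * (2 * m * r - 1).
  have c2E : (c - 2 = 2 * (2 * m * r - 1))%N by rewrite cE; clear; lia.
  rewrite c2E in le_small; move: (2 * m * r - 1)%N le_small => y le_small.
  have := leq_trans le_small (leq_mul leM (leqnn (2 * y))).
  by move: #|_| (M) => x z; clear; lia.
have leD : m * m * (f * f + f + 1) <= 3 * (1 + 2 * (4 * m * r - 1) + M * (2 * m * r - 1) + 2 * (P - 1)).
  rewrite -DE -cE leq_mul2l /=; apply: leq_trans Dle _.
  move: leE2 le_even; move: (M * _)%N #|[set _ in _ | _]| #|[set _ in _ | _]| => x y z.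
  by clear; lia.
have gE' : (2 ^ e * n' = f * (f + 1) * m * m)%N.
  by move: gn; rewrite gE; clear; lia.
have T3E' : (12 * k * r = m * ((3 * n + r) * f + 3 * n + 5 * r))%N.
  by rewrite -T3E -/T3 T3k; clear; lia.
rewrite def_f in leD gE' T3E' gE; rewrite cE in dvc oddc.
have := sc3_arithmetic n3 r0 m0 T3E' dvc oddc ke gE' oddn nn3 dvPn P3 _ _ leD.
case; rewrite ?geq_minl //.
- by rewrite -cE /M; clear -kc; lia.
- by case=> n1 r1 m1; left; rewrite gE cE n1 r1 m1.
by case=> n1 r1 m1; right; rewrite gE cE n1 r1 m1.
Qed.

End Orders.

(** * The quotient by the 3'-core *)

Section CoreQuotient.

Variables (gT : finGroupType) (G : {group gT}) (u : gT).
Hypotheses (Gu : u \in G) (ou : #[u] = 3) (cu : 'C_G[u] = <[u]>).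

Let N := 'O_3^'(G)%G.
Let nNG : N <| G := pcore_normal _ _.
Let sNG : N \subset G := pcore_sub _ _.
Let coN : coprime 3 #|N| := sc3_coprime_pcore _.
Let nNu : u \in 'N(N).
Proof. exact: (subsetP (normal_norm nNG)). Qed.
Let regN : 'C_N[u] = 1 := sc3_regular Gu ou cu sNG coN Gu ou.

(** [u ^ x] lies in the coset of [u] modulo [N], so it equals [u ^ y] for some [y] in [N], and
    [x * y^-1] centralizes [u]. *)
Lemma sc3_core_cent x : x \in G -> [~ u, x] \in N -> x \in N <*> <[u]>.
Proof.
move=> Gx Nux; have [y Ny] := commgM_conj nNu regN Nux.
rewrite commgEl mulKVg => uxy; have Gy := subsetP sNG y Ny.
rewrite -[x](mulgKV y) groupM //; last by rewrite (subsetP (joing_subl _ _)).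
rewrite (subsetP (joing_subr _ _)) // -cu inE groupM ?groupV //=.
by apply/cent1P/commute_sym/commgP/conjg_fixP; rewrite conjgM uxy conjgK.
Qed.

Lemma sc3_core_involution t : t \in G -> #[t] = 2 -> [~ u, t] \in N -> t \in N.
Proof.
move=> Gt ot /(sc3_core_cent Gt) NUt.
have nNU : N <| N <*> <[u]>.
  by apply: normalS nNG; rewrite ?joing_subl // join_subG sNG cycle_subG.
have hallN : 3^'.-Hall(N <*> <[u]>) N.
  rewrite /pHall joing_subl pcore_pgroup -divgS ?joing_subl //=.
  rewrite norm_joinEr ?cycle_subG // TI_cardMg; last first.
    by apply: coprime_TIg; rewrite coprime_sym -[#|<[u]>|]/#[u] ou.
  by rewrite mulKn ?cardG_gt0 // -[#|<[u]>|]/#[u] ou.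
by rewrite (mem_normal_Hall hallN nNU NUt) /p_elt ot.
Qed.

(* A t without fixed points on 'Z(N) inverts it, so [~ u, t] centralizes 'Z(N) and
   lies in N; then t itself lies in N and centralizes 'Z(N). *)
Lemma sc3_involution_hub t : t \in G -> #[t] = 2 -> N :!=: 1 ->
  exists2 z, z \in 'Z(N)^# & commute t z.
Proof.
move=> Gt ot ntN; have nilN : nilpotent N := sc3_nil Gu ou cu sNG coN nNu.
have ntZ : 'Z(N) != 1 by rewrite (center_nil_eq1 nilN).
have nZG : 'Z(N) <| G := char_normal_trans (center_char N) nNG.
have [/exists_inP[z Zz /eqP ctz] | noz] := boolP [exists z in 'Z(N)^#, t * z == z * t].
  by exists z.
have comm1 z : z \in 'Z(N) -> commute t z -> z = 1.
  move=> Zz ctz; apply/eqP; apply: contraR noz => ntz.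
  by apply/exists_inP; exists z; [apply/setD1P | apply/eqP].
have nZ x : x \in G -> x \in 'N('Z(N)) by apply: (subsetP (normal_norm nZG)).
have tV : t^-1 = t by apply/eqP; rewrite eq_invg_mul -(expgS t 1) -order_dvdn ot.
have inv z : z \in 'Z(N) -> z ^ t = z^-1.
  move=> Zz; have Zzt : z ^ t \in 'Z(N) by rewrite memJ_norm ?nZ.
  apply/esym/eqP; rewrite eq_invg_mul; apply/eqP/comm1; first exact: groupM.
  apply/commute_sym/commgP/conjg_fixP; rewrite conjMg -conjgM -(expgS t 1).
  have -> : t ^+ 2 = 1 by rewrite -ot expg_order.
  by rewrite conjg1; apply: (centsP (center_abelian N)).
(* A group that centralizes a nontrivial element of order prime to 3 has order prime to 3, and this
   one is normal. *)
have sCN : 'C_G('Z(N)) \subset N.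
  have nCG : 'C_G('Z(N)) <| G by rewrite /normal subsetIl normsI ?norms_cent ?normG ?normal_norm.
  rewrite pcore_max //.
  have [z Zz ntz] := trivgPn _ ntZ.
  rewrite /pgroup p'natE // -prime_coprime //.
  apply: (sc3_cent_coprime Gu ou cu (subsetIl _ _) (subsetP sNG z (subsetP (center_sub N) z Zz)) ntz).
    exact: coprime_dvdr (order_dvdG (subsetP (center_sub N) z Zz)) coN.
  by rewrite -(cent_set1 z) subIset // centS ?orbT // sub1set.
have Nt : t \in N.
  apply: sc3_core_involution => //; apply: (subsetP sCN).
  rewrite inE groupR //=; apply/centP=> z Zz; apply/commute_sym/commgP/conjg_fixP.
  have Zzu x : x \in G -> z ^ x \in 'Z(N) by move=> Gx; rewrite memJ_norm ?nZ.
  have Zzu' : z ^ u^-1 \in 'Z(N) by rewrite Zzu ?groupV.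
  rewrite commgEl [u ^ t]conjgE tV !conjgM (inv _ Zzu').
  by rewrite conjVg conjgKV conjVg inv // invgK.
case/eqP: ntZ; apply/trivgP/subsetP=> z Zz; rewrite inE; apply/eqP/comm1 => //.
by case/setIP: Zz => _ /centP/(_ t Nt)/commute_sym.
Qed.

Lemma card_sc3_normaliser : #|'N_G(<[u]>)| %| 6.
Proof.
have sUN : <[u]> \subset 'N_G(<[u]>) by rewrite subsetI cycle_subG Gu normG.
have U3 : #|<[u]>| = 3 := ou.
have [/exists_inP[t Gt /eqP ut] | noinv] := boolP [exists t in G, u ^ t == u^-1].
  have le6 : #|'N_G(<[u]>)| <= 6.
    apply: (@leq_trans #|<[u]> :|: <[u]> :* t^-1|).
      apply/subset_leq_card/subsetP=> n /(sc3_norm_index ou cu Gt ut)[Un | Unt].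
        by rewrite inE Un.
      by rewrite inE mem_rcoset invgK Unt orbT.
    by apply: leq_trans (leq_card_setU _ _) _; rewrite card_rcoset U3.
  have := cardSg sUN; rewrite U3 => /dvdnP[k def_k]; rewrite def_k in le6 *.
  have := cardG_gt0 'N_G(<[u]>)%G; rewrite def_k; clear def_k.
  by case: k le6 => [|[|[|k]]].
rewrite (@eq_card _ _ (mem <[u]>)) ?U3 // => n; apply/idP/idP=> [Nn|]; last exact: (subsetP sUN).
have [[] // | unV] := sc3_norm_cases ou cu Nn.
by case/negP: noinv; apply/exists_inP; exists n; [case/setIP: Nn | apply/eqP].
Qed.

(** Outside the split case, [u] stays self-centralizing of order 3 modulo [N], where the 3'-core is
    trivial, so [sc3_orders] applies to the quotient. *)
Lemma sc3_quotient_card :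
  [\/ #|G / N| %| 6, #|G / N| = 60 | #|G / N| = 168].
Proof.
have [defG | [t [s [Gt ot ut Ts us]]]] := sc3_dichotomy Gu ou cu.
  constructor 1; apply: dvdn_trans card_sc3_normaliser.
  rewrite -{1}defG quotientMidl; apply: dvdn_quotient.
have nN x : x \in G -> x \in 'N(N) by apply: (subsetP (normal_norm nNG)).
have Nx1 x : x \in G -> #[x] = 3 -> coset N x != 1.
  move=> Gx ox; apply: contraTneq (isT : 3 %| 3) => /(coset_idr (nN x Gx)) Nx.
  have := coprime_dvdr (order_dvdG Nx) coN; by rewrite ox.
have o3 x : x \in G -> #[x] = 3 -> #[coset N x] = 3.
  move=> Gx ox; apply: nt_prime_order => //; last exact: Nx1.
  by rewrite -morphX ?nN // -ox expg_order morph1.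
have ouN := o3 u Gu ou.
have GuN : coset N u \in (G / N)%G by apply: mem_quotient.
have cuN : 'C_(G / N)[coset N u] = <[coset N u]>.
  apply/eqP; rewrite eqEsubset subsetI !cycle_subG GuN cent1id !andbT.
  apply/subsetP=> _ /setIP[/morphimP[x Nx Gx ->] /cent1P cxu].
  have : x \in N <*> <[u]>.
    apply: sc3_core_cent => //; apply: coset_idr; first by rewrite groupR ?nN.
    by rewrite morphR ?nN //; apply/eqP/commgP/commute_sym.
  move/(mem_quotient N); rewrite quotientYidl ?cycle_subG ?nN //.
  by rewrite quotient_cycle ?nN.
have utN : coset N u ^ coset N t = (coset N u)^-1.
  by rewrite -morphJ ?nN // ut morphV ?nN.
have GtN : coset N t \in (G / N)%G by apply: mem_quotient.
have otN : #[coset N t] = 2.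
  apply: nt_prime_order => //; first by rewrite -morphX ?nN // -ot expg_order morph1.
  by apply/eqP=> t1; have := sc3_neqV ouN; rewrite -utN t1 conjg1 eqxx.
have TsN : coset N s \in coset N t ^: (G / N).
  case/imsetP: Ts => g Gg ->; rewrite morphJ ?nN //; apply: memJ_class.
  exact: mem_quotient.
have [Gs _ _] := involution_class Gt ot Ts.
have usN : #[coset N u * coset N s] = 3 by rewrite -morphM ?nN // o3 ?groupM.
have O1 : 'O_3^'(G / N) = 1 := trivg_pcore_quotient _ _.
by have [_ [[-> _]|[-> _]]] := sc3_orders GuN ouN cuN GtN otN utN TsN usN O1; [constructor 2 | constructor 3].
Qed.

End CoreQuotient.

(** [W] is normal in a 2-group containing [s], so it meets the centre of that group. *)
Lemma involution_cent_2group (gT : finGroupType) (W : {group gT}) s :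
  2.-group W -> W :!=: 1 -> #[s] = 2 -> s \in 'N(W) -> exists2 a, a \in W^# & commute s a.
Proof.
move=> pW ntW os nWs; pose H := (W <*> <[s]>)%G.
have nWH : W <| H by rewrite /normal joing_subl join_subG normG cycle_subG.
have pH : 2.-group H by rewrite /H /= norm_joinEr ?cycle_subG // pgroupM pW /pgroup -[#|<[s]>|]/#[s] os.
have := meet_center_nil (pgroup_nil pH) nWH ntW.
case/trivgPn=> a /setIP[Wa /centerP[_ cHa]] nta; exists a; first exact/setD1P.
by apply/commute_sym/cHa; rewrite (subsetP (joing_subr _ _)) ?cycle_id.
Qed.

(** * Involutions in a group of order 168 *)

Section Order168.

Variables (gT : finGroupType) (G : {group gT}) (u : gT).
Hypotheses (Gu : u \in G) (ou : #[u] = 3) (cu : 'C_G[u] = <[u]>).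
Hypotheses (G168 : #|G| = 168) (O1 : 'O_3^'(G) = 1).

(** Some [x] in a Sylow 2-subgroup above [W] induces a transposition on the involutions of [W],
    where [u] induces a 3-cycle; so [x] inverts [u] modulo ['C_G(W)]. Since [u] is regular on
    ['C_G(W)], [x] can be corrected there to invert [u] itself, and then it generates ['N_G(<[u]>)]
    modulo [<[u]>]. *)
Lemma sc3_four_group_norm (W : {group gT}) :
  W \subset G -> #|W| = 4 -> u \in 'N(W) -> 'N_G(<[u]>) \subset 'N(W).
Proof.
move=> sWG W4 nWu; have pW : 2.-group W by rewrite /pgroup W4.
have [P sylP sWP] := Sylow_superset sWG pW; have [sPG pP _] := and3P sylP.
have P8 : #|P| = 8 by rewrite (card_Hall sylP) G168 p_part.
have nWP : W <| P by apply: index2_normal => //; rewrite -divgS // P8 W4.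
have ntW : W :!=: 1 by rewrite -cardG_gt1 W4.
have : 'Z(P) :&: W != 1 by rewrite setIC; apply: meet_center_nil (pgroup_nil pP) nWP ntW.
have sI2 : 2.-group ('Z(P) :&: W) by apply: pgroupS pW; apply: subsetIr.
case/(pgroup_pdiv sI2) => _ dv2 _; have [s /setIP[/centerP[Ps cPs] Ws] os] := Cauchy (isT : prime 2) dv2.
have nts : s != 1 by rewrite -order_eq1 os.
have s2 : s ^+ 2 = 1 by rewrite -os expg_order.
have Gs := subsetP sWG s Ws.
have coW : coprime 3 #|W| by rewrite W4.
have regW := sc3_regular Gu ou cu sWG coW Gu ou.
have Wsu : s ^ u \in W by rewrite memJ_norm.
have nesu : s ^ u != s.
  apply: contra nts => /eqP/conjg_fixP/commgP cus.
  by rewrite -in_set1 -[[set 1]]/(1%G : {set gT}) /= -regW inE Ws; apply/cent1P.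
have ntsu : s ^ u != 1 by rewrite -(conj1g u) (inj_eq (conjg_inj u)).
have defW : W :=: [set 1; s; s ^ u; s * s ^ u].
  apply/eqP; rewrite eq_sym eqEcard W4 card_four_set // andbT.
  exact: four_set_sub.
have [y0 Wy0 def_us] := commgM_conj nWu regW Ws.
have [cs suu] : commute s (s ^ u) /\ s ^ (u ^+ 2) = s * s ^ u.
  by apply: triangle_involution => //; rewrite def_us -conjXg -ou expg_order conj1g.
pose C := 'C_G(W)%G; have sCG : C \subset G := subsetIl _ _.
have coC : coprime 3 #|C|.
  apply: (sc3_cent_coprime Gu ou cu sCG Gs nts); first by rewrite os.
  by rewrite -(cent_set1 s) subIset // centS ?orbT // sub1set.
have nCu : u \in 'N(C).
  by rewrite -cycle_subG normsI ?norms_cent ?cycle_subG ?(subsetP (normG G)).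
have [x Px ncx] : exists2 x, x \in P & x \notin 'C(W).
  apply/subsetPn; apply: contraL (isT : true) => sPC; apply/negP=> _.
  (* A subgroup of order prime to 3 containing [P] has order 8 or 56, both 2 modulo 3, while
     regularity of [u] requires 1. *)
  have dv8 : 8 %| #|C| by rewrite -P8 cardSg // subsetI sPG.
  have dv168 : #|C| %| 168 by rewrite -G168 cardSg.
  have := sc3_card_mod3 Gu ou cu sCG coC nCu.
  have [j def_C] := dvdnP dv8; rewrite def_C.
  have : j %| 7.
    rewrite -(@Gauss_dvdr _ 3); last by apply: coprime_dvdl (_ : j %| #|C|) _; rewrite 1?coprime_sym // def_C dvdn_mulr.
    by rewrite -(@dvdn_pmul2r 8) // -def_C.
  by case/(primeP (isT : prime 7)).2/pred2P=> ->.
have nWx : x \in 'N(W) by rewrite (subsetP (normal_norm nWP)).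
have sx : s ^ x = s by apply/conjg_fixP/commgP/cPs.
have sux : (s ^ u) ^ x = s * s ^ u.
  have : (s ^ u) ^ x \in W by rewrite memJ_norm.
  rewrite {1}defW !inE -!orbA => /or4P[] /eqP // sux.
  - by case/eqP: ntsu; apply: (conjg_inj x); rewrite conj1g.
  - by case/eqP: nesu; apply: (conjg_inj x); rewrite sx.
  case/negP: ncx; rewrite -sub_cent1 defW; apply/subsetP=> r.
  have cx r' : r' ^ x = r' -> r' \in 'C[x] by move=> rx; apply/cent1P/commgP/conjg_fixP.
  have [cx1 cx2] := (cx s sx, cx _ sux).
  by rewrite in_set4 => /or4P[]/eqP-> //; apply: groupM.
have u3 : u ^+ 3 = 1 by rewrite -ou expg_order.
have suuu : ((s ^ u) ^ u) ^ u = s by rewrite -!conjgM -[RHS]conjg1 -u3 !expgS expg0 mulg1 ?mulgA.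
have suu' : (s ^ u) ^ u = s * s ^ u by rewrite -conjgM.
have suxV : (s ^ u) ^ x^-1 = s * s ^ u.
  apply: (canLR (conjgK x)); rewrite (conjMg s) sx sux mulgA -(expgS s 1) s2 mul1g //.
have sxV : s ^ x^-1 = s by rewrite -{1}sx conjgK.
have Cux : u ^ x * u \in C.
  apply/setIP; split; first by rewrite groupM // groupJ // (subsetP sPG).
  rewrite -sub_cent1 defW; apply/subsetP=> r.
  have cx r' : r' ^ (u ^ x * u) = r' -> r' \in 'C[u ^ x * u] by move=> rx; apply/cent1P/commgP/conjg_fixP.
  have cs1 : s \in 'C[u ^ x * u].
    by apply: cx; rewrite conjgM [u ^ x]conjgE 2!conjgM sxV sux -suu' suuu.
  have cs2 : s ^ u \in 'C[u ^ x * u].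
    by apply: cx; rewrite conjgM [u ^ x]conjgE 2!conjgM suxV -suu' suuu sx.
  by rewrite in_set4 => /or4P[]/eqP-> //; apply: groupM.
have nCuV : u^-1 \in 'N(C) by rewrite groupV.
have regCV : 'C_C[u^-1] = 1 by apply: (sc3_regular Gu ou cu sCG coC); rewrite ?groupV ?orderV.
have Cuux : u * u ^ x \in C.
  have -> : u * u ^ x = (u ^ x * u) ^ u^-1 by rewrite [RHS]conjgE invgK mulgK.
  by rewrite memJ_norm.
have [y Cy] := commgM_conj nCuV regCV Cuux; rewrite mulKg => uxy.
pose g := x * y^-1.
have nWC : C \subset 'N(W) by apply: subset_trans (subsetIr _ _) (cent_sub _).
have nWg : g \in 'N(W) by rewrite groupM ?groupV // (subsetP nWC).
have Gg : g \in G by apply: groupM; rewrite ?groupV; [apply: (subsetP sPG) | apply: (subsetP sCG)].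
have ug : u ^ g = u^-1 by rewrite conjgM uxy conjgK.
have sUW : <[u]> \subset 'N(W) by rewrite cycle_subG.
apply/subsetP=> n /(sc3_norm_index ou cu Gg ug)[/(subsetP sUW) // | /(subsetP sUW)].
by rewrite groupMr.
Qed.

End Order168.

Section Involutions168.

Variables (gT : finGroupType) (G : {group gT}) (u : gT).
Hypotheses (Gu : u \in G) (ou : #[u] = 3) (cu : 'C_G[u] = <[u]>).
Hypotheses (G168 : #|G| = 168) (O1 : 'O_3^'(G) = 1).

(** The order of the product [w] decides. If it is even, both involutions commute with the
    involution in [<[w]>]. If it is 3, both normalize a conjugate of [W] and fix nontrivial elements
    of this abelian group. Order 7 is excluded. *)
Lemma sc3_168_involutions (W : {group gT}) s1 s2 :
    W \subset G -> #|W| = 4 -> u \in 'N(W) ->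
    s1 \in G -> #[s1] = 2 -> s2 \in G -> #[s2] = 2 ->
  exists a b, [/\ a \in G^#, b \in G^#, commute s1 a, commute a b & commute b s2].
Proof.
move=> sWG W4 nWu G1 o1 G2 o2; pose w := s1 * s2.
have [sV1 sV2] : s1^-1 = s1 /\ s2^-1 = s2.
  by split; apply/eqP; rewrite eq_invg_mul -[_ * _](expgS _ 1) -?{2}o1 -?{2}o2 -order_dvdn ?o1 ?o2.
have w1 : w ^ s1 = w^-1 by rewrite conjgE /w -(mulgA s1 s2) mulKg invMg sV1 sV2.
have w2 : w ^ s2 = w^-1.
  by rewrite conjgE (_ : w * s2 = s1) ?invMg ?sV1 // /w -mulgA -{1}sV2 mulVg mulg1.
have Gw : w \in G by rewrite groupM.
have nt1 : s1 != 1 by rewrite -order_eq1 o1.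
have [w_1 | ntw] := eqVneq w 1.
  have def_s2 : s2 = s1 by apply: (mulgI s1); rewrite -/w w_1 -{1}sV1 mulVg.
  by exists s1, s1; rewrite def_s2; split=> //; apply/setD1P.
have [oddw | evenw] := boolP (odd #[w]); last first.
  pose a := w ^+ #[w]./2.
  have e2 : (#[w] = #[w]./2 * 2)%N.
    by rewrite muln2 -[LHS](odd_double_half #[w]) (negPf evenw).
  have a2 : a ^+ 2 = 1 by rewrite -expgM -e2 expg_order.
  have nta : a != 1.
    rewrite -order_dvdn gtnNdvd //; last by rewrite {2}e2 ltn_Pmulr //; case: #[w]./2 e2 (order_gt0 w) => // ->.
    by case: #[w]./2 e2 (order_gt0 w) => // ->.
  have aV := involutionV a2.
  have Ga : a \in G^# by apply/setD1P; split; rewrite ?groupX.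
  have ca s : w ^ s = w^-1 -> commute s a.
    by move=> ws; apply/commute_sym/commgP/conjg_fixP; rewrite conjXg ws expgVn.
  by exists a, a; split=> //; [apply: ca | apply/commute_sym/ca].
have dvw : #[w] %| 168 by rewrite -G168 order_dvdG.
have [dv3 | ndv3] := boolP (3 %| #[w]).
  have ow : #[w] = 3.
    have [y wy oy] := Cauchy (isT : prime 3) dv3.
    have Gy : y \in G by apply: mem_cycle_sub wy.
    have : w \in 'C_G[y].
      by rewrite inE Gw cent1C; apply: (subsetP (_ : <[w]> \subset 'C[w])) wy; rewrite cycle_subG cent1id.
    rewrite (sc3_cent Gu ou cu Gy oy) => /order_dvdG; rewrite -[#|<[y]>|]/#[y] oy.
    by case/(primeP (isT : prime 3)).2/pred2P=> // /eqP; rewrite order_eq1 (negPf ntw).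
  have [g Gg def_w] := sc3_class Gu ou cu Gw ow.
  have cw := sc3_cent Gu ou cu Gw ow.
  have nWw : w \in 'N(W :^ g).
    by rewrite normJ; case: def_w => ->; rewrite memJ_conjg ?groupV.
  have sWgG : W :^ g \subset G by rewrite -(conjGid Gg) conjSg.
  have Wg4 : #|(W :^ g)%G| = 4 by rewrite cardJg.
  have sNW := sc3_four_group_norm Gw ow cw G168 sWgG Wg4 nWw.
  have nwW s : s \in G -> w ^ s = w^-1 -> s \in 'N(W :^ g).
    move=> Gs ws; apply: (subsetP sNW); rewrite inE Gs.
    by apply/normP; rewrite -cycleJ ws cycleV.
  have pW : 2.-group (W :^ g)%G by rewrite /pgroup Wg4.
  have ntW : (W :^ g)%G :!=: 1 by rewrite -cardG_gt1 Wg4.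
  have [a /setD1P[nta Wa] ca] := involution_cent_2group pW ntW o1 (nwW s1 G1 w1).
  have [b /setD1P[ntb Wb] cb] := involution_cent_2group pW ntW o2 (nwW s2 G2 w2).
  exists a, b; split=> //; [apply/setD1P | apply/setD1P | ].
  - by split=> //; apply: (subsetP sWgG).
  - by split=> //; apply: (subsetP sWgG).
  by apply: (centsP (card_p2group_abelian (isT : prime 2) Wg4)).
have ow : #[w] = 7.
  have co24 : coprime #[w] 24.
    rewrite (_ : 24 = (2 ^ 3 * 3)%N) // coprimeMr coprimeXr ?coprimen2 //=.
    by rewrite coprime_sym prime_coprime.
  have : #[w] %| 7 by rewrite -(Gauss_dvdr _ co24).
  by case/(primeP (isT : prime 7)).2/pred2P=> // /eqP; rewrite order_eq1 (negPf ntw).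
have sylw : 7.-Sylow(G) <[w]>.
  by rewrite pHallE cycle_subG Gw -[#|<[w]>|]/#[w] ow G168 p_part.
have := card_Syl_mod G (isT : prime 7); rewrite (card_Syl sylw).
have := Lagrange (subsetIl G 'N(<[w]>)); rewrite G168.
have N7 : 7 %| #|'N_G(<[w]>)| by rewrite -ow cardSg // subsetI cycle_subG Gw normG.
have N2 : 2 %| #|'N_G(<[w]>)|.
  rewrite -o1 order_dvdG // inE G1; apply/normP; by rewrite -cycleJ w1 cycleV.
(* The number of Sylow 7-subgroups divides 12 and is 1 modulo 7, so [<[w]>] would be normal, against
   the trivial 3'-core. *)
have : 14 %| #|'N_G(<[w]>)| by rewrite (_ : 14 = (2 * 7)%N) // Gauss_dvd ?N2.
case/dvdnP=> j ->; case def_i: #|G : 'N_G(<[w]>)| => [|[|i]]; rewrite ?muln0 //; last first.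
  move=> ji imod.
  have : i.+2 %| 12 by apply/dvdnP; exists j; lia.
  by case: i imod {def_i ji} => [|[|[|[|[|[|[|[|[|[|[|i]]]]]]]]]]] // _ /dvdn_leq.
move=> _ _; case/eqP: ntw; apply/eqP; rewrite -cycle_eq1 -subG1 -O1 pcore_max //.
  by rewrite /pgroup -[#|_|]/#[w] ow.
rewrite /normal cycle_subG Gw; move/eqP: def_i; rewrite indexg_eq1 subsetI => /andP[_ //].
Qed.

End Involutions168.

(** * The commuting graph when the centre is trivial *)

Section CaseA.

Variables (gT : finGroupType) (G : {group gT}) (u : gT).
Hypotheses (Gu : u \in G) (ou : #[u] = 3) (cu : 'C_G[u] = <[u]>) (Z1 : 'Z(G) = 1).

Let N := 'O_3^'(G)%G.

(** If 3 divides the order, the centralizer is [<[x]>] of order 3. Otherwise it embeds in [G / N],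
    and a divisor of 6, 60 or 168 that is prime to 6 and exceeds 1 is 5 or 7. *)
Lemma sc3_odd_cent x : x \in G -> x != 1 -> odd #|'C_G[x]| -> 'C_N[x] = 1 -> prime #|'C_G[x]|.
Proof.
move=> Gx ntx oddC tiN; have Cx : x \in 'C_G[x] by rewrite inE Gx cent1id.
have [dv3 | ndv3] := boolP (3 %| #|'C_G[x]|).
  have [y Cy oy] := Cauchy (isT : prime 3) dv3.
  have [Gy cxy] : y \in G /\ y \in 'C[x] by apply/setIP.
  have : x \in <[y]> by rewrite -(sc3_cent Gu ou cu Gy oy) inE Gx cent1C.
  move/order_dvdG; rewrite -[#|<[y]>|]/#[y] oy.
  case/(primeP (isT : prime 3)).2/pred2P=> [/eqP|ox]; first by rewrite order_eq1 (negPf ntx).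
  by rewrite (sc3_cent Gu ou cu Gx ox) -[#|_|]/#[x] ox.
have dvC : #|'C_G[x]| %| #|G / N|.
  have nNC : 'C_G[x] \subset 'N(N) := subset_trans (subsetIl _ _) (normal_norm (pcore_normal _ _)).
  have tiCN : N :&: 'C_G[x] = 1.
    by apply/trivgP; rewrite -tiN setIS // subsetIr.
  by rewrite (card_isog (quotient_isog nNC tiCN)) cardSg // quotientS // subsetIl.
have co3 : coprime #|'C_G[x]| 3 by rewrite coprime_sym prime_coprime.
have co2 k : coprime #|'C_G[x]| (2 ^ k * 3) by rewrite coprimeMr coprimeXr ?coprimen2.
have ntC : #|'C_G[x]| != 1%N by rewrite neq_ltn cardG_gt1 orbC; apply/orP; left; apply/trivgPn; exists x.
have [dv6 | c60 | c168] := sc3_quotient_card Gu ou cu.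
- have := dvdn_trans dvC dv6; rewrite -[6]/(2 ^ 1 * 3 * 1)%N (Gauss_dvdr _ (co2 1%N)) dvdn1.
  by rewrite (negPf ntC).
- move: dvC; rewrite c60 -[60]/(2 ^ 2 * 3 * 5)%N (Gauss_dvdr _ (co2 2%N)).
  by case/(primeP (isT : prime 5)).2/pred2P=> [/eqP|->//]; rewrite (negPf ntC).
move: dvC; rewrite c168 -[168]/(2 ^ 3 * 3 * 7)%N (Gauss_dvdr _ (co2 3%N)).
by case/(primeP (isT : prime 7)).2/pred2P=> [/eqP|->//]; rewrite (negPf ntC).
Qed.

Lemma even_cent_involution x : x \in G -> ~~ odd #|'C_G[x]| ->
  exists s, [/\ s \in G, #[s] = 2 & commute x s].
Proof.
rewrite -dvdn2 => Gx /(Cauchy (isT : prime 2))[s /setIP[Gs cs] os].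
by exists s; split=> //; apply/commute_sym/cent1P.
Qed.

Lemma sc3_commuting_hub : N :!=: 1 -> {in G :\: 'Z(G) &, forall x y,
  [\/ centrally_closed G x, centrally_closed G y |
      exists2 s, path (commuting_step G) x s & last x s = y /\ size s <= 5]}.
Proof.
move=> ntN; have sZG : 'Z(N) \subset G := subset_trans (center_sub N) (pcore_sub _ _).
have near x : x \in G^# -> centrally_closed G x \/
    exists a z, [/\ a \in G^#, z \in 'Z(N)^#, commute x a & commute a z].
  move=> /setD1P[ntx Gx]; have [oddC | evenC] := boolP (odd #|'C_G[x]|); last first.
    have [s [Gs os cxs]] := even_cent_involution Gx evenC.
    have [z Zz csz] := sc3_involution_hub Gu ou cu Gs os ntN.
    by right; exists s, z; split=> //; apply/setD1P; rewrite -order_eq1 os.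
  have [tiN | ] := eqVneq 'C_N[x] 1.
    by left; apply: prime_cent_closed => //; apply: sc3_odd_cent.
  case/trivgPn=> n /setIP[Nn cxn] ntn; right.
  have nilN : nilpotent N.
    by apply: (sc3_nil Gu ou cu (pcore_sub _ _) (sc3_coprime_pcore _)); rewrite (subsetP (normal_norm (pcore_normal _ _))).
  have : 'Z(N) != 1 by rewrite center_nil_eq1.
  case/trivgPn=> z Zz ntz; exists n, z; split=> //.
  - by apply/setD1P; split=> //; apply: (subsetP (pcore_sub _ _) n Nn).
  - exact/setD1P.
  - exact/commute_sym/cent1P.
  by case/centerP: Zz => _ /(_ n Nn)/commute_sym.
rewrite Z1 => x y Gx Gy; have [|[a [z [Ga Zz cxa caz]]]] := near x Gx; first by constructor 1.
have [|[b [w [Gb Zw cyb cbw]]]] := near y Gy; first by constructor 2.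
(* Since [z] and [w] commute in ['Z(N)], two steps at either end and one in the middle make 5. *)
constructor 3; exists [:: a; z; w; b; y] => //=.
have sZ1 : 'Z(N)^# \subset G^# by rewrite setSD.
rewrite Z1 Ga Gb Gy !(subsetP sZ1) //= andbT.
apply/and5P; split; apply/cent1P => //; try exact: commute_sym.
by apply: (centsP (center_abelian N)); [case/setD1P: Zw | case/setD1P: Zz].
Qed.

Lemma sc3_commuting : {in G :\: 'Z(G) &, forall x y,
  [\/ centrally_closed G x, centrally_closed G y |
      exists2 s, path (commuting_step G) x s & last x s = y /\ size s <= 5]}.
Proof.
have [N1 | ntN] := eqVneq N 1%G; last by apply: sc3_commuting_hub.
have O1 : 'O_3^'(G) = 1 by rewrite -[LHS]/(gval N) N1.
have tiN x : 'C_N[x] = 1 by apply/trivgP; rewrite N1 subsetIl.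
have allCl (cl : forall x, x \in G -> x != 1 -> ~~ odd #|'C_G[x]| -> centrally_closed G x) :
    forall x, x \in G :\: 'Z(G) -> centrally_closed G x.
  rewrite Z1 => x /setD1P[ntx Gx]; have [oddC | evenC] := boolP (odd #|'C_G[x]|); last exact: cl.
  by apply: prime_cent_closed => //; apply: sc3_odd_cent.
have [defG | [t [s [Gt ot ut Ts us]]]] := sc3_dichotomy Gu ou cu.
  have dv6 : #|G| %| 6.
    by move: defG; rewrite O1 mul1g => {1}<-; apply: card_sc3_normaliser.
  move=> x y Gx _; constructor 1; apply: allCl => // {y Gx}{}x Gx ntx evenC.
  apply: prime_cent_closed => //.
  have dvC : #|'C_G[x]| %| #|G| by rewrite cardSg ?subsetIl.
  have := dvdn_trans dvC dv6; rewrite -dvdn2 in evenC; have [k def_k] := dvdnP evenC.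
  rewrite def_k -[6]/(3 * 2)%N dvdn_pmul2r // => /((primeP (isT : prime 3)).2)/pred2P[->//|k3].
  (* A centralizer of order 6 is the whole group, so [x] would be central. *)
  case/eqP: ntx; suff : x \in 'Z(G) by rewrite Z1 => /set1P.
  apply/centerP; split=> // y Gy.
  have: y \in 'C_G[x].
    suff -> : 'C_G[x] = G by [].
    apply/eqP; rewrite eqEcard subsetIl def_k k3 dvdn_leq //.
  by case/setIP=> _ /cent1P/commute_sym.
have [allT] := sc3_orders Gu ou cu Gt ot ut Ts us O1.
have cT r : r \in G -> #[r] = 2 -> #|'C_G[r]| = #|'C_G[t]|.
  move=> Gr /(allT r Gr)/imsetP[g Gg ->].
  by rewrite cent1J -{1}(conjGid Gg) -conjIg cardJg.
case=> [[G60 c4] | [G168 c8]].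
  move=> x y nZx _; constructor 1; apply: abelian_cent_closed (nZx) => {nZx y}{}x.
  rewrite Z1 => /setD1P[ntx Gx].
  have [oddC | evenC] := boolP (odd #|'C_G[x]|).
    by apply/cyclic_abelian/prime_cyclic; apply: sc3_odd_cent.
  have [r [Gr or cxr]] := even_cent_involution Gx evenC.
  have Cx : x \in 'C_G[r] by rewrite inE Gx; apply/cent1P.
  (* As [x] lies in the centralizer of an involution, of order 4, [<[x]>] contains an involution
     [q], and ['C_G[x]] lies in the abelian group ['C_G[q]]. *)
  have p2 : 2.-group <[x]>.
    by rewrite /pgroup (pnat_dvd (order_dvdG Cx)) // cT // c4.
  have ntX : <[x]> != 1 by rewrite cycle_eq1.
  have [_ dv2 _] := pgroup_pdiv p2 ntX.
  have [q xq oq] := Cauchy (isT : prime 2) dv2.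
  have Gq : q \in G by apply: mem_cycle_sub xq.
  apply: (@abelianS _ _ 'C_G[q]); last by apply: (card_p2group_abelian (isT : prime 2)); rewrite cT.
  apply: setIS; have /cycleP[i ->] := xq.
  by apply/subsetP=> z /cent1P cxz; apply/cent1P/commuteX.
have [W [sWG W4 nWu]] : exists W : {group gT}, [/\ W \subset G, #|W| = 4 & u \in 'N(W)].
  have [|W sWG [W4 nWu _]] := @four_group_T3 _ G u t Gu ou cu Gt ot s; last by exists W.
  by rewrite inE Ts us.
have near x : x \in G^# -> centrally_closed G x \/ exists s, [/\ s \in G, #[s] = 2 & commute x s].
  move=> /setD1P[ntx Gx]; have [oddC | evenC] := boolP (odd #|'C_G[x]|); last first.
    by right; apply: even_cent_involution.
  by left; apply: prime_cent_closed => //; apply: sc3_odd_cent.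
rewrite Z1 => x y Gx Gy; have [|[r [Gr or cxr]]] := near x Gx; first by constructor 1.
have [|[q [Gq oq cyq]]] := near y Gy; first by constructor 2.
have [a [b [Ga Gb cra cab cbq]]] := sc3_168_involutions Gu ou cu G168 O1 sWG W4 nWu Gr or Gq oq.
constructor 3; exists [:: r; a; b; q; y] => //=.
have G1 z : z \in G -> #[z] = 2 -> z \in G^# by move=> Gz oz; rewrite in_setD1 -order_eq1 oz.
rewrite Z1 Ga Gb Gy !G1 //= andbT.
by apply/and5P; split; apply/cent1P => //; apply: commute_sym.
Qed.

End CaseA.

(** By regularity [t * x] is conjugate to [t], so it squares to 1. *)
Lemma involution_inverts (gT : finGroupType) (K : {group gT}) t x :
  t \in 'N(K) -> t ^+ 2 = 1 -> 'C_K[t] = 1 -> x \in K -> x ^ t = x^-1.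
Proof.
move=> nKt t2 regK Kx; have [y _ def_tx] := commgM_conj nKt regK Kx.
by apply: order2_mul; rewrite // def_tx -conjXg t2 conj1g.
Qed.

Lemma inverted_abelian (gT : finGroupType) (K : {group gT}) t :
  {in K, forall x, x ^ t = x^-1} -> abelian K.
Proof.
move=> inv; apply/centsP=> x Kx y Ky; apply: invg_inj.
by rewrite -inv ?groupM // conjMg !inv // invMg.
Qed.

Lemma odd_regular (gT : finGroupType) (H K : {group gT}) t :
  K \subset H -> odd #|K| -> 2.-group 'C_H[t] -> 'C_K[t] = 1.
Proof.
move=> sKH oddK pC; apply/trivgP; rewrite -(@coprime_TIg _ K 'C_H[t]).
  by rewrite subsetI subsetIl setSI.
by rewrite coprime_sym (pnat_coprime pC) // -odd_2'nat.
Qed.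

Lemma index_cent1_le2 (gT : finGroupType) (H M : {group gT}) y :
  M \subset 'C_H[y] -> #|H| <= 2 * #|M| -> #|H : 'C_H[y]| <= 2.
Proof.
move=> sMC leHM; rewrite -(leq_pmul2l (cardG_gt0 'C_H[y])) Lagrange ?subsetIl //.
by rewrite (leq_trans leHM) // mulnC leq_mul2r subset_leq_card ?orbT.
Qed.

(** * Involutions in groups with a normal 2-complement *)

Section InvolutionCentralizer.

Variables (gT : finGroupType) (H : {group gT}) (i : gT).
Hypotheses (Hi : i \in H) (oi : #[i] = 2).

Let i2 : i ^+ 2 = 1. Proof. by rewrite -oi expg_order. Qed.

(** [<[i]>] is a Sylow subgroup with a normal complement; the complement is inverted by [i], hence
    abelian, and has index 2. *)
Lemma self_centralizing_involution : 'C_H[i] = <[i]> -> 2 < #|H| ->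
  exists y, [/\ y \in H^#, odd #[y] & #|H : 'C_H[y]| <= 2].
Proof.
move=> cH gtH; have pI : 2.-group <[i]> by rewrite /pgroup -[#|_|]/#[i] oi.
have sIH : <[i]> \subset H by rewrite cycle_subG.
have [P sylP siP] := Sylow_superset sIH pI; have [sPH pP _] := and3P sylP.
have Pi : i \in P by rewrite -cycle_subG.
have ntP : P :!=: 1 by apply/trivgPn; exists i; rewrite -?order_eq1 ?oi.
have : 'Z(P) != 1 by rewrite (center_nil_eq1 (pgroup_nil pP)).
case/trivgPn=> z /centerP[Pz cPz] ntz.
have : z \in 'C_H[i] by rewrite inE (subsetP sPH) //; apply/cent1P/cPz.
rewrite cH cycle2g // !inE (negPf ntz) => /eqP def_z; subst z.
have defP : P :=: <[i]>.
  apply/eqP; rewrite eqEsubset siP -cH subsetI sPH sub_cent1 andbT.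
  by apply/centP=> x Px; apply/cPz.
have sylI : 2.-Sylow(H) <[i]> by rewrite -defP.
have sNC : 'N_H(<[i]>) \subset 'C(<[i]>).
  apply/subsetP=> n /setIP[_ nIn]; rewrite cent_cycle.
  apply/cent1P/commute_sym/commgP/conjg_fixP.
  have : i ^ n \in <[i]> by rewrite memJ_norm // cycle_id.
  by rewrite cycle2g // !inE -{1}(conj1g n) (inj_eq (conjg_inj n)) -order_eq1 oi => /eqP.
have [K [nKH p'K defH]] := Burnside_normal_complement sylI (cycle_abelian i) sNC.
have sKH := normal_sub nKH.
have oddK : odd #|K| by rewrite /pgroup -odd_2'nat in p'K.
have inv : {in K, forall x, x ^ i = x^-1}.
  move=> x Kx; apply: (@involution_inverts _ K) => //.
    by rewrite (subsetP (normal_norm nKH)).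
  by apply: (odd_regular sKH oddK); rewrite cH.
have abK := inverted_abelian inv.
have cardH : #|H| = (2 * #|K|)%N.
  rewrite -defH TI_cardMg ?[#|<[i]>|]oi 1?mulnC //.
  by apply: coprime_TIg; rewrite -[#|<[i]>|]/#[i] oi coprimen2.
have : K :!=: 1.
  by rewrite -cardG_gt1 -(@ltn_pmul2l 2) // muln1 -cardH.
case/trivgPn=> y Ky nty; exists y; split.
- by apply/setD1P; split=> //; apply: (subsetP sKH).
- exact: dvdn_odd (order_dvdG Ky) oddK.
apply: (@index_cent1_le2 _ _ K); last by rewrite cardH.
by rewrite subsetI sKH sub_cent1 (subsetP abK).
Qed.

(** The normal complement [K] of [V] is inverted by [i], hence abelian. If another involution [j] of
    [V] is regular on [K], it inverts [K] as well and [i * j] centralizes it. So when [K] is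
    nontrivial, some [y != 1] in [K] commutes with an involution of [V] and with [K], which generate
    a subgroup of index 2. *)
Lemma centralizing_Sylow_involution (V : {group gT}) :
    'C_H[i] = V -> #|V| = 4 -> {in V, forall x, x ^+ 2 = 1} -> 2.-Sylow(H) V ->
    'N_H(V) \subset 'C(V) ->
  (exists2 j, j \in H^# & j \in 'Z(H)) \/
  exists y, [/\ y \in H^#, odd #[y] & #|H : 'C_H[y]| <= 2].
Proof.
move=> cV V4 expV sylV sNC; have abV : abelian V := card_p2group_abelian (isT : prime 2) V4.
have nti : i != 1 by rewrite -order_eq1 oi.
have Vi : i \in V by rewrite -cV inE Hi cent1id.
have [K [nKH p'K defH]] := Burnside_normal_complement sylV abV sNC.
have sKH := normal_sub nKH; have oddK : odd #|K| by rewrite /pgroup -odd_2'nat in p'K.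
have nK w : w \in V -> w \in 'N(K).
  by move=> Vw; rewrite (subsetP (normal_norm nKH)) // (subsetP (pHall_sub sylV)).
have inv : {in K, forall x, x ^ i = x^-1}.
  move=> x Kx; apply: (@involution_inverts _ K) => //; first exact: nK.
  by apply: (odd_regular sKH oddK); rewrite cV /pgroup V4.
have abK := inverted_abelian inv.
have cardH : #|H| = (#|K| * 4)%N.
  by rewrite -defH TI_cardMg ?V4 // coprime_TIg // V4 -[4]/(2 ^ 2)%N coprimeXr ?coprimen2.
have [K1 | ] := eqVneq (K : {set gT}) 1.
  left; exists i; first exact/setD1P.
  have HV : H :=: V by rewrite -defH K1 mul1g.
  by rewrite HV; apply/centerP; split=> // x Vx; apply: (centsP abV).
case/trivgPn=> y0 Ky0 nty0; right.
have [j Vj nij] : exists2 j, j \in V & j \notin <[i]>.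
  apply/subsetPn; apply: contraL (isT : true) => /subset_leq_card.
  by rewrite V4 -[#|<[i]>|]/#[i] oi.
have nt1 w : w \notin <[i]> -> w != 1 by apply: contraNneq => ->.
have [y [w [Ky nty Vw ntw cyw]]] : exists y w, [/\ y \in K, y != 1, w \in V, w != 1 & commute y w].
  have [reg | ] := eqVneq 'C_K[j] 1; last first.
    case/trivgPn=> y /setIP[Ky cyj] nty; exists y, j; split=> //; first exact: nt1.
    exact/cent1P.
  have invj := involution_inverts (nK j Vj) (expV j Vj) reg.
  exists y0, (i * j); split; rewrite ?groupM //.
    apply: nt1; apply: contra nij => iij; have := groupM (cycle_id i) iij.
    by rewrite mulgA -(expgS i 1) i2 mul1g.
  by apply/commgP/conjg_fixP; rewrite conjgM inv // invj ?groupV // invgK.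
have ow : #[w] = 2 by apply: nt_prime_order => //; apply: expV.
exists y; split.
- by apply/setD1P; split=> //; apply: (subsetP sKH).
- exact: dvdn_odd (order_dvdG Ky) oddK.
apply: (@index_cent1_le2 _ _ (K <*> <[w]>)%G); last first.
  rewrite /= norm_joinEr ?cycle_subG ?nK // TI_cardMg.
    by rewrite -[#|<[w]>|]/#[w] ow cardH mulnCA.
  by apply: coprime_TIg; rewrite -[#|<[w]>|]/#[w] ow coprimen2.
rewrite subsetI !join_subG sKH !cycle_subG !sub_cent1 (subsetP abK) //=.
rewrite (subsetP (pHall_sub sylV)) //=; exact/cent1P.
Qed.

End InvolutionCentralizer.

(** * Involutions with centralizer of order 4 *)

Section FusedInvolutions.

Variables (gT : finGroupType) (H V : {group gT}) (i : gT).
Hypotheses (Hi : i \in H) (oi : #[i] = 2) (cV : 'C_H[i] = V) (V4 : #|V| = 4).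
Hypotheses (expV : {in V, forall x, x ^+ 2 = 1}) (sylV : 2.-Sylow(H) V).
Hypothesis nNC : ~~ ('N_H(V) \subset 'C(V)).

Let i2 : i ^+ 2 = 1. Proof. by rewrite -oi expg_order. Qed.
Let abV : abelian V := card_p2group_abelian (isT : prime 2) V4.
Let sVH : V \subset H := pHall_sub sylV.
Let Vi : i \in V. Proof. by rewrite -cV inE Hi cent1id. Qed.
Let nti : i != 1. Proof. by rewrite -order_eq1 oi. Qed.

(** An [n] that normalizes but does not centralize [V] moves its involutions in a 3-cycle: if
    [n ^+ 2] fixed [i], it would lie in [V], and [V <*> <[n]>] would be a larger 2-group. *)
Lemma fused_involutions t : t \in H -> #[t] = 2 -> t \in i ^: H.
Proof.
move=> Ht ot; have [n Nn ncn] := subsetPn nNC.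
have [Hn nVn] := setIP Nn.
have fixV y : y \in H -> i ^ y = i -> y \in V.
  by move=> Hy iy; rewrite -cV inE Hy; apply/cent1P/commute_sym/commgP/conjg_fixP.
have ncV : n \notin V by apply: contra ncn; apply: (subsetP abV).
have Vin : i ^ n \in V by rewrite memJ_norm.
have nein : i ^ n != i by apply: contra ncV => /eqP; apply: fixV.
have ntin : i ^ n != 1 by rewrite -(conj1g n) (inj_eq (conjg_inj n)).
have neinn : (i ^ n) ^ n != i.
  apply: contra ncV => /eqP inn; have Vnn : n ^+ 2 \in V.
    by apply: fixV; rewrite ?groupX // conjgM.
  have pn : 2.-group (V <*> <[n]>).
    rewrite norm_joinEr ?cycle_subG // pgroupM /pgroup V4 /=.
    have : #[n] %| 2 ^ 2 by rewrite order_dvdn (expgM n 2 2) expV.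
    by move/pnat_dvd; apply.
  have sVn : V <*> <[n]> \subset H by rewrite join_subG sVH cycle_subG.
  by rewrite -(sub_pHall sylV pn (joing_subl _ _) sVn) (subsetP (joing_subr _ _)) ?cycle_id.
have defV : V :=: [set 1; i; i ^ n; i * i ^ n].
  apply/eqP; rewrite eq_sym eqEcard V4 card_four_set // andbT.
  exact: four_set_sub.
have inn : (i ^ n) ^ n = i * i ^ n.
  have : (i ^ n) ^ n \in V by rewrite memJ_norm.
  rewrite {1}defV in_set4 => /or4P[] /eqP // e.
  - by case/eqP: ntin; apply: (conjg_inj n); rewrite conj1g.
  - by rewrite e eqxx in neinn.
  by case/eqP: nein; apply: (conjg_inj n).
have stH : <[t]> \subset H by rewrite cycle_subG.
have pt : 2.-group <[t]> by rewrite /pgroup -[#|_|]/#[t] ot.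
have [g Hg] := Sylow_Jsub sylV stH pt; rewrite -cycleJ cycle_subG => Vtg.
rewrite -(memJ_norm _ (subsetP (class_norm i H) g Hg)).
have : t ^ g != 1 by rewrite -(conj1g g) (inj_eq (conjg_inj g)) -order_eq1 ot.
move: Vtg; rewrite {1}defV in_set4 => /or4P[] /eqP-> //; last rewrite -inn.
- by rewrite eqxx.
- by rewrite class_refl.
- by rewrite memJ_class.
by rewrite -conjgM memJ_class // groupM.
Qed.

Let T := i ^: H.

Lemma fused_cent t : t \in H -> #[t] = 2 -> [/\ #|'C_H[t]| = 4, abelian 'C_H[t] & t ^+ 2 = 1].
Proof.
move=> Ht ot; have /imsetP[g Hg ->] := fused_involutions Ht ot.
have -> : 'C_H[i ^ g] = V :^ g by rewrite cent1J -{1}(conjGid Hg) -conjIg cV.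
by rewrite cardJg abelianJ -conjXg i2 conj1g.
Qed.

Lemma fusedT t : t \in T -> [/\ t \in H, #[t] = 2 & t != 1].
Proof.
by case/imsetP=> g Hg ->; rewrite groupJ // -order_eq1 orderJ oi.
Qed.

Lemma fused_card : #|H| = (4 * #|T|)%N.
Proof. by rewrite -index_cent1 -V4 -cV Lagrange ?subsetIl. Qed.

Lemma fused_odd : odd #|T|.
Proof.
have /and3P[_ _] := sylV; rewrite -divgS // fused_card V4 mulKn //.
by rewrite odd_2'nat.
Qed.

Lemma even_order_involution x : x \in H -> ~~ odd #[x] ->
  exists2 z, z \in <[x]> & #[z] = 2.
Proof. by rewrite -dvdn2 => Hx /(Cauchy (isT : prime 2))[z xz oz]; exists z. Qed.

(** [s] inverts [x], so it commutes with the involution [z] of [<[x]>]; both [s] and [x] then lie in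
    the abelian group ['C_H[z]]. *)
Lemma fused_commute s x : s \in T -> s * x \in T -> x \in H -> ~~ odd #[x] -> commute s x.
Proof.
move=> Ts Tsx Hx evenx; have [Hs os _] := fusedT Ts; have [Hsx osx _] := fusedT Tsx.
have [_ _ s2] := fused_cent Hs os; have [_ _ sx2] := fused_cent Hsx osx.
have xs := order2_mul s2 sx2.
have [z xz oz] := even_order_involution Hx evenx.
have Hz : z \in H by apply: mem_cycle_sub xz.
have [_ abC z2] := fused_cent Hz oz.
have zV := involutionV z2.
have Csz : s \in 'C_H[z].
  rewrite inE Hs; apply/cent1P/commute_sym/commgP/conjg_fixP.
  by have /cycleP[k def_z] := xz; rewrite {1}def_z conjXg xs expgVn -def_z.
have Cxz : x \in 'C_H[z].
  by rewrite inE Hx; have /cycleP[k ->] := xz; apply/cent1P/commuteX.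
exact: (centsP abC).
Qed.

Let m x := #|[set s in T | s * x \in T]|.

(* m x counts the ways of writing x as a product of two involutions; they all invert x. *)
Lemma fused_mult_le x : x \in H -> m x <= #|'C_H[x]|.
Proof.
move=> Hx; rewrite /m; set S := [set s in T | _].
have inv s : s \in S -> s \in H /\ x ^ s = x^-1.
  rewrite inE => /andP[Ts Tsx]; have [Hs os _] := fusedT Ts; have [Hsx osx _] := fusedT Tsx.
  have [_ _ s2] := fused_cent Hs os; have [_ _ sx2] := fused_cent Hsx osx.
  by split=> //; apply: order2_mul.
have [-> | [s0 Ss0]] := set_0Vmem S; first by rewrite cards0.
rewrite -(card_imset S (mulIg s0)); apply/subset_leq_card/subsetP=> _ /imsetP[s Ss ->].
have [[Hs xs] [Hs0 xs0]] := (inv s Ss, inv s0 Ss0).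
rewrite inE groupM //; apply/cent1P/commute_sym/commgP/conjg_fixP.
by rewrite conjgM xs conjVg xs0 invgK.
Qed.

Lemma fused_mult_sum : \sum_(x in H) m x = (#|T| * #|T|)%N.
Proof.
transitivity (\sum_(x in H) \sum_(s in T) ((s * x)%g \in T)).
  by apply: eq_bigr => x _; rewrite /m -sum1dep_card big_mkcondr.
rewrite exchange_big -sum_nat_const; apply: eq_bigr => s /fusedT[Hs _ _].
rewrite -big_mkcondr sum1_card -[#|T|](card_imset T (mulgI s^-1)).
apply: eq_card => x; apply/andP/imsetP=> [[Hx Tsx] | [t Tt ->]].
  by exists (s * x); rewrite ?mulKg.
by have [Ht _ _] := fusedT Tt; rewrite mulKVg groupM ?groupV.
Qed.

(** For fixed [s], the product [s * x] commutes with [s] by [fused_commute], and ['C_H[s]] has only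
    two elements besides 1 and [s]. *)
Lemma fused_mult_even : \sum_(x in H | ~~ odd #[x]) m x <= #|T| * 2.
Proof.
apply: (@leq_trans (\sum_(x in H | ~~ odd #[x]) \sum_(s in T) ((s * x)%g \in T))).
  by apply: leq_sum => x _; rewrite /m -sum1dep_card big_mkcondr.
rewrite exchange_big -sum_nat_const; apply: leq_sum => s Ts; have [Hs os nts] := fusedT Ts.
have [C4 _ s2] := fused_cent Hs os.
rewrite -big_mkcondr sum1_card.
rewrite -(card_imset _ (mulgI s)).
have C2 : #|'C_H[s] :\: [set 1; s]| = 2.
  rewrite cardsD C4 (setIidPr _) ?cards2 1?eq_sym ?nts //.
  by rewrite subUset !sub1set group1 inE Hs cent1id.
rewrite -C2; apply/subset_leq_card/subsetP=> t /imsetP[x /andP[/andP[Hx evenx] Tsx] ->].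
have [Hsx osx ntsx] := fusedT Tsx.
rewrite in_setD in_set2 negb_or ntsx inE Hsx /=.
rewrite -[X in _ != X]mulg1 (inj_eq (mulgI s)); apply/andP; split.
  by apply: contraNneq evenx => ->; rewrite order1.
apply/cent1P/commute_sym/commuteM => //; exact: fused_commute.
Qed.

Lemma fused_odd_elements :
  #|[set x in H | odd #[x] && (x != 1)]| + #|T| + 1 <= 4 * #|T|.
Proof.
set O := [set x in H | _]; have dis1 : O :&: T = set0.
  apply/setP=> x; rewrite in_set0; apply/setIP=> [[]].
  by rewrite inE => /and3P[_ oddx _] /fusedT[_ ox _]; rewrite ox in oddx.
have dis2 : (O :|: T) :&: [set 1] = set0.
  apply/setP=> x; rewrite in_set0; apply/setIP=> [[]].
  rewrite in_set1 => OTx /eqP x1; move: OTx; rewrite x1 inE => /orP[].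
    by rewrite inE eqxx !andbF.
  by case/fusedT=> _ _; rewrite eqxx.
have := cardsUI O T; rewrite dis1 cards0 addn0 => <-.
have := cardsUI (O :|: T) [set 1]; rewrite dis2 cards0 addn0 cards1 => <-.
rewrite -fused_card; apply/subset_leq_card/subsetP=> x /setUP[/setUP[]|/set1P->] //.
  by rewrite inE => /andP[].
by case/fusedT.
Qed.

(** Of the [#|T| ^ 2] products of two involutions, at most [3 * #|T|] are 1 or of even order. The
    others spread over fewer than [3 * #|T|] elements, so some multiplicity is about a third of
    [#|T|] or more, and [fused_mult_le] turns it into a large centralizer. *)
Lemma fused_real_element : 3 < #|T| ->
  exists x s, [/\ x \in H, x != 1, odd #[x] & [/\ s \in T, x ^ s = x^-1 & #|T| < 3 * #|'C_H[x]| + 3]].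
Proof.
move=> gtT; pose O := [set x in H | odd #[x] && (x != 1)].
pose P x := [exists s in T, x ^ s == x^-1] && (#|T| < 3 * #|'C_H[x]| + 3).
have [/exists_inP[x] | noP] := boolP [exists x in O, P x].
  rewrite inE => /and3P[Hx oddx ntx] /andP[/exists_inP[s Ts /eqP xs] ltT].
  by exists x, s.
have mO x : x \in O -> 3 * m x <= #|T| - 3.
  move=> Ox; have := Ox; rewrite inE => /and3P[Hx oddx ntx].
  have [m0 | [s]] := set_0Vmem [set s in T | s * x \in T]; first by rewrite /m m0 cards0.
  rewrite inE => /andP[Ts Tsx].
  have [Hs os _] := fusedT Ts; have [Hsx osx _] := fusedT Tsx.
  have [_ _ s2] := fused_cent Hs os; have [_ _ sx2] := fused_cent Hsx osx.
  have xs := order2_mul s2 sx2; have := fused_mult_le Hx.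
  have : ~~ P x by apply: contra noP => Px; apply/exists_inP; exists x.
  rewrite negb_and -leqNgt => /orP[/exists_inP[]| leT]; first by exists s; rewrite ?xs.
  move=> le_m; rewrite -(leq_add2r 3) subnK ?(ltnW gtT) //.
  by apply: leq_trans leT; rewrite leq_add2r leq_mul2l.
have sumO : 3 * \sum_(x in O) m x <= #|O| * (#|T| - 3).
  by rewrite big_distrr -sum_nat_const /=; apply: leq_sum => x; apply: mO.
have m1 : m 1 <= #|T| by apply/subset_leq_card/subsetP=> s; rewrite inE => /andP[].
have oddE : \sum_(x in H | odd #[x]) m x = (m 1%g + \sum_(x in O) m x)%N.
  rewrite (bigD1 1%g) ?group1 ?order1 //=; congr (_ + _)%N.
  by apply: eq_bigl => x; rewrite inE andbA.
have := fused_mult_sum; rewrite (bigID (fun x => odd #[x])) /= oddE.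
have := fused_mult_even; have := fused_odd_elements; rewrite -/O.
move: gtT sumO m1 {mO noP oddE}; clear; move: (m 1%g) (\sum_(x in O) m x)%N (\sum_(x in H | _) m x)%N.
move: #|O| #|T| => o n m1 S E n3 le1 le2 le3 le4 sumE; exfalso.
case: n n3 le1 le2 le3 le4 sumE => [|[|[|n]]] // n3; rewrite !subSS subn0 => le1 le2 le3 le4 sumE.
have : o * n <= (3 * n + 8) * n by rewrite leq_mul2r; apply/orP; right; lia.
lia.
Qed.

Lemma fused_real_cent x s : x \in H -> x != 1 -> odd #[x] -> s \in T -> x ^ s = x^-1 ->
  [/\ odd #|'C_H[x]|, abelian 'C_H[x] & {in 'C_H[x], forall y, y ^ s = y^-1}].
Proof.
move=> Hx ntx oddx Ts xs; have [Hs os _] := fusedT Ts; have [C4 _ s2] := fused_cent Hs os.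
have oddC : odd #|'C_H[x]|.
  rewrite -[odd _]negbK -dvdn2; apply/negP=> /(Cauchy (isT : prime 2))[z /setIP[Hz czx] oz].
  have [Cz4 _ _] := fused_cent Hz oz.
  have : x \in 'C_H[z] by rewrite inE Hx cent1C.
  move/order_dvdG; rewrite Cz4 -[4]/(2 ^ 2 * 1)%N Gauss_dvdr ?coprimeXr ?coprimen2 //.
  by rewrite dvdn1 order_eq1 (negPf ntx).
have inv : {in 'C_H[x], forall y, y ^ s = y^-1}.
  move=> y Cy; apply: (@involution_inverts _ 'C_H[x]%G) => //.
    rewrite -cycle_subG normsI ?cycle_subG ?(subsetP (normG H)) // inE sub_conjg /=.
    rewrite -cent1J; have -> : x ^ s^-1 = x^-1.
      by apply: (conjg_inj s); rewrite conjgKV conjVg xs invgK.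
    by rewrite -!cent_cycle cycleV.
  by apply: (@odd_regular _ H) => //; rewrite ?subsetIl // /pgroup C4.
by split=> //; apply: inverted_abelian inv.
Qed.

(** When [#|T| > 3], the centralizer [A] of the real element is abelian, meets its other conjugates
    trivially and is not normal, so [#|A| ^ 2 <= #|H|]. With the lower bound on [#|A|] this gives
    [#|H| = 12 * #|A|], and [A] turns out to have six conjugates. *)
Lemma fused_order : #|H| %| 60.
Proof.
have oddT := fused_odd; have [leT | gtT] := leqP #|T| 3.
  by rewrite fused_card; case: #|T| oddT leT => [|[|[|[|]]]].
have [x [s [Hx ntx oddx [Ts xs ltT]]]] := fused_real_element gtT.
have [Hs os _] := fusedT Ts; have [C4s _ s2] := fused_cent Hs os.
have [] := fused_real_cent Hx ntx oddx Ts xs; set A := 'C_H[x] => oddA abA inv.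
pose AG := 'C_H[x]%G; have sAH : A \subset H := subsetIl _ _.
have Ax : x \in A by rewrite inE Hx cent1id.
have cA y : y \in A -> y != 1 -> 'C_H[y] = A.
  move=> Ay nty; have Hy := subsetP sAH y Ay.
  have oddy : odd #[y] by apply: dvdn_odd (order_dvdG Ay) oddA.
  have [_ abC _] := fused_real_cent Hy nty oddy Ts (inv y Ay).
  apply/eqP; rewrite eqEsubset; apply/andP; split; last first.
    by rewrite subsetI sAH sub_cent1 (subsetP abA).
  apply/subsetP=> w Cw; apply/setIP; split; first by case/setIP: Cw.
  apply/cent1P; apply: (centsP abC) => //.
  by rewrite inE Hx; apply/cent1P; apply: (centsP abA).
have TI g y : g \in H -> y \in A -> y \in A :^ g -> y != 1 -> A :^ g = A.
  move=> Hg Ay Agy nty; rewrite -[RHS](cA y) //; rewrite mem_conjg in Agy.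
  rewrite -(cA (y ^ g^-1)) //; last by rewrite -(conj1g g^-1) (inj_eq (conjg_inj _)).
  by rewrite conjIg (conjGid Hg) -cent1J conjgKV.
pose a := #|A|; have a_gt2 : 2 < a.
  have : 1 < a by rewrite cardG_gt1; apply/trivgPn; exists x.
  by move: oddA; rewrite -/a; case: a => [|[|[|]]].
have [e def_n] : exists e, #|T| = (e * a)%N.
  apply/dvdnP; have : a %| #|H| by apply: cardSg.
  by rewrite fused_card -[4]/(2 ^ 2)%N Gauss_dvdr // coprimeXr ?coprimen2.
have NAs : s \in 'N_H(A).
  rewrite inE Hs inE; apply/subsetP=> y /imsetP[w Aw ->]; rewrite inv //.
  by rewrite -/(gval AG) groupV.
have sANA : A \subset 'N_H(A) by rewrite subsetI sAH normG.
(* Otherwise a four-group normalizes [A]; all its involutions would invert [x], yet the product of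
   two of them centralizes [x]. *)
have no4 : ~~ (4 %| #|'N_H(A)|).
  apply/negP=> dv4; have [Q sylQ] := Sylow_exists 2 'N_H(A)%G.
  have [sQN pQ _] := and3P sylQ.
  have Q4 : 3 < #|Q|.
    rewrite (card_Hall sylQ) dvdn_leq ?part_gt0 // p_part.
    by rewrite -[4]/(2 ^ 2)%N dvdn_exp2l // -pfactor_dvdn // cardG_gt0.
  have [g Hg sQV] := Sylow_Jsub sylV (subset_trans sQN (subsetIl _ _)) pQ.
  have invQ q : q \in Q -> q != 1 -> x ^ q = x^-1.
    move=> Qq ntq; have q2 : q ^+ 2 = 1.
      have /expV : q ^ g \in V by rewrite (subsetP sQV) // memJ_conjg.
      by rewrite -conjXg => qg; apply: (conjg_inj g); rewrite qg conj1g.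
    have [Hq nAq] := setIP (subsetP sQN q Qq).
    have oq : #[q] = 2 by apply: nt_prime_order.
    have [Cq4 _ _] := fused_cent Hq oq.
    apply: (@involution_inverts _ AG) => //.
    by apply: (@odd_regular _ H) => //; rewrite /pgroup Cq4.
  have [q1 Qq1 ntq1] : exists2 q, q \in Q & q != 1.
    by apply/trivgPn; rewrite -cardG_gt1; apply: ltn_trans Q4.
  have [q2 Qq2] : exists2 q, q \in Q & q \notin [set 1; q1^-1].
    apply/subsetPn; apply: contraL Q4 => /subset_leq_card; rewrite cards2 -leqNgt.
    by move/leq_trans; apply; case: (_ != _).
  rewrite in_set2 negb_or => /andP[ntq2 neq].
  have := invQ _ (groupM Qq1 Qq2); rewrite conjgM invQ // conjVg invQ // invgK => xx.
  have : x = x^-1 by apply: xx; rewrite -eq_invg_mul eq_sym.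
  move/eqP; rewrite eq_sym eq_invg_mul -(expgS x 1) -order_dvdn => dv2.
  by have := dvdn_odd dv2; move: oddx ntx; rewrite -order_eq1; case: #[x] dv2 => [|[|[|]]].
have ndvH : ~~ (H \subset 'N(A)).
  apply: contra no4 => nAH; rewrite (setIidPl nAH) fused_card; exact: dvdn_mulr.
have aa : a * a <= #|H|.
  have [g Hg nAg] := subsetPn ndvH.
  have tiA : AG :&: (AG :^ g)%G = 1.
    apply/trivgP/subsetP=> y /setIP[Ay Agy]; rewrite in_set1; apply: contraR nAg => nty.
    by apply/normP; apply: TI Agy nty.
  rewrite -{2}[a](cardJg _ g) -(TI_cardMg tiA); apply/subset_leq_card.
  by rewrite mul_subG // -(conjGid Hg) conjSg.
have a0 : 0 < a := ltn_trans (isT : 0 < 2) a_gt2.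
have ae : a <= 4 * e by rewrite -(leq_pmul2r a0) -mulnA -def_n -fused_card.
have e3 : e = 3.
  rewrite def_n in ltT gtT oddT; rewrite -/a in ltT.
  have : e < 4.
    rewrite ltnNge; apply/negP=> le4; have := leq_mul le4 (leqnn a).
    by move: ltT a_gt2; clear; lia.
  move: oddT gtT ae; rewrite oddM => /andP[odde _].
  case: e odde {def_n ltT} => [|[|[|[|e]]]] //= _; rewrite mul1n muln1 => gt3 le4.
  have a4 : a = 4 by apply/eqP; rewrite eqn_leq le4.
  by move: oddA; rewrite -/a a4.
rewrite e3 in def_n ae.
have hE : #|H| = (12 * a)%N by rewrite fused_card def_n mulnA.
have [l def_l] : exists l, #|'N_H(A)| = (l * (2 * a))%N.
  apply/dvdnP; rewrite Gauss_dvd ?coprime2n // cardSg // andbT.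
  by rewrite -os order_dvdG.
have idx : (l * #|H : 'N_H(A)| = 6)%N.
  apply/eqP; rewrite -(eqn_pmul2l (_ : 0 < 2 * a)) ?muln_gt0 ?a0 //.
  rewrite mulnA [(2 * a * l)%N]mulnC -def_l Lagrange ?subsetIl // hE.
  by rewrite -mulnA [X in _ == X]mulnCA mulnC mulnA.
have oddl : odd l.
  apply: contraR no4; rewrite -dvdn2 => /dvdnP[k def_k].
  by rewrite def_l def_k -mulnA dvdn_mull // mulnA dvdn_mulr.
have nT t0 : 'N_H(A) <| H -> t0 \in H -> #[t0] = 2 -> t0 \in 'N_H(A).
  move=> nNA Ht0 ot0; have := fused_involutions Ht0 ot0.
  rewrite (class_eqP (_ : i \in s ^: H)); last by rewrite class_sym.
  by case/imsetP=> g Hg ->; rewrite memJ_norm // (subsetP (normal_norm nNA)).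
(* [l] is 1 or 3. If it were 3, the normalizer would have index 2 and contain all involutions, hence
   [V]. *)
have l1 : l = 1%N.
  have dvl : l %| 6 by rewrite -idx dvdn_mulr.
  have lel := dvdn_leq (isT : 0 < 6) dvl; move: oddl dvl lel idx def_l.
  case: l => [|[|[|[|[|[|[|l]]]]]]] // _ _ _ idx def_l; have id2 : #|H : 'N_H(A)| = 2.
    by apply/eqP; rewrite -(eqn_pmul2l (isT : 0 < 3)) idx.
  have nNA := index2_normal (subsetIl H 'N(A)) id2.
  case/negP: no4; rewrite -V4 cardSg //; apply/subsetP=> w Vw.
  have [-> | ntw] := eqVneq w 1; first exact: group1.
  apply: nT => //; first exact: (subsetP sVH).
  by apply: nt_prime_order => //; apply: expV.
rewrite l1 !mul1n in def_l idx.
have hallA : 2^'.-Hall('N_H(A)) AG.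
  rewrite /pHall sANA /pgroup -odd_2'nat oddA -divgS // def_l mulnK //.
have nANA : AG <| 'N_H(A) by rewrite /normal sANA subsetIr.
have prime5 p : prime p -> p %| a -> p = 5.
  move=> pr /(Cauchy pr)[y Ay oy].
  have nty : y != 1 by rewrite -order_gt1 oy prime_gt1.
  have Hy : y \in H := subsetP sAH y Ay.
  have oddp : odd p by rewrite -oy; apply: dvdn_odd (order_dvdG Ay) oddA.
  have py : p.-group <[y]> by rewrite /pgroup -[#|_|]/#[y] oy pnat_id.
  have acty : [acts <[y]>, on A :^: H | 'Js].
    rewrite cycle_subG inE /= inE; apply/andP; split=> //; rewrite inE.
    apply/subsetP=> B /imsetP[g Hg ->]; rewrite inE /= -conjsgM.
    by apply: imset_f; rewrite groupM.
  have := pgroup_fix_mod py acty; rewrite card_conjugates idx.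
  (* An element of order [p] fixes only [A] among the six conjugates, so 6 is 1 modulo [p]. *)
  rewrite (_ : 'Fix_(A :^: H | 'Js)(<[y]>) = [set A]) ?cards1.
    move/eqP; rewrite eqn_mod_dvd // => dv5.
    by have := (primeP (isT : prime 5)).2 p dv5; case/pred2P=> // p1; rewrite p1 in pr.
  apply/setP=> B; rewrite in_set1; apply/setIP/eqP=> [[/imsetP[g Hg ->]] | ->].
    move/afixP/(_ y (cycle_id y)) => /= Agy; apply: (TI g y) => //.
    rewrite mem_conjg; have Hyg : y ^ g^-1 \in H by rewrite groupJ ?groupV.
    rewrite -[A]/(gval AG) (mem_normal_Hall hallA nANA).
      by rewrite /p_elt orderJ oy -odd_2'nat.
    rewrite inE Hyg /=; apply/normP; apply: (@conjsg_inj _ g).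
    have yg : y ^ g^-1 * g = g * y by rewrite conjgE invgK -!mulgA mulVg mulg1.
    by rewrite -conjsgM yg conjsgM Agy.
  split; first by rewrite -{1}(conjsg1 A); apply: imset_f; apply: group1.
  by apply/afixP=> w yw /=; apply: conjGid; rewrite /=; apply: (subsetP (_ : <[y]> \subset A)) yw; rewrite cycle_subG.
have a1 : 1 < a := ltn_trans (isT : 1 < 2) a_gt2.
have dv5 : 5 %| a by rewrite -(prime5 _ (pdiv_prime a1) (pdiv_dvd a)) pdiv_dvd.
have [k def_a] := dvdnP dv5; rewrite -/a in oddA.
rewrite hE; move: oddA ae a_gt2; rewrite def_a oddM andbT.
by case: k {def_a} => [|[|[|k]]].
Qed.

(** In the application [H] is [G / 'Z(G)], and orders of this form make centralizers in [G] cyclic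
    modulo a central subgroup, hence abelian. *)
Lemma fused_cent_order x : x \in H^# ->
  exists k, #|'C_H[x]| = (#[x] * k)%N /\ (k = 1%N \/ prime k).
Proof.
case/setD1P=> ntx Hx; have Cx : x \in 'C_H[x] by rewrite inE Hx cent1id.
have /dvdnP[k def_k] := order_dvdG Cx; exists k; rewrite mulnC; split=> //.
have gto : 1 < #[x] by rewrite order_gt1.
have gtk : 0 < k by have := cardG_gt0 'C_H[x]%G; rewrite def_k muln_gt0 => /andP[].
have [oddx | evenx] := boolP (odd #[x]); last first.
  have [z xz oz] := even_order_involution Hx evenx.
  have Hz : z \in H by apply: mem_cycle_sub xz.
  have [C4 _ _] := fused_cent Hz oz.
  have : #|'C_H[x]| %| 4.
    rewrite -C4 cardSg // setIS //; have /cycleP[j ->] := xz.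
    by apply/subsetP=> w /cent1P cxw; apply/cent1P/commuteX.
  move/dvdn_leq=> /(_ isT); rewrite def_k => le4.
  have : k * 2 <= 4 := leq_trans (leq_mul (leqnn k) gto) le4.
  by case: k gtk {def_k le4} => [|[|[|k]]] //; [left | right].
have oddC : odd #|'C_H[x]|.
  rewrite -[odd _]negbK -dvdn2; apply/negP=> /(Cauchy (isT : prime 2))[z /setIP[Hz czx] oz].
  have [Cz4 _ _] := fused_cent Hz oz.
  have : x \in 'C_H[z] by rewrite inE Hx cent1C.
  move/order_dvdG; rewrite Cz4 -[4]/(2 ^ 2 * 1)%N Gauss_dvdr ?coprimeXr ?coprimen2 //.
  by rewrite dvdn1 order_eq1 (negPf ntx).
have : #|'C_H[x]| %| 15.
  have := dvdn_trans (cardSg (subsetIl H 'C[x])) fused_order.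
  by rewrite -[60]/(2 ^ 2 * 15)%N Gauss_dvdr ?coprimeXr ?coprimen2.
rewrite def_k => dv15; have := dvdn_leq (isT : 0 < 15) dv15.
have dvk : k %| 15 := dvdn_trans (dvdn_mulr _ (dvdnn k)) dv15.
move/(leq_trans (leq_mul (leqnn k) gto)) => lek.
have : k <= 7 by lia.
by case: k dvk {def_k gtk dv15 lek} => [|[|[|[|[|[|[|[|]]]]]]]] //; [left | right | right].
Qed.

End FusedInvolutions.

Lemma involution_product (gT : finGroupType) (s t : gT) :
  s ^+ 2 = 1 -> t ^+ 2 = 1 -> (s * t) ^ s = (s * t)^-1 /\ (s * t) ^ t = (s * t)^-1.
Proof.
move=> /involutionV sV /involutionV tV; rewrite invMg sV tV; split; first by rewrite conjgE -(mulgA s t s) mulKg.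
have tt : t * t = 1 by rewrite -{1}tV mulVg.
by rewrite conjgE -(mulgA s t t) tt mulg1 tV.
Qed.

Lemma involution_product_odd (gT : finGroupType) (s t : gT) :
    s ^+ 2 = 1 -> t ^+ 2 = 1 -> odd #[s * t] ->
  exists2 w, w \in <[s * t]> & t = s ^ w.
Proof.
move=> s2 t2 oddw; have [ws _] := involution_product s2 t2.
(* The exponent is the inverse of 2 modulo the odd order of [w], since
   [s ^ (w ^+ k) = s * w ^+ (2 * k)]. *)
set w := s * t in oddw ws *; exists (w ^+ (#[w]./2).+1); first exact: mem_cycle.
have sV := involutionV s2.
have swk k : s ^ (w ^+ k) = s * w ^+ (k * 2).
  have ws' : (w ^+ k)^-1 = s * w ^+ k * s by rewrite -expgVn -ws -conjXg conjgE sV mulgA.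
  by rewrite conjgE ws' -!mulgA (mulgA s s) -(expgS s 1) s2 mul1g muln2 -addnn expgD.
rewrite swk; have -> : ((#[w]./2).+1 * 2 = #[w] + 1)%N.
  by rewrite muln2 doubleS addn1 -[in RHS](odd_double_half #[w]) oddw add1n.
by rewrite expgD expg_order mul1g expg1 mulgA -(expgS s 1) s2 mul1g.
Qed.

(** * Four-groups that are not Sylow subgroups *)

Section NonSylow.

Variables (gT : finGroupType) (H V P : {group gT}) (i j : gT).
Hypotheses (Hi : i \in H) (oi : #[i] = 2) (cV : 'C_H[i] = V) (V4 : #|V| = 4).
Hypotheses (expV : {in V, forall x, x ^+ 2 = 1}) (sylP : 2.-Sylow(H) P) (sVP : V \subset P).
Hypotheses (gtP : 4 < #|P|) (Vj : j \in V) (ntj : j != 1) (nji : j != i) (cPj : P \subset 'C[j]).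

Let i2 : i ^+ 2 = 1. Proof. by rewrite -oi expg_order. Qed.
Let j2 : j ^+ 2 = 1. Proof. exact: expV. Qed.
Let iV : i^-1 = i. Proof. exact: involutionV. Qed.
Let abV : abelian V := card_p2group_abelian (isT : prime 2) V4.
Let sPH : P \subset H := pHall_sub sylP.
Let sVH : V \subset H := subset_trans sVP sPH.
Let Vi : i \in V. Proof. by rewrite -cV inE Hi cent1id. Qed.
Let nti : i != 1. Proof. by rewrite -order_eq1 oi. Qed.
Let Hj : j \in H := subsetP sVH j Vj.

Let J := j ^: H.
Let E := <<J>>%G.

Lemma nonSylow_fix y : y \in H -> i ^ y = i -> y \in V.
Proof. by move=> Hy iy; rewrite -cV inE Hy; apply/cent1P/commute_sym/commgP/conjg_fixP. Qed.

Lemma nonSylow_not_conj : j \notin i ^: H.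
Proof.
apply/negP=> /imsetP[g Hg def_j]; have := gtP; rewrite ltnNge -V4 -cV.
rewrite -(cardJg 'C_H[i] g) conjIg (conjGid Hg) -cent1J -def_j.
by rewrite subset_leq_card // subsetI sPH.
Qed.

Lemma nonSylow_V : V :=: [set 1; i; j; i * j].
Proof.
apply/eqP; rewrite eq_sym eqEcard V4 card_four_set // andbT.
exact: four_set_sub.
Qed.

(** Some [x] of [P] outside [V] normalizes [V] and moves [i], but not to [j], whose centralizer is
    larger. *)
Lemma nonSylow_conj : i * j \in i ^: H.
Proof.
have prV : V \proper P by rewrite properEcard sVP V4.
have := nilpotent_proper_norm (pgroup_nil (pHall_pgroup sylP)) prV.
case/properP=> _ [x /setIP[Px nVx] nVxx]; have Hx := subsetP sPH x Px.
suff -> : i * j = i ^ x by apply: memJ_class.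
have : i ^ x \in V by rewrite memJ_norm.
rewrite {1}nonSylow_V in_set4 => /or4P[] /eqP // ix.
- by case/eqP: nti; apply: (conjg_inj x); rewrite conj1g.
- by rewrite nonSylow_fix in nVxx.
by case/negP: nonSylow_not_conj; rewrite -ix memJ_class.
Qed.

Lemma nonSylow_VJ v : v \in V -> v \in J -> v = j.
Proof.
rewrite {1}nonSylow_V in_set4 => /or4P[] /eqP-> // Jv.
- by case/eqP: ntj; case/imsetP: Jv => g Hg; rewrite -{1}(conj1g g) => /conjg_inj.
- by case/negP: nonSylow_not_conj; rewrite class_sym.
by case/negP: nonSylow_not_conj; rewrite -(class_eqP nonSylow_conj) class_sym.
Qed.

Lemma nonSylow_J j' : j' \in J -> [/\ j' \in H, j' != 1 & j' ^+ 2 = 1].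
Proof.
case/imsetP=> g Hg ->; rewrite groupJ // -(conj1g g) (inj_eq (conjg_inj g)) -conjXg j2 ntj.
by rewrite conj1g.
Qed.

(** As [i] and [j'] are not conjugate, [i * j'] has even order, and the involution [z] among its
    powers lies in ['C_H[i] = V]. If [z] is [j], the claim holds; if it is [i] or [i * j], whose
    centralizer is [V], then [j'] lies in [V] and equals [j]. *)
Lemma nonSylow_commute j' : j' \in J -> commute j j'.
Proof.
move=> Jj'; have [Hj' ntj' j'2] := nonSylow_J Jj'.
have Hw : i * j' \in H by rewrite groupM.
have [oddw | evenw] := boolP (odd #[i * j']).
  have [w wi def_j'] := involution_product_odd i2 j'2 oddw.
  case/negP: nonSylow_not_conj; have Hww : w \in H.
    by apply: mem_cycle_sub wi.
  have : j' \in i ^: H by rewrite def_j' memJ_class.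
  by move=> /class_eqP <-; rewrite (class_eqP Jj') class_refl.
have [z zw oz] := even_order_involution Hw evenw.
have Hz : z \in H by apply: mem_cycle_sub zw.
have z2 : z ^+ 2 = 1 by rewrite -oz expg_order.
have zV := involutionV z2.
have cz s : (i * j') ^ s = (i * j')^-1 -> commute z s.
  move=> ws; apply/commgP/conjg_fixP; have /cycleP[k def_z] := zw.
  by rewrite {1}def_z conjXg ws expgVn -def_z.
have [wi wj'] := involution_product i2 j'2.
have Vz : z \in V by rewrite -cV inE Hz; apply/cent1P/cz.
have ntz : z != 1 by rewrite -order_eq1 oz.
have VJ : j' \in V -> commute j j' by move/nonSylow_VJ/(_ Jj')->.
have := Vz; rewrite {1}nonSylow_V in_set4 (negPf ntz) /=.
case/or3P=> /eqP def_z; rewrite def_z in cz.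
- by apply: VJ; rewrite -cV inE Hj'; apply/cent1P/commute_sym/cz.
- exact: cz.
apply: VJ; have /imsetP[g Hg def_ij] := nonSylow_conj.
have C4 : #|'C_H[i * j]| = 4.
  by rewrite def_ij cent1J -{1}(conjGid Hg) -conjIg cardJg cV.
have -> : V :=: 'C_H[i * j].
  apply/eqP; rewrite eqEcard V4 C4 andbT subsetI sVH sub_cent1.
  by rewrite (subsetP abV) ?groupM.
by rewrite inE Hj'; apply/cent1P/commute_sym/cz.
Qed.

Lemma nonSylow_E : [/\ abelian E, E <| H & {in E, forall e, e ^+ 2 = 1}].
Proof.
have sJH : J \subset H by apply/subsetP=> x /nonSylow_J[].
have abE : abelian E.
  rewrite abelian_gen; apply/centsP=> _ /imsetP[g Hg ->] b Jb.
  have Jbg : b ^ g^-1 \in J.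
    by rewrite memJ_norm // (subsetP (class_norm j H)) // groupV.
  by rewrite -[b](conjgKV g) /commute -!conjMg (nonSylow_commute Jbg).
split=> //; first by rewrite /normal gen_subG sJH norms_gen ?class_norm.
have gL := group_Ldiv 2 abE; move=> e Ee.
have sEL : E \subset Group gL.
  rewrite gen_subG; apply/subsetP=> x Jx; have [_ _ x2] := nonSylow_J Jx.
  by apply/LdivP; rewrite mem_gen.
by have /LdivP[] := subsetP sEL e Ee.
Qed.

Let nEH : E <| H. Proof. by case: nonSylow_E. Qed.
Let abE : abelian E. Proof. by case: nonSylow_E. Qed.
Let expE : {in E, forall e, e ^+ 2 = 1}. Proof. by case: nonSylow_E. Qed.
Let Ej : j \in E. Proof. by rewrite mem_gen ?class_refl. Qed.
Let nEi e : e \in E -> e ^ i \in E.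
Proof. by rewrite memJ_norm // (subsetP (normal_norm nEH)). Qed.

Variable j' : gT.
Hypotheses (Jj' : j' \in J) (nj'j : j' != j).

Let Ej' : j' \in E. Proof. by rewrite mem_gen. Qed.
Let j'2 : j' ^+ 2 = 1. Proof. exact: expE. Qed.

Lemma nonSylow_notin : i \notin E.
Proof.
apply/negP=> Ei; have sEV : E \subset V.
  by rewrite -cV subsetI (normal_sub nEH) sub_cent1 (subsetP abE).
by case/eqP: nj'j; apply: nonSylow_VJ => //; apply: (subsetP sEV).
Qed.

Lemma nonSylow_CEi e : e \in E -> e ^ i = e -> e \in [set 1; j].
Proof.
move=> Ee ei; have : e \in V.
  rewrite -cV inE (subsetP (normal_sub nEH)) //.
  by apply/cent1P/commgP/conjg_fixP.
rewrite {1}nonSylow_V in_set4 in_set2 => /or4P[]/eqP def_e.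
- by rewrite def_e eqxx.
- by case/negP: nonSylow_notin; rewrite -def_e.
- by rewrite def_e eqxx orbT.
by case/negP: nonSylow_notin; rewrite -(groupMr _ Ej) -def_e.
Qed.

Lemma nonSylow_trace e : e \in E -> e * e ^ i \in [set 1; j].
Proof.
move=> Ee; apply: nonSylow_CEi; first by rewrite groupM ?nEi.
rewrite conjMg -conjgM -(expgS i 1) i2 conjg1.
by apply: (centsP abE); rewrite ?nEi.
Qed.

(** [e * e ^ i] is fixed by [i], hence 1 or [j]; it is 1 only if [i] fixes [e]. *)
Lemma nonSylow_swap e : e \in E -> e \notin [set 1; j] -> e ^ i = e * j.
Proof.
move=> Ee ne; have eV : e^-1 = e by apply: involutionV; rewrite expE.
have := nonSylow_trace Ee; rewrite in_set2 => /orP[/eqP ei | /eqP <-].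
  by case/negP: ne; apply: nonSylow_CEi => //; apply: (mulgI e); rewrite ei -(expgS e 1) expE.
by rewrite mulgA -(expgS e 1) expE // mul1g.
Qed.

Let nj' : j' \notin [set 1; j].
Proof. by rewrite in_set2 negb_or nj'j andbT; have [] := nonSylow_J Jj'. Qed.

Lemma nonSylow_defE : E :=: [set 1; j; j'; j * j'].
Proof.
apply/eqP; rewrite eqEsubset; apply/andP; split; last exact: four_set_sub.
apply/subsetP=> e Ee; rewrite in_set4.
have [|ne] := boolP (e \in [set 1; j]); first by rewrite in_set2 => /orP[]->; rewrite ?orbT.
have : e * j' \in [set 1; j].
  apply: nonSylow_CEi; first exact: groupM.
  rewrite conjMg !nonSylow_swap // mulgA -(mulgA e) (centsP abE j Ej j' Ej').
  by rewrite -!mulgA -(expgS j 1) j2 mulg1.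
have j'V := involutionV j'2.
rewrite in_set2 => /orP[] /eqP ej'; rewrite -[e](mulgK j') ej' j'V ?mul1g eqxx ?orbT //.
Qed.

Lemma nonSylow_defJ : J = [set j; j'; j * j'].
Proof.
apply/eqP; rewrite eqEsubset; apply/andP; split.
  apply/subsetP=> x Jx; have : x \in E by rewrite mem_gen.
  rewrite nonSylow_defE in_set4 => /or4P[]/eqP def_x.
  - by have [_ ] := nonSylow_J Jx; rewrite def_x eqxx.
  - by rewrite def_x !inE eqxx.
  - by rewrite def_x !inE eqxx orbT.
  by rewrite def_x !inE eqxx !orbT.
have jj' : j * j' = j' ^ i by rewrite nonSylow_swap //; apply: (centsP abE).
apply/subsetP=> x; rewrite 2!in_setU !in_set1 -!orbA => /or3P[]/eqP-> //; first exact: class_refl.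
by rewrite jj' memJ_norm // (subsetP (class_norm j H)).
Qed.

Let D := 'C_H(E)%G.
Let sDH : D \subset H := subsetIl _ _.
Let nDH : D <| H.
Proof. by rewrite /normal sDH /= normsI ?normG // norms_cent // normal_norm. Qed.

Lemma nonSylow_mem_D d : d \in H -> j ^ d = j -> j' ^ d = j' -> d \in D.
Proof.
have cd a : a ^ d = a -> a \in 'C[d] by move=> ad; apply/cent1P/commgP/conjg_fixP.
move=> Hd /cd jd /cd j'd; rewrite inE Hd -sub_cent1 nonSylow_defE.
exact: four_set_sub.
Qed.

Lemma nonSylow_D e d : e \in E -> d \in D -> e ^ d = e.
Proof.
move=> Ee /setIP[_ /centP/(_ e Ee) cde].
by apply/conjg_fixP/commgP/commute_sym.
Qed.

Let j'i : j' ^ i = j' * j. Proof. exact: nonSylow_swap. Qed.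

Let nej'j : j' * j != j'.
Proof. by rewrite -[X in _ != X]mulg1 (inj_eq (mulgI j')). Qed.

Lemma nonSylow_VD v : v \in V -> v \in D -> v \in [set 1; j].
Proof.
rewrite {1}nonSylow_V in_set4 in_set2 => /or4P[]/eqP-> => [_|Di|_|Dij].
- by rewrite eqxx.
- by case/eqP: nej'j; rewrite -j'i nonSylow_D.
- by rewrite eqxx orbT.
case/eqP: nej'j; rewrite -{2}(nonSylow_D Ej' Dij) conjgM j'i conjMg [j ^ j]conjgE mulKg.
by rewrite (nonSylow_D Ej') // inE Hj (subsetP abE).
Qed.

(** This makes [i] regular on [D / E]: the product [i * i ^ d] is 1 or [j], and accordingly [d] or
    [d * j'] centralizes [i] and lies in [V :&: D]. *)
Lemma nonSylow_commD d : d \in D -> i * i ^ d \in E -> d \in E.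
Proof.
move=> Dd; set e := i * i ^ d => Ee; have Hd := subsetP sDH d Dd.
have id : i ^ d = i * e by rewrite mulgA -(expgS i 1) i2 mul1g.
have eV : e^-1 = e by apply: involutionV; rewrite expE.
have sub1j : [set 1; j] \subset E by rewrite subUset !sub1set group1.
have : e \in [set 1; j].
  apply: nonSylow_CEi => //; rewrite -{2}eV; apply: order2_mul => //.
  by rewrite -id -conjXg i2 conj1g.
rewrite in_set2 => /orP[] /eqP def_e.
  apply: (subsetP sub1j); apply: nonSylow_VD => //; apply: nonSylow_fix => //.
  by rewrite id def_e mulg1.
have j'V := involutionV j'2.
have Hj' := subsetP (normal_sub nEH) j' Ej'.
have Dj' : j' \in D by rewrite inE Hj' (subsetP abE).
have ij' : i ^ j' = i * j.
  have -> : i ^ j' = i * (j' ^ i * j') by rewrite !conjgE j'V iV !mulgA -(expgS i 1) i2 mul1g.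
  have jj' : j' * j * j' = j by rewrite (centsP abE j' Ej' j Ej) -mulgA -(expgS j' 1) j'2 mulg1.
  by rewrite j'i jj'.
rewrite -(groupMr _ Ej'); apply: (subsetP sub1j); apply: nonSylow_VD; last exact: groupM.
apply: nonSylow_fix; first exact: groupM.
rewrite conjgM id def_e (conjMg i) ij' (nonSylow_D Ej) //.
by rewrite -mulgA -(expgS j 1) j2 mulg1.
Qed.

(** If a Sylow 2-subgroup of [D] exceeded [E], its image modulo [E] would meet the centre of a
    2-group containing the image of [i], against [nonSylow_commD]. *)
Lemma nonSylow_SylowD : 2.-Sylow(D) E.
Proof.
have pE : 2.-group E.
  apply/pgroupP=> p pr /(Cauchy pr)[e Ee oe].
  have : #[e] %| 2 by rewrite order_dvdn expE.
  by rewrite oe dvdn_prime2.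
have pEi : 2.-group (E <*> <[i]>).
  rewrite norm_joinEr ?cycle_subG ?(subsetP (normal_norm nEH)) // pgroupM pE.
  by rewrite /pgroup -[#|<[i]>|]/#[i] oi.
have sEiH : E <*> <[i]> \subset H by rewrite join_subG (normal_sub nEH) cycle_subG.
have [Q sylQ sEiQ] := Sylow_superset sEiH pEi; have [sQH pQ _] := and3P sylQ.
have [sEQ Qi] : E \subset Q /\ i \in Q.
  by move: sEiQ; rewrite join_subG cycle_subG => /andP[].
have sylR : 2.-Sylow(D) (D :&: Q) := Sylow_setI_normal nDH sylQ.
suff -> : E :=: D :&: Q by [].
have sER : E \subset D :&: Q by rewrite subsetI sEQ andbT subsetI (normal_sub nEH).
apply/eqP; rewrite eqEsubset sER /=; apply: contraT => nRE.
have nER : D :&: Q \subset 'N(E) by rewrite subIset // (subset_trans sDH) // normal_norm.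
have nEQ : E <| Q by apply: normalS nEH.
have nRQ : ((D :&: Q) / E)%g <| (Q / E)%g.
  by apply: quotient_normal; rewrite setIC; apply: normalGI nDH.
have ntR : ((D :&: Q) / E)%g != 1.
  by apply: contra nRE => /eqP/trivgP; rewrite quotient_sub1.
have := meet_center_nil (pgroup_nil (quotient_pgroup E pQ)) nRQ ntR.
case/trivgPn=> _ /setIP[/morphimP[d Nd /setIP[Dd Qd] ->] /centerP[_ cd]] ntd.
case/eqP: ntd; apply: coset_id; apply: nonSylow_commD => //.
have Ni : i \in 'N(E) by rewrite (subsetP (normal_norm nEH)).
have cid := cd (coset E i) (mem_quotient _ Qi).
have -> : i * i ^ d = [~ i, d] by rewrite commgEl iV.
apply: coset_idr; first by rewrite groupR.
by rewrite morphR //; apply/eqP/commgP/commute_sym.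
Qed.

Lemma nonSylow_fix_j h : h \in H -> j ^ h = j -> h \in D \/ h * i \in D.
Proof.
move=> Hh jh; have Jj'h : j' ^ h \in J by rewrite memJ_norm // (subsetP (class_norm j H)).
have ji : j ^ i = j by apply/conjg_fixP/commgP; apply: (centsP abV).
move: Jj'h; rewrite nonSylow_defJ 2!in_setU !in_set1 -!orbA => /or3P[] /eqP j'h.
- by case/eqP: nj'j; apply: (conjg_inj h); rewrite j'h.
- by left; apply: nonSylow_mem_D.
right; apply: nonSylow_mem_D; rewrite ?groupM ?conjgM ?jh //.
by rewrite j'h conjMg ji j'i (centsP abE j' Ej' j Ej) mulgA -(expgS j 1) j2 mul1g.
Qed.

(** Conjugates of [i] invert [K], and [D] centralizes it. The stabilizer of [j] consists of [D] and
    a coset of [i], and conjugates of [i] move the other members of [J] to [j]. So every [h] in [H]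
    sends [y] to itself or its inverse. *)
Lemma nonSylow_complement (K : {group gT}) :
    K <| H -> odd #|K| -> abelian K -> K :!=: 1 -> D \subset 'C(K) ->
  exists y, [/\ y \in H^#, odd #[y] & #|H : 'C_H[y]| <= 2].
Proof.
move=> nKH oddK abK ntK cDK; have sKH := normal_sub nKH.
have invK t y : t \in i ^: H -> y \in K -> y ^ t = y^-1.
  case/imsetP=> g Hg ->; apply: involution_inverts.
  - by rewrite (subsetP (normal_norm nKH)) ?groupJ.
  - by rewrite -conjXg i2 conj1g.
  apply: (odd_regular sKH oddK).
  by rewrite /pgroup cent1J -{1}(conjGid Hg) -conjIg cardJg cV V4.
have [y Ky nty] := trivgPn _ ntK; exists y; split.
- by apply/setD1P; split=> //; apply: (subsetP sKH).
- exact: dvdn_odd (order_dvdG Ky) oddK.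
rewrite index_cent1; apply: (@leq_trans #|[set y; y^-1]|); last first.
  by rewrite cards2; case: (_ != _).
have fixj h : h \in H -> j ^ h = j -> y ^ h \in [set y; y^-1].
  have cDy d : d \in D -> y ^ d = y.
    by move=> Dd; apply/conjg_fixP/commgP/commute_sym; apply: (centsP cDK).
  move=> Hh /(nonSylow_fix_j Hh)[/cDy-> | /cDy yhi]; first by rewrite set21.
  have -> : y ^ h = (y ^ (h * i)) ^ i by rewrite conjgM -[RHS]conjgM -(expgS i 1) i2 conjg1.
  by rewrite yhi invK ?class_refl // set22.
apply/subset_leq_card/subsetP=> _ /imsetP[h Hh ->].
have moved t : t \in i ^: H -> j ^ (h * t) = j -> y ^ h \in [set y; y^-1].
  move=> Tt jht; have Ht : t \in H by case/imsetP: Tt => g Hg ->; rewrite groupJ.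
  have t2 : t * t = 1 by case/imsetP: Tt => g Hg ->; rewrite -conjMg -(expgS i 1) i2 conj1g.
  have -> : y ^ h = (y ^ (h * t)) ^ t by rewrite -conjgM -mulgA t2 mulg1.
  have := fixj (h * t) (groupM Hh Ht) jht; rewrite !in_set2.
  by case/orP=> /eqP->; rewrite ?conjVg invK // ?invgK eqxx ?orbT.
have swap e0 e : e0 \in J -> e \in E -> e \notin [set 1; e0] ->
    exists2 t, t \in i ^: H & e ^ t = e * e0.
  case/imsetP=> g Hg -> Ee ne; exists (i ^ g); first exact: memJ_class.
  have Eeg : e ^ g^-1 \in E by rewrite memJ_norm // (subsetP (normal_norm nEH)) // groupV.
  have neg : e ^ g^-1 \notin [set 1; j].
    apply: contra ne; rewrite !in_set2 => /orP[]/eqP eg; rewrite -[e](conjgKV g) eg.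
      by rewrite conj1g eqxx.
    by rewrite eqxx orbT.
  rewrite -{1}[e](conjgKV g) -conjJg nonSylow_swap // conjMg conjgKV //.
have [_ ntj' _] := nonSylow_J Jj'.
have jj'_ne1 : j * j' != 1.
  rewrite -eq_invg_mul; apply: contra nj'j => /eqP<-.
  by rewrite eq_invg_mul -(expgS j 1) j2.
have : j ^ h \in J by rewrite memJ_class.
have Jjj' : j * j' \in J by rewrite nonSylow_defJ !inE eqxx !orbT.
have j'V := involutionV j'2.
rewrite {1}nonSylow_defJ 2!in_setU !in_set1 -!orbA => /or3P[] /eqP jh.
- exact: fixj.
- have [|t Tt j't] := swap (j * j') j' Jjj' Ej'.
    rewrite in_set2 negb_or ntj' eq_sym -[X in _ != X]mul1g (inj_eq (mulIg _)) //.
  apply: (moved t) => //; rewrite conjgM jh j't (centsP abE j Ej j' Ej').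
  by rewrite mulgA -(expgS j' 1) j'2 mul1g.
have [|t Tt jt] := swap j' (j * j') Jj' (groupM Ej Ej').
  rewrite in_set2 negb_or jj'_ne1 -[X in _ != X]mul1g (inj_eq (mulIg _)) //.
by apply: (moved t) => //; rewrite conjgM jh jt -mulgA -(expgS j' 1) j'2 mulg1.
Qed.

Lemma nonSylow_order24 : D :=: E -> #|H| = 24 /\ #|'C_H[j]| = 8.
Proof.
move=> DE; have E4 : #|E| = 4.
  by rewrite nonSylow_defE card_four_set //; have [] := nonSylow_J Jj'.
have C8 : #|'C_H[j]| = 8.
  apply/eqP; rewrite eqn_leq; apply/andP; split.
    apply: (@leq_trans #|E :|: E :* i|).
      apply/subset_leq_card/subsetP=> h /setIP[Hh /cent1P cjh].
      have jh : j ^ h = j by apply/conjg_fixP/commgP/commute_sym.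
      rewrite inE mem_rcoset iV -DE.
      by have [->|->] := nonSylow_fix_j Hh jh; rewrite ?orbT.
    by apply: leq_trans (leq_card_setU _ _) _; rewrite card_rcoset E4.
  have sPC : P \subset 'C_H[j] by rewrite subsetI sPH.
  apply: leq_trans (subset_leq_card sPC).
  have dv4 : 4 %| #|P| by rewrite -V4 cardSg.
  by move: gtP; case/dvdnP: dv4 => [[|[|k]]] -> //.
split=> //; rewrite -(Lagrange (subsetIl H 'C[j])) C8 index_cent1 -/J nonSylow_defJ.
have jj'_ne1 : j * j' != j by rewrite -[X in _ != X]mulg1 (inj_eq (mulgI j)); have [] := nonSylow_J Jj'.
have jj'_nej' : j * j' != j' by rewrite -[X in _ != X]mul1g (inj_eq (mulIg _)).
rewrite setUC cardsU1 cards2 !inE negb_or jj'_ne1 jj'_nej' (eq_sym j) nj'j //.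
Qed.

(** [H] has order 24. For [x] outside [E], the centralizer has order below 8: either it meets [E]
    trivially and has order at most 6, or it lies properly inside some ['C_H[e]] of order 8. *)
Lemma nonSylow_cent_order x : D :=: E -> x \in H^# ->
  (exists k, #|'C_H[x]| = (#[x] * k)%N /\ (k = 1%N \/ prime k)) \/
  [/\ #|'C_H[x]| = 8, #[x] = 2 & exists2 g, g \in H & (x ^ g \in V) && (x ^ g != i)].
Proof.
move=> DE /setD1P[ntx Hx]; have [H24 C8] := nonSylow_order24 DE.
have CJ8 e : e \in J -> #|'C_H[e]| = 8.
  by case/imsetP=> g Hg ->; rewrite cent1J -{1}(conjGid Hg) -conjIg cardJg.
have JE e : e \in E -> e != 1 -> e \in J.
  rewrite nonSylow_defE nonSylow_defJ in_set4.
  by case/or4P=> /eqP->; rewrite ?eqxx // => _; rewrite 2!in_setU !in_set1 eqxx ?orbT.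
have [Ex | nEx] := boolP (x \in E).
  right; split; first exact/CJ8/JE.
    by apply: nt_prime_order => //; apply: expE.
  have /imsetP[g Hg ->] := JE x Ex ntx.
  by exists g^-1; rewrite ?groupV // conjgK Vj.
left; have Cx : x \in 'C_H[x] by rewrite inE Hx cent1id.
have /dvdnP[k def_k] := order_dvdG Cx; exists k; rewrite mulnC; split=> //.
have gto : 1 < #[x] by rewrite order_gt1.
have gtk : 0 < k by have := cardG_gt0 'C_H[x]%G; rewrite def_k muln_gt0 => /andP[].
suff: k <= 3 by case: k gtk {def_k} => [|[|[|[|]]]] //; [left | right | right].
rewrite leqNgt; apply/negP=> k4; have : 8 <= #|'C_H[x]| by rewrite def_k; apply: leq_mul k4 gto.
rewrite leqNgt => /negP[]; have E4 : #|E| = 4.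
  by rewrite nonSylow_defE card_four_set //; have [] := nonSylow_J Jj'.
have [tiE | ] := eqVneq ('C_H[x] :&: E) 1.
  have sCE : 'C_H[x] * E \subset H by rewrite mul_subG ?subsetIl ?(normal_sub nEH).
  have := subset_leq_card sCE; rewrite TI_cardMg // E4 H24.
  by rewrite -[24]/(6 * 4)%N leq_pmul2r // => le6; apply: leq_ltn_trans le6 _.
case/trivgPn=> e /setIP[Ce Ee] nte; have [He /cent1P cxe] := setIP Ce.
have e2 := expE Ee.
rewrite -(CJ8 e (JE e Ee nte)); apply: proper_card; rewrite properE; apply/andP; split.
  apply/subsetP=> w Cw; have [Hw /cent1P cxw] := setIP Cw; rewrite inE Hw.
  apply/cent1P/commute_sym/commgP/conjg_fixP.
  apply: contraNeq nEx => new; rewrite -DE inE Hx -sub_cent1.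
  have Eew : e ^ w \in E by rewrite memJ_norm // (subsetP (normal_norm nEH)).
  have -> : E :=: [set 1; e; e ^ w; e * e ^ w].
    apply/eqP; rewrite eq_sym eqEcard E4 card_four_set //; last first.
      by rewrite -(conj1g w) (inj_eq (conjg_inj w)).
    rewrite andbT; apply/subsetP=> z; rewrite in_set4.
    by case/or4P=> /eqP-> //; apply: groupM.
  have cxew : e ^ w \in 'C[x].
    have <- : x ^ w = x by apply/conjg_fixP/commgP/commute_sym.
    by rewrite cent1J memJ_conjg; apply/cent1P.
  have cxe' : e \in 'C[x] by apply/cent1P.
  apply/subsetP=> z; rewrite in_set4.
  by case/or4P=> /eqP-> //; apply: groupM.
apply: contra nEx => sC; rewrite -DE inE Hx -sub_cent1.
have sEC : E \subset 'C_H[e] by rewrite subsetI (normal_sub nEH) sub_cent1 (subsetP abE).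
exact: subset_trans (subset_trans sEC sC) (subsetIr _ _).
Qed.

Lemma nonSylow_trichotomy :
  (exists y, [/\ y \in H^#, odd #[y] & #|H : 'C_H[y]| <= 2]) \/
  (forall x, x \in H^# ->
    (exists k, #|'C_H[x]| = (#[x] * k)%N /\ (k = 1%N \/ prime k)) \/
    [/\ #|'C_H[x]| = 8, #[x] = 2 & exists2 g, g \in H & (x ^ g \in V) && (x ^ g != i)]).
Proof.
have cDE : D \subset 'C(E) := subsetIr _ _.
have sND : 'N_D(E) \subset 'C(E) := subset_trans (subsetIl _ _) cDE.
have [K [nKD p'K defD]] := Burnside_normal_complement nonSylow_SylowD abE sND.
have [K1 | ntK] := eqVneq (K : {set gT}) 1.
  right=> x; apply: nonSylow_cent_order; by rewrite -defD K1 mul1g.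
left; have sKD := normal_sub nKD; have oddK : odd #|K| by rewrite /pgroup -odd_2'nat in p'K.
have nKH : K <| H.
  have hallK : 2^'.-Hall(D) K.
    rewrite /pHall sKD p'K -divgS // -defD TI_cardMg ?mulKn ?cardG_gt0 //.
      by rewrite pnatNK; apply: pHall_pgroup nonSylow_SylowD.
    by apply: coprime_TIg; rewrite coprime_sym (pnat_coprime (pHall_pgroup nonSylow_SylowD)).
  rewrite -(normal_Hall_pcore hallK nKD).
  exact: char_normal_trans (pcore_char _ _) nDH.
have invK : {in K, forall y, y ^ i = y^-1}.
  move=> y Ky; apply: (@involution_inverts _ K) => //.
    by rewrite (subsetP (normal_norm nKH)).
  by apply: (odd_regular (normal_sub nKH) oddK); rewrite cV /pgroup V4.
have abK := inverted_abelian invK.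
apply: (nonSylow_complement nKH oddK abK ntK).
rewrite -defD mul_subG // centsC; exact: subset_trans sKD cDE.
Qed.

End NonSylow.

(** The exceptional branch of the third alternative comes from [H] of order 24, with [x] an
    involution of the normal four-group. *)
Lemma involution_cent4 (gT : finGroupType) (H V : {group gT}) i :
    i \in H -> #[i] = 2 -> 'C_H[i] = V -> #|V| = 4 -> {in V, forall x, x ^+ 2 = 1} ->
  [\/ exists2 j, j \in H^# & j \in 'Z(H),
      exists y, [/\ y \in H^#, odd #[y] & #|H : 'C_H[y]| <= 2] |
      forall x, x \in H^# ->
        (exists k, #|'C_H[x]| = (#[x] * k)%N /\ (k = 1%N \/ prime k)) \/
        [/\ #|'C_H[x]| = 8, #[x] = 2 & exists2 g, g \in H & (x ^ g \in V) && (x ^ g != i)]].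
Proof.
move=> Hi oi cV V4 expV; have sVH : V \subset H by rewrite -cV subsetIl.
have pV : 2.-group V by rewrite /pgroup V4.
have [sylV | nsylV] := boolP (2.-Sylow(H) V).
  have [NC | nNC] := boolP ('N_H(V) \subset 'C(V)).
    have [] := centralizing_Sylow_involution Hi oi cV V4 expV sylV NC; [by constructor 1 | by constructor 2].
  constructor 3=> x Hx; left; exact: (fused_cent_order Hi oi cV V4 expV sylV nNC Hx).
have [P sylP sVP] := Sylow_superset sVH pV; have [sPH pP _] := and3P sylP.
have gtP : 4 < #|P|.
  rewrite ltnNge; apply: contra nsylV => leP; suff -> : V = P by [].
  by apply/eqP; rewrite -val_eqE eqEcard sVP V4.
have ntP : 'Z(P) != 1.
  by rewrite (center_nil_eq1 (pgroup_nil pP)) -cardG_gt1; apply: ltn_trans gtP.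
have [j /centerP[Pj cj] ntj] := trivgPn _ ntP.
have cPj : P \subset 'C[j] by apply/subsetP=> x Px; apply/cent1P/commute_sym/cj.
have Vi : i \in V by rewrite -cV inE Hi cent1id.
have Vj : j \in V.
  by rewrite -cV inE (subsetP sPH) //; apply/cent1P/cj/(subsetP sVP).
have nji : j != i.
  apply: contraTneq gtP => def_j; rewrite -leqNgt -V4 subset_leq_card // -cV subsetI sPH.
  by rewrite -def_j.
have [/existsP[j' /andP[Jj' nj'j]] | no] := boolP [exists j', (j' \in j ^: H) && (j' != j)].
  by have [] := nonSylow_trichotomy Hi oi cV V4 expV sylP sVP gtP Vj ntj nji cPj Jj' nj'j;
    [constructor 2 | constructor 3].
constructor 1; exists j; first by apply/setD1P; split=> //; apply: (subsetP sVH).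
apply/centerP; split=> [|x Hx]; first exact: (subsetP sVH).
apply/commgP/conjg_fixP; apply: contraNeq no => njx.
by apply/existsP; exists (j ^ x); rewrite memJ_class.
Qed.

(** * The commuting graph when the centre has order 2 *)

Section CentreOrder2.

Variables (gT : finGroupType) (G : {group gT}).
Hypothesis Z2 : #|'Z(G)| = 2.

Lemma centrally_closed_coset x : x \in G ->
  {in 'C_G[x], forall b, b \in 'Z(G) \/ b * x^-1 \in 'Z(G)} -> centrally_closed G x.
Proof.
move=> Gx CZ; have central z y : z \in 'Z(G) -> y \in G -> commute z y.
  by case/centerP=> _; apply.
apply/andP; split.
  apply/centsP=> b Cb c Cc; have [Gb Gc] := (subsetP (subsetIl _ _) b Cb, subsetP (subsetIl _ _) c Cc).
  have [Zb | Zb] := CZ b Cb; first exact: central.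
  have [Zc | Zc] := CZ c Cc; first exact/commute_sym/central.
  rewrite -[b](mulgKV x) -[c](mulgKV x).
  apply: commute_sym; apply: commuteM; first apply/commute_sym/central => //.
    by rewrite groupM // groupM ?groupV.
  by apply: commute_sym; apply: commuteM; [apply/commute_sym/central | apply: commute_refl].
apply/forall_inP=> y /setDP[Cy nZy]; have [/(negP nZy) // | Zyx] := CZ y Cy.
apply/subsetP=> w /setIP[Gw /cent1P cwy]; rewrite inE Gw; apply/cent1P.
have -> : x = (y * x^-1)^-1 * y by rewrite invMg invgK mulgKV.
apply: commuteM => //; apply/commuteV/commute_sym/central => //.
Qed.

(** If ['C_G[x]] meets ['C_G[y]] only in the centre, the index bound forces ['C_G[x]] into the
    centre and the coset of [x], so [x] is centrally closed. Otherwise a noncentral element joins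
    [x] to [y]. *)
Lemma hub_commuting y : y \in G :\: 'Z(G) -> #|G : 'C_G[y]| <= 2 ->
  {in G :\: 'Z(G) &, forall x x',
    [\/ centrally_closed G x, centrally_closed G x' |
      exists2 s, path (commuting_step G) x s & last x s = x' /\ size s <= 5]}.
Proof.
move=> nZy idx; have [Gy _] := setDP nZy.
have near x : x \in G :\: 'Z(G) -> centrally_closed G x \/
    exists w, [/\ w \in G :\: 'Z(G), commute x w & commute w y].
  move=> nZx; have [Gx _] := setDP nZx.
  have [cxy | ncxy] := boolP (x \in 'C[y]).
    by right; exists x; split=> //; apply/cent1P.
  have [sZ | ] := boolP ('C_G[x] :&: 'C_G[y] \subset 'Z(G)); last first.
    case/subsetPn=> w /setIP[/setIP[Gw /cent1P cwx] /setIP[_ /cent1P cwy]] nZw.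
    by right; exists w; split=> //; apply/setDP.
  left; apply: centrally_closed_coset => // b Cb; have [Gb /cent1P cbx] := setIP Cb.
  have [cby | ncby] := boolP (b \in 'C[y]).
    by left; apply: (subsetP sZ); rewrite inE Cb inE Gb.
  right; apply: (subsetP sZ); rewrite inE; apply/andP; split.
    by rewrite groupM ?groupV //= inE Gx cent1id.
  have sCG : 'C_G[y] :|: 'C_G[y] :* x \subset G.
    by rewrite subUset subsetIl mul_subG ?subsetIl ?sub1set.
  have tiC : 'C_G[y] :&: 'C_G[y] :* x = set0.
    apply/setP=> w; rewrite in_set0; apply/setIP=> -[Cw]; rewrite mem_rcoset => Cwx.
    case/negP: ncxy; have : x \in 'C_G[y].
      have -> : x = (w * x^-1)^-1 * w by rewrite invMg invgK mulgKV.
      by rewrite groupM ?groupV.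
    by case/setIP.
  have := cardsUI 'C_G[y] ('C_G[y] :* x); rewrite tiC cards0 addn0 card_rcoset => cardU.
  have defG : 'C_G[y] :|: 'C_G[y] :* x = G.
    apply/eqP; rewrite eqEcard sCG cardU addnn -mul2n -(Lagrange (subsetIl G 'C[y])) mulnC.
    by rewrite leq_mul2r idx orbT.
  move: Gb; rewrite -{1}defG inE mem_rcoset => /orP[/setIP[_] | //].
  by rewrite (negPf ncby).
move=> x x' nZx nZx'; have [|[w [nZw cxw cwy]]] := near x nZx; first by constructor 1.
have [|[w' [nZw' cxw' cwy']]] := near x' nZx'; first by constructor 2.
constructor 3; exists [:: w; y; w'; x'] => //; rewrite /= nZw nZy nZw' nZx' /= andbT.
by apply/and4P; split; apply/cent1P => //; apply: commute_sym.
Qed.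

Let nZ : G \subset 'N('Z(G)) := normal_norm (center_normal G).
Let H := (G / 'Z(G))%G.

Let coset_neq1 x : x \in G :\: 'Z(G) -> coset 'Z(G) x \in H^#.
Proof.
move=> /setDP[Gx nZx]; apply/setD1P; split; last exact: mem_quotient.
by apply: contra nZx => /eqP/coset_idr; apply; apply: (subsetP nZ).
Qed.

Let coset_eqZ a b : a \in G -> b \in G ->
  coset 'Z(G) a = coset 'Z(G) b -> b^-1 * a \in 'Z(G).
Proof.
move=> Ga Gb eq_c; have [Na Nb] := (subsetP nZ a Ga, subsetP nZ b Gb).
have e : coset 'Z(G) (b^-1 * a) = (coset 'Z(G) b)^-1 * coset 'Z(G) a.
  by rewrite morphM ?groupV // morphV.
by apply: coset_idr; rewrite ?groupM ?groupV // [LHS]e eq_c mulVg.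
Qed.

(** Commutators with [y] are central, so the class of [y] lies in one coset of the centre, which has
    two elements. *)
Lemma hub_of_central j : j \in H^# -> j \in 'Z(H) ->
  exists2 y, y \in G :\: 'Z(G) & #|G : 'C_G[y]| <= 2.
Proof.
case/setD1P=> ntj /morphimP[y Ny Gy def_j] /centerP[_ cj]; exists y.
  rewrite inE Gy andbT; apply: contra ntj => Zy; rewrite def_j; apply/eqP.
  exact: coset_id.
rewrite index_cent1 -Z2 -(card_lcoset _ y); apply/subset_leq_card/subsetP=> _ /imsetP[g Gg ->].
have Ng := subsetP nZ g Gg.
rewrite mem_lcoset -commgEl; apply: coset_idr; first by rewrite groupR.
rewrite morphR //; apply/eqP/commgP; have := cj (coset 'Z(G) g) (mem_quotient _ Gg).
by rewrite def_j.
Qed.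

(** Conjugates of [y] with the same image differ by a central [z]. Their powers with exponent [#[j]]
    are central, hence equal, so [z ^+ #[j] = 1]; as [#[j]] is odd and [z ^+ 2 = 1], [z] is trivial.
    The class of [y] is thus no larger than that of [j]. *)
Lemma hub_of_odd j : j \in H^# -> odd #[j] -> #|H : 'C_H[j]| <= 2 ->
  exists2 y, y \in G :\: 'Z(G) & #|G : 'C_G[y]| <= 2.
Proof.
case/setD1P=> ntj /morphimP[y Ny Gy def_j] oddj idx; exists y.
  rewrite inE Gy andbT; apply: contra ntj => Zy; rewrite def_j; apply/eqP.
  exact: coset_id.
move: idx; rewrite !index_cent1; apply: leq_trans.
have inj : {in y ^: G &, injective (coset 'Z(G))}.
  move=> _ _ /imsetP[g Gg ->] /imsetP[h Gh ->] eq_c.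
  have [Gyg Gyh] : y ^ g \in G /\ y ^ h \in G by rewrite !groupJ.
  have Zz : (y ^ h)^-1 * y ^ g \in 'Z(G).
    exact: coset_eqZ.
  set z := _ * _ in Zz; have def_yg : y ^ g = y ^ h * z by rewrite mulKVg.
  have z2 : z ^+ 2 = 1 by apply/eqP; rewrite -order_dvdn -Z2 order_dvdG.
  have Zyn : y ^+ #[j] \in 'Z(G).
    by apply: coset_idr; rewrite ?groupX // morphX // -def_j expg_order.
  have fixZ k : k \in G -> (y ^ k) ^+ #[j] = y ^+ #[j].
    move=> Gk; rewrite -conjXg; apply/conjg_fixP/commgP.
    by case/centerP: Zyn => _; apply.
  have zn : z ^+ #[j] = 1.
    apply: (mulgI ((y ^ h) ^+ #[j])); rewrite -expgMn; last first.
      by case/centerP: Zz => _ /(_ _ Gyh)/commute_sym.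
    by rewrite -def_yg !fixZ // mulg1.
  suff z1 : z = 1 by rewrite def_yg z1 mulg1.
  rewrite -(expg1 z) -(odd_double_half #[j]) oddj -muln2 mulnC expgD expgM z2 expg1n mulg1 in zn.
  by rewrite -(expg1 z).
rewrite -(card_in_imset inj); apply/subset_leq_card/subsetP=> _ /imsetP[_ /imsetP[g Gg ->] ->].
rewrite morphJ ?(subsetP nZ) // def_j; apply: memJ_class; exact: mem_quotient.
Qed.

Variable v : gT.
Hypotheses (nZv : v \in G :\: 'Z(G)) (C4 : #|'C_G[v]| = 4).

Let Gv : v \in G. Proof. by case/setDP: nZv. Qed.
Let i := coset 'Z(G) v.
Let sZC x : x \in G -> 'Z(G) \subset 'C_G[x].
Proof.
move=> Gx; rewrite subsetI center_sub /=; apply/subsetP=> z /centerP[_ cz].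
by apply/cent1P/cz.
Qed.

Let Hi : i \in H. Proof. exact: mem_quotient. Qed.

Lemma centre2_quotient_cent : ('C_G[v] / 'Z(G))%g = [set 1; i].
Proof.
have ntI : i != 1 by case/setD1P: (coset_neq1 nZv).
apply/eqP; rewrite eq_sym eqEcard cards2 eq_sym ntI card_quotient; last first.
  by rewrite subIset // nZ.
rewrite -divgS ?sZC // C4 Z2 andbT subUset !sub1set group1.
by rewrite mem_quotient // inE Gv cent1id.
Qed.

Lemma centre2_order_i : #[i] = 2.
Proof.
have ntI : i != 1 by case/setD1P: (coset_neq1 nZv).
apply: nt_prime_order => //; apply/eqP; rewrite -order_dvdn.
have Ci : i \in ('C_G[v] / 'Z(G))%G by rewrite mem_quotient // inE Gv cent1id.
have := order_dvdG Ci; rewrite card_quotient; last by rewrite subIset // nZ.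
by rewrite -divgS ?sZC // C4 Z2.
Qed.

(** Commutators of [v] with elements of [B] are central, so [v] has at most two conjugates under
    [B], and its centralizer in [B] has order at most 4. *)
Lemma centre2_preimage : exists B : {group gT},
  [/\ 'Z(G) \subset B, B \subset G, v \in B & (B / 'Z(G))%g = 'C_H[i]] /\ #|B| <= 8.
Proof.
have [B defB sZB sBG] := inv_quotientS (center_normal G) (subsetIl H 'C[i]).
have Bv : v \in B.
  have : i \in (B / 'Z(G))%g by rewrite -defB inE Hi cent1id.
  case/morphimP=> w Nw Bw eq_c.
  have Zwv : w^-1 * v \in 'Z(G) by apply: coset_eqZ => //; apply: (subsetP sBG).
  by rewrite -(groupMl _ (_ : w^-1 \in B)) ?groupV // (subsetP sZB).
exists B; split=> //.
rewrite -(Lagrange (subsetIl B 'C[v])) index_cent1 -[8]/(4 * 2)%N; apply: leq_mul.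
  by rewrite -C4 subset_leq_card // setSI.
rewrite -Z2 -(card_lcoset _ v); apply/subset_leq_card/subsetP=> _ /imsetP[b Bb ->].
have Gb := subsetP sBG b Bb; have Nb := subsetP nZ b Gb.
rewrite mem_lcoset -commgEl; apply: coset_idr; first by rewrite groupR // (subsetP nZ).
rewrite morphR ?(subsetP nZ) //; apply/eqP/commgP.
have : coset 'Z(G) b \in 'C_H[i] by rewrite defB mem_quotient.
by case/setIP=> _ /cent1P/commute_sym.
Qed.

Lemma centre2_commuting : {in G :\: 'Z(G) &, forall x x',
    [\/ centrally_closed G x, centrally_closed G x' |
      exists2 s, path (commuting_step G) x s & last x s = x' /\ size s <= 5]}.
Proof.
have oi := centre2_order_i; have [B [[sZB sBG Bv defB] leB]] := centre2_preimage.
have cardB : #|B| = (2 * #|'C_H[i]|)%N.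
  rewrite -defB card_quotient; last exact: subset_trans sBG nZ.
  by rewrite -Z2 Lagrange.
have Ci : i \in 'C_H[i] by rewrite inE Hi cent1id.
have hub y : y \in G :\: 'Z(G) -> #|G : 'C_G[y]| <= 2 -> _ := @hub_commuting y.
have gtH : 2 < #|H|.
  rewrite ltnNge; apply/negP=> leH; have [_ /negP[]] := setDP nZv.
  have cycH : cyclic (G / 'Z(G)).
    have [H1 | ntH] := eqVneq (H : {set _}) 1; first by rewrite H1 cyclic1.
    apply: prime_cyclic; have : 1 < #|H| by rewrite cardG_gt1.
    by case: #|H| leH => [|[|[|]]].
  have := cyclic_center_factor_abelian cycH => abG.
  by apply/centerP; split=> // x Gx; apply: (centsP abG).
have dvC : #|'C_H[i]| %| 4 /\ 2 %| #|'C_H[i]|.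
  have dv2 : 2 %| #|'C_H[i]| by rewrite -oi order_dvdG.
  split=> //; have : #|'C_H[i]| <= 4 by rewrite -(@leq_pmul2l 2) // -cardB.
  by case/dvdnP: dv2 (cardG_gt0 'C_H[i]%G) => [[|[|[|k]]]] -> //; rewrite ltnn.
have {dvC} [C2 | CH4] : #|'C_H[i]| = 2 \/ #|'C_H[i]| = 4.
  have [dv4 /dvdnP[k def_k]] := dvC; have := dvdn_leq (isT : 0 < 4) dv4.
  by rewrite def_k in dv4 *; case: k {def_k} dv4 => [|[|[|k]]] //; [left | right].
  have cI : 'C_H[i] = <[i]>.
    by apply/eqP; rewrite eq_sym eqEcard cycle_subG Ci C2 -[#|<[i]>|]/#[i] oi.
  have [j [Hj oddj idx]] := self_centralizing_involution Hi oi cI gtH.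
  have [y nZy idy] := hub_of_odd Hj oddj idx; exact: hub nZy idy.
pose V := 'C_H[i]%G.
(* A cyclic [V] of order 4 would make [B] abelian, hence contained in ['C_G[v]] of order 4, although
   [B] has order 8. *)
have expV : {in V, forall x, x ^+ 2 = 1}.
  move=> x Vx; apply/eqP; apply: contraLR isT => nx2.
  have V4 : #|V| = 4 by [].
  have defV : V :=: <[x]>.
    apply/eqP; rewrite eq_sym eqEcard cycle_subG Vx V4 /=.
    have := order_dvdG Vx; rewrite V4 => dv4.
    move: nx2; rewrite -order_dvdn -[#|<[x]>|]/#[x].
    by case: #[x] dv4 => [|[|[|[|n]]]].
  have abB : abelian B.
    apply: (@cyclic_factor_abelian _ 'Z(G)%G B).
      rewrite subsetI sZB /=; apply: subset_trans (subsetIr _ _) (centS sBG).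
    by rewrite defB -/(gval V) defV cycle_cyclic.
  have : #|B| <= 4.
    by rewrite -C4 subset_leq_card // subsetI sBG sub_cent1 (subsetP abB).
  by rewrite cardB CH4.
have [[j Hj Zj] | [j [Hj oddj idx]] | centH] := involution_cent4 Hi oi (erefl (gval V)) CH4 expV.
- by have [y nZy idy] := hub_of_central Hj Zj; apply: hub nZy idy.
- by have [y nZy idy] := hub_of_odd Hj oddj idx; apply: hub nZy idy.
move=> x x' nZx _; constructor 1; apply: abelian_cent_closed (nZx) => {nZx x'}{}x nZx.
have [Gx _] := setDP nZx; set C := 'C_G[x]%G; set xb := coset 'Z(G) x.
have Hxb : xb \in H^# := coset_neq1 nZx.
have sCG : C \subset G := subsetIl _ _.
have nZC : C \subset 'N('Z(G)) := subset_trans sCG nZ.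
have sCbC : (C / 'Z(G))%g \subset 'C_H[xb].
  apply/subsetP=> _ /morphimP[w Nw /setIP[Gw /cent1P cwx] ->].
  rewrite inE mem_quotient //=; apply/cent1P; rewrite /commute -!morphM ?(subsetP nZ) //.
  by rewrite cwx.
have Cx : x \in C by rewrite inE Gx cent1id.
have Cxb : xb \in (C / 'Z(G))%g by rewrite mem_quotient.
pose M := ('Z(G) <*> <[x]>)%G.
have sMC : M \subset 'Z(C).
  rewrite join_subG cycle_subG; apply/andP; split.
    rewrite subsetI sZC //=; apply: subset_trans (subsetIr _ _) (centS sCG).
  by apply/centerP; split=> // w /setIP[_ /cent1P].
have MbE : (M / 'Z(G))%g = <[xb]>.
  by rewrite quotientYidl ?cycle_subG ?(subsetP nZ) // quotient_cycle // (subsetP nZ).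
have [k [def_k primek]] : exists k, #|(C / 'Z(G))%g| = (#[xb] * k)%N /\ (k = 1%N \/ prime k).
  have /dvdnP[k def_k] := order_dvdG Cxb; have dvC := cardSg sCbC.
  have oxb : 0 < #[xb] := order_gt0 xb.
  exists k; rewrite mulnC; split=> //.
  have [[k' [def_k' pr_k']] | [C8 o2 [g Hg /andP[Vxg nxg]]]] := centH xb Hxb.
    move: dvC; rewrite /= def_k def_k' mulnC dvdn_pmul2l //.
    by case: pr_k' => [-> | pr_k']; [rewrite dvdn1 => /eqP; left | case/(primeP pr_k').2/pred2P=> ->; [left | right]].
  (* If these were equal, the conjugate of [i] that commutes with [xb] would lift to a conjugate of
     [v] that commutes with [x], which puts [xb ^ g] into [[set 1; i]]. *)
  have neC : (C / 'Z(G))%g != 'C_H[xb].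
    apply: contra nxg => /eqP defC.
    have [g0 Ng0 Gg0 def_g] := morphimP Hg.
    have xg : xb ^ g = coset 'Z(G) (x ^ g0) by rewrite def_g morphJ ?(subsetP nZ).
    have vg : i ^ g^-1 = coset 'Z(G) (v ^ g0^-1).
      by rewrite def_g -morphV // morphJ ?groupV ?(subsetP nZ).
    have : i ^ g^-1 \in 'C_H[xb].
      rewrite inE groupJ ?groupV //= -mem_conjg -cent1J cent1C.
      by case/setIP: Vxg.
    rewrite -defC vg => /morphimP[w Nw Cw eq_c].
    have Gvg : v ^ g0^-1 \in G by rewrite groupJ ?groupV.
    have Zw := coset_eqZ Gvg (subsetP sCG w Cw) eq_c.
    have : v ^ g0^-1 \in C.
      by rewrite -(groupMl _ (_ : w^-1 \in C)) ?groupV // (subsetP (sZC Gx)).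
    case/setIP=> _; rewrite -mem_conjg -cent1J cent1C => cxv.
    have : xb ^ g \in ('C_G[v] / 'Z(G))%g.
      by rewrite xg mem_quotient // inE groupJ.
    rewrite centre2_quotient_cent in_set2 => /orP[|//].
    by rewrite -(conj1g g) (inj_eq (conjg_inj g)); case/setD1P: Hxb => /negPf->.
  have : #|(C / 'Z(G))%g| < 8.
    by rewrite -C8 proper_card // properEneq neC.
  have := cardG_gt0 (C / 'Z(G))%G.
  move: dvC; rewrite /= C8 def_k o2.
  by case: k {def_k} => [|[|[|[|k]]]] //; [left | right].
(* [M] is central in [C], and the quotient has order [k], which is 1 or prime. *)
apply: (@cyclic_factor_abelian _ M C sMC).
have cardCM : #|(C / M)%g| = k.
  have nMC : C \subset 'N(M) by apply: cents_norm; rewrite centsC (subset_trans sMC) ?subsetIr.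
  have sMC' : M \subset C := subset_trans sMC (center_sub C).
  have sZM : 'Z(G) \subset M := joing_subl _ _.
  have := card_quotient nZC; rewrite def_k => idC.
  have := card_quotient (subset_trans sMC' nZC); rewrite MbE -[#|<[xb]>|]/#[xb] => idM.
  rewrite card_quotient // -divgS //.
  rewrite -(Lagrange sZM) -idM -(Lagrange (sZC Gx)) -idC mulnA mulKn //.
  by rewrite muln_gt0 cardG_gt0 order_gt0.
have [k1 | prk] := primek; last by apply: prime_cyclic; rewrite cardCM.
by rewrite (card1_trivg (_ : #|(C / M)%g| = 1%N)) ?cyclic1 // cardCM.
Qed.

End CentreOrder2.

(* A clique of two vertices forces C_G(v) = Z(G) u {v, w}, so #|Z(G)| <= 2. *)
Lemma isolated_edge_cent (gT : finGroupType) (G : {group gT}) :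
    (exists E : {set noncentral G}, E \in isolated_edges (commuting_graph G)) ->
  exists2 v, v \in G :\: 'Z(G) &
    'Z(G) = 1 /\ #|'C_G[v]| = 3 \/ #|'Z(G)| = 2 /\ #|'C_G[v]| = 4.
Proof.
case=> E; rewrite inE => /andP[compE /existsP[v /existsP[w /andP[evw /eqP defE]]]].
have [Gv nZv] := setDP (valP v); have [Gw nZw] := setDP (valP w).
have /andP[neq_vw cvw'] := evw.
exists (val v); first exact: valP.
have cvw : commute (val v) (val w) := eqP cvw'.
have adj x : commuting_graph G v x -> x \in [set v; w].
  have Ev : v \in E by rewrite defE set21.
  rewrite -defE; case/imsetP: compE Ev => x0 _ ->; rewrite !inE => x0v evx.
  exact: connect_trans x0v (connect1 evx).
have ZC : 'Z(G) \subset 'C_G[val v].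
  apply/subsetP=> z /centerP[Gz cz]; apply/setIP; split=> //; exact/cent1P/cz.
have defC : 'C_G[val v] = 'Z(G) :|: [set val v; val w].
  have Cv : val v \in 'C_G[val v] by apply/setIP; rewrite cent1id.
  have Cw : val w \in 'C_G[val v] by apply/setIP; split=> //; apply/cent1P/commute_sym.
  apply/eqP; rewrite eqEsubset !subUset ZC !sub1set Cv Cw !andbT.
  apply/subsetP=> x /setIP[Gx /cent1P cxv]; rewrite in_setU.
  have [// | nZx /=] := boolP (x \in 'Z(G)).
  have nZx' : x \in G :\: 'Z(G) by apply/setDP.
  have [-> | nxv] := eqVneq x (val v); first exact: set21.
  have : Sub x nZx' \in [set v; w].
    by apply: adj; rewrite commuting_graphE SubK -(inj_eq val_inj) SubK eq_sym nxv; apply/eqP.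
  by rewrite !in_set2 -!(inj_eq val_inj) SubK.
have cardC : #|'C_G[val v]| = (#|'Z(G)| + 2)%N.
  rewrite defC; have <- : #|[set val v; val w]| = 2 by rewrite cards2 (inj_eq val_inj) neq_vw.
  have := cardsUI 'Z(G) [set val v; val w]; rewrite (_ : _ :&: _ = set0) ?cards0 ?addn0 //.
  by apply/setP=> x; rewrite in_set0; apply/setIP=> [[Zx /set2P[] def_x]]; rewrite def_x in Zx; [case/negP: nZv | case/negP: nZw].
have dvZ : #|'Z(G)| %| 2.
  by rewrite -(@dvdn_addr #|'Z(G)|) // -cardC cardSg.
case/(primeP (isT : prime 2)).2/pred2P: dvZ => Z; [left | right]; rewrite cardC Z //.
by split=> //; apply: card1_trivg.
Qed.

Theorem theorem1p3 (gT : finGroupType) (G : {group gT}) :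
  (exists E : {set noncentral G}, E \in isolated_edges (commuting_graph G)) ->
  #|components (commuting_graph G) :\:
      (isolated_edges (commuting_graph G) :|: cliques (commuting_graph G))| <= 1
  /\ (forall C : {set noncentral G},
        C \in components (commuting_graph G) ->
        C \notin cliques (commuting_graph G) ->
        diameter (commuting_graph G) C <= 5).
Proof.
move/isolated_edge_cent=> [v nZv [[Z1 C3] | [Z2 C4]]]; apply: commuting_graph_theorem; last first.
  exact: centre2_commuting Z2 _ nZv C4.
have [Gv nv] := setDP nZv; have Cv : v \in 'C_G[v] by rewrite inE Gv cent1id.
have ov : #[v] = 3.
  have := order_dvdG Cv; rewrite C3; case/(primeP (isT : prime 3)).2/pred2P=> // /eqP.
  by rewrite order_eq1 => /eqP v1; rewrite v1 group1 in nv.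
apply: (sc3_commuting Gv ov _ Z1).
by apply/eqP; rewrite eq_sym eqEcard cycle_subG Cv C3 -[#|<[v]>|]/#[v] ov.
Qed.
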